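(* Let $G$ be a finite simple connected graph on $n\geq 3$ vertices, and let $\mathcal S_G=\{v\in V(G)\mid \deg_G(v)=n-1\}$. The action of $\operatorname{Aut}(G)$ on $G$ restricts to an action on $\mathcal S_G$, and hence induces an action of $\operatorname{Aut}(G)$ on the complete graph $K_{\mathcal S_G}$ with vertex set $\mathcal S_G$ (regarded as a 1-dimensional topological space). There exists an $\operatorname{Aut}(G)$-equivariant embedding $K_{\mathcal S_G}\hookrightarrow X_G$ and an $\operatorname{Aut}(G)$-equivariant strong deformation retraction \[ X_G\simeq K_{\mathcal S_G}\sqcup D_G \] of $X_G$ onto the disjoint union of (the image of) $K_{\mathcal S_G}$ and $D_G$, where $D_G$ is a discrete $\operatorname{Aut}(G)$-space. In particular, after forgetting the $\operatorname{Aut}(G)$-action, the only component of $X_G$ with possibly non-trivial homotopy is homotopy equivalent to the complete graph $K_{\mathcal S_G}$. If $k=|\mathcal S_G|\geq 2$, then this is a wedge of $(k-1)(k-2)/2$ circles.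
   Context: A network realignment $N=(T,r)$ over $G$ consists of a partition $V(G)=A\sqcup B$ with $|A|\ge 2$ ($B$ may be empty), a tree $T$ that is a subgraph of $G$ with vertex set $A$, and a map $r\colon B\to E(T)$ such that $(b,v),(b,w)\in E(G)$ whenever $b\in B$ and $r(b)=(v,w)$. For $b\in B$ and an endpoint $v$ of $r(b)$, the specification $N^{b\to v}$ is the network realignment with vertex partition $A\cup\{b\}$, $B\setminus\{b\}$, tree obtained from $T$ by adding the vertex $b$ and the edge $(v,b)$, and map $r|_{B\setminus\{b\}}$. $P_G$ is the poset of all network realignments over $G$, with partial order generated by the covering relations $N\succ N^{b\to v}$. Each lower ideal $P_G^{\le N}$ is the face poset of a cube of dimension $|B|$, and $X_G$, the network realignment complex, is the finite cubical complex with face poset $P_G$ (i.e. the geometric realisation $|\Delta(P_G)|$ with this cubical structure); its vertices are the spanning trees of $G$. The group $\operatorname{Aut}(G)$ acts on $P_G$, and hence on $X_G$, by $gN=(gT,gr)$, where $gT$ is the image tree and $(gr)(gb)=g(r(b))$. A $\Lambda$-equivariant strong deformation retraction of a $\Lambda$-space $X$ onto a $\Lambda$-invariant subspace $U$ is a homotopy $H\colon X\times[0,1]\to X$ from the identity to a retraction onto $U$, fixing $U$ pointwise at all times, with $H(gx,t)=gH(x,t)$ for all $g\in\Lambda$. *)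

(* Defs.v *)
From HB Require Import structures.
From mathcomp Require Import all_boot all_order all_fingroup all_algebra.
From mathcomp Require Import all_classical all_reals all_analysis.
From mathcomp Require Import homotopy.
Import numFieldNormedType.Exports.
Import Order.TTheory GRing.Theory Num.Theory.

Set Implicit Arguments.
Unset Strict Implicit.
Unset Printing Implicit Defensive.

Local Open Scope classical_set_scope.
Local Open Scope ring_scope.

Section Homotopy.
Context (R : realType).

(* A homotopy is a map on [X * R] of which only the restriction to
   [X * [0, 1]] matters. *)
Definition homotopy_continuous (X Y : topologicalType) (H : X * R -> Y) :=
  {within [set: X] `*` `[0, 1], continuous H}.

Definition homotopic (X Y : topologicalType) (f g : X -> Y) :=
  exists H : X * R -> Y, [/\ homotopy_continuous H,
    forall x, H (x, 0) = f x & forall x, H (x, 1) = g x].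

Definition homotopy_equivalent (X Y : topologicalType) :=
  exists (f : X -> Y) (g : Y -> X), [/\ continuous f, continuous g,
    homotopic (g \o f) id & homotopic (f \o g) id].

Definition contractible (X : topologicalType) :=
  exists x0 : X, homotopic id (fun _ : X => x0).

End Homotopy.

Definition topological_embedding (X Y : topologicalType) (f : X -> Y) :=
  injective f /\
  forall A : set X, open A <-> exists2 B : set Y, open B & A = f @^-1` B.

Section Equivariance.
Context (L : Type).

Definition invariant_set (X : Type) (act : L -> X -> X) (U : set X) :=
  forall g x, U x -> U (act g x).

Definition equivariant (X Y : Type) (actX : L -> X -> X) (actY : L -> Y -> Y)
    (f : X -> Y) :=
  forall g x, f (actX g x) = actY g (f x).

Definition equivariant_strong_deformation_retract (R : realType)
    (X : topologicalType) (act : L -> X -> X) (U : set X) :=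
  exists H : X * R -> X,
    [/\ homotopy_continuous H,
        forall x, H (x, 0) = x,
        forall x, U (H (x, 1)),
        forall t x, 0 <= t <= 1 -> U x -> H (x, t) = x
      & forall g t x, 0 <= t <= 1 -> H (act g x, t) = act g (H (x, t))].

End Equivariance.

Definition discrete_subset (X : topologicalType) (D : set X) :=
  forall A : set (set_type D), open A.

Section Bouquet.
Context (R : realType).

Definition circle : set (R * R) := [set p | p.1 ^+ 2 + p.2 ^+ 2 = 1].

Lemma circle_base_proof : ((1, 0) : R * R) \in circle.
Proof. by rewrite inE /circle /= expr1n expr0n addr0. Qed.

Definition circle_base : set_type circle := exist _ (1, 0) circle_base_proof.

(* The library's [wedge] of an empty family is empty, so a one-point space
   (index [None]) is added to the [m] circles; this only matters for [m = 0],
   where the wedge has to be a point. *)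
Definition bouquet_summand (m : nat) (i : option 'I_m) : topologicalType :=
  if i is Some _ then set_type circle else discrete_topology unit.

Definition bouquet_base (m : nat) (i : option 'I_m) : bouquet_summand i :=
  match i with
  | Some _ => circle_base
  | None => tt
  end.

Definition bouquet (m : nat) : topologicalType := wedge (@bouquet_base m).

End Bouquet.

Section Realisation.
Context (R : realType).

Definition simplicial (T U : finType) (K : {set {set T}}) (L : {set {set U}})
    (f : T -> U) :=
  forall s, s \in K -> f @: s \in L.

(* Points in barycentric coordinates, with the topology induced from
   [R ^ T]. *)
Definition realisation_set (T : finType) (K : {set {set T}}) :
    set {ptws T -> R} :=
  [set x | [/\ forall t, 0 <= x t, \sum_t x t = 1
             & [set t | x t != 0]%SET \in K]].

Definition realisation (T : finType) (K : {set {set T}}) : topologicalType :=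
  set_type (realisation_set K).

Lemma realisation_map_proof (T U : finType) (K : {set {set T}})
    (L : {set {set U}}) (f : T -> U) (fP : simplicial K L f)
    (x : realisation K) :
  ((fun u => \sum_(t | f t == u) \val x t) : {ptws U -> R})
    \in realisation_set L.
Proof.
have [x0 x1 xK] := set_valP x; rewrite inE; split.
- by move=> u; apply: sumr_ge0 => t _; exact: x0.
- by rewrite -x1 [RHS](partition_big f predT).
- rewrite (_ : [set _ | _]%SET = f @: [set t | \val x t != 0]%SET); last first.
    apply/setP => u; rewrite inE psumr_neq0; last by move=> t _; exact: x0.
    apply/hasP/imsetP => [[t _ /andP[/eqP <- xt]]|[t]].
      by exists t => //; rewrite inE gt_eqF.
    rewrite inE => xt ->; exists t; first exact: mem_index_enum.
    by rewrite eqxx /= lt_neqAle eq_sym xt x0.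
  exact: fP.
Qed.

(* The affine extension of a simplicial map. *)
Definition realisation_map (T U : finType) (K : {set {set T}})
    (L : {set {set U}}) (f : T -> U) (fP : simplicial K L f)
    (x : realisation K) : realisation L :=
  exist (fun y => y \in realisation_set L) _ (realisation_map_proof fP x).

End Realisation.

Definition order_complex (d : Order.disp_t) (P : finPOrderType d) :
    {set {set P}} :=
  [set s | (s != finset.set0) && [forall x in s, forall y in s, (x >=< y)%O]]%SET.

Lemma order_complex_simplicial (d : Order.disp_t) (P : finPOrderType d)
    (f : P -> P) (f_homo : {homo f : x y / (x <= y)%O}) :
  simplicial (order_complex P) (order_complex P) f.
Proof.
move=> s; rewrite !inE => /andP[s0 /forall_inP sC]; apply/andP; split.
  by rewrite imset_eq0.
apply/forall_inP => _ /imsetP[x xs ->].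
apply/forall_inP => _ /imsetP[y ys ->].
have /forall_inP/(_ _ ys) := sC _ xs.
by case/orP => /f_homo; rewrite /Order.comparable => ->; rewrite ?orbT.
Qed.

(* The complete graph on the vertex set [S], as a 1-dimensional complex. *)
Definition complete_graph (V : finType) (S : {set V}) : {set {set V}} :=
  [set s : {set V} | (s \subset S) && (0 < #|s| <= 2)%N]%SET.

Record simple_graph (V : finType) := SimpleGraph {
  adj :> rel V;
  adj_sym : symmetric adj;
  adj_irr : irreflexive adj
}.

Section Graph.
Context (V : finType) (G : simple_graph V).

Definition connected_graph := forall x y, connect G x y.

Definition degree (v : V) : nat := #|[set w | G v w]%SET|.

Definition universal_vertices : {set V} :=
  [set v | degree v == #|V|.-1]%SET.

Definition edges : {set {set V}} :=
  [set e : {set V} | [exists u, exists v, G u v && (e == [set u; v]%SET)]]%SET.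

Definition automorphisms : {set {perm V}} :=
  [set g : {perm V} | [forall x, forall y, G (g x) (g y) == G x y]]%SET.

Lemma automorphismsP (g : {perm V}) :
  reflect (forall x y, G (g x) (g y) = G x y) (g \in automorphisms).
Proof.
rewrite inE; apply: (iffP forallP) => [h x y|h x].
  by have /forallP/(_ y)/eqP := h x.
by apply/forallP => y; rewrite h.
Qed.

Lemma group_set_automorphisms : group_set automorphisms.
Proof.
apply/group_setP; split; first by apply/automorphismsP => x y; rewrite !perm1.
move=> g h /automorphismsP gP /automorphismsP hP.
by apply/automorphismsP => x y; rewrite !permM hP gP.
Qed.

Canonical automorphism_group := Group group_set_automorphisms.

Definition Aut_graph : Type := {g : {perm V} | g \in automorphism_group}.

Definition tree_rel (E : {set {set V}}) : rel V :=
  [rel x y | [set x; y]%SET \in E].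

(* [(A, E)] is a subgraph of [G] which is a tree. A cyclic sequence of at most
   two distinct vertices (such as an edge run back and forth) is not a cycle
   of the graph. *)
Definition is_subtree (A : {set V}) (E : {set {set V}}) : Prop :=
  [/\ E \subset edges,
      forall e, e \in E -> e \subset A,
      {in A &, forall x y, connect (tree_rel E) x y}
    & forall c, ucycle (tree_rel E) c -> (size c <= 2)%N].

End Graph.

(* [((A, E), r)]: the vertex and edge sets of the tree, and the map [r], which
   takes the dummy value [set0] (not an edge) outside [B = ~: A]. *)
Definition realignment_data (V : finType) : finType :=
  ({set V} * {set {set V}} * {ffun V -> {set V}})%type.

Section Realignment.
Context (V : finType) (G : simple_graph V).

Implicit Types (N M : realignment_data V).

Definition tree_vertices N : {set V} := N.1.1.
Definition tree_edges N : {set {set V}} := N.1.2.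
Definition attach N : {ffun V -> {set V}} := N.2.

Definition is_realignment N : Prop :=
  [/\ (2 <= #|tree_vertices N|)%N,
      is_subtree G (tree_vertices N) (tree_edges N),
      attach N \in pffun_on finset.set0 (~: tree_vertices N)%SET (tree_edges N)
    & forall b v, b \notin tree_vertices N -> v \in attach N b -> G b v].

Definition realignment := {N : realignment_data V | `[< is_realignment N >]}.

HB.instance Definition _ := Finite.on realignment.

Definition specification N (b v : V) : realignment_data V :=
  (b |: tree_vertices N, [set v; b] |: tree_edges N,
   [ffun x => if x == b then finset.set0 else attach N x])%SET.

Definition specifies : rel realignment :=
  [rel M N | [exists b, exists v,
     [&& b \notin tree_vertices (\val N), v \in attach (\val N) b
       & \val M == specification (\val N) b v]]].

Definition realignment_le : rel realignment := connect specifies.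

Lemma specifies_card (M N : realignment) : specifies M N ->
  (#|tree_vertices (\val N)| < #|tree_vertices (\val M)|)%N.
Proof.
move=> /existsP[b /existsP[v /and3P[bN _ /eqP ->]]].
by rewrite /tree_vertices /= cardsU1 bN.
Qed.

Lemma realignment_le_card (M N : realignment) : realignment_le M N ->
  M = N \/ (#|tree_vertices (\val N)| < #|tree_vertices (\val M)|)%N.
Proof.
case/connectP => p; elim: p M => [|K p IH] M /=; first by move=> _ ->; left.
case/andP => /specifies_card MK pK /IH -/(_ pK)[<-|KN]; right => //.
exact: ltn_trans KN MK.
Qed.

Lemma realignment_le_refl : reflexive realignment_le.
Proof. by move=> N; exact: connect0. Qed.

Lemma realignment_le_anti : antisymmetric realignment_le.
Proof.
move=> M N /andP[/realignment_le_card[//|NM] /realignment_le_card[//|MN]].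
by have := ltn_trans NM MN; rewrite ltnn.
Qed.

Lemma realignment_le_trans : transitive realignment_le.
Proof. by move=> N M K; exact: connect_trans. Qed.

Fact realignment_display : Order.disp_t. Proof. exact: Order.default_display. Qed.

HB.instance Definition _ := Order.Le_isPOrder.Build realignment_display
  realignment realignment_le_refl realignment_le_anti realignment_le_trans.

Definition realignment_complex (R : realType) : topologicalType :=
  realisation R (order_complex realignment).

Definition permute_data (g : {perm V}) N : realignment_data V :=
  (g @: tree_vertices N, [set g @: e | e : {set V} in tree_edges N],
   [ffun x => g @: attach N (g^-1%g x)])%SET.

Lemma tree_rel_permute (g : {perm V}) (E : {set {set V}}) x y :
  tree_rel [set g @: e | e : {set V} in E]%SET (g x) (g y) = tree_rel E x y.
Proof.
rewrite /tree_rel /=.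
rewrite (_ : [set g x; g y]%SET = g @: [set x; y]%SET); last first.
  by rewrite imsetU !imset_set1.
by rewrite mem_imset //; exact/imset_inj/perm_inj.
Qed.

Lemma permute_data_proof (g : Aut_graph G) (N : realignment) :
  `[< is_realignment (permute_data (\val g) (\val N)) >].
Proof.
case: g N => g gA [N /= /asboolP[A2 [EG EA Econn Eacyc] /pffun_onP[rB rE] rG]].
have /automorphismsP gP := gA.
apply/asboolP; split; rewrite ?/tree_vertices ?/tree_edges ?/attach /=.
- by rewrite card_imset //; exact: perm_inj.
- split.
  + apply/fintype.subsetP => _ /imsetP[e eE ->].
    have /[!inE]/existsP[u /existsP[v /andP[uv /eqP ->]]] := fintype.subsetP EG _ eE.
    apply/existsP; exists (g u); apply/existsP; exists (g v).
    by rewrite gP uv imsetU !imset_set1 eqxx.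
  + by move=> _ /imsetP[e eE ->]; apply: imsetS; exact: EA.
  + move=> _ _ /imsetP[x xA ->] /imsetP[y yA ->].
    have /connectP[p pP ->] := Econn x y xA yA.
    apply/connectP; exists (map g p); last by rewrite last_map.
    rewrite path_map; apply: sub_path pP => u v uv /=.
    by rewrite tree_rel_permute.
  + move=> c /andP[cc uc]; have := Eacyc (map g^-1%g c).
    rewrite size_map; apply; apply/andP; split; last first.
      by rewrite map_inj_uniq //; exact: perm_inj.
    rewrite cycle_map; apply: sub_cycle cc => u v /=.
    by rewrite -{1}(permKV g u) -{1}(permKV g v) tree_rel_permute.
- apply/pffun_onP; split.
    apply/fintype.subsetP => x; rewrite inE ffunE imset_eq0 => rx.
    have /[!inE] := fintype.subsetP rB (g^-1%g x) rx.
    by rewrite -{2}(permKV g x) mem_imset //; exact: perm_inj.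
  move=> _ /fintype.imageP[x + ->]; rewrite inE ffunE => xA.
  apply: imset_f; apply: rE; apply: fintype.image_f.
  by move: xA; rewrite inE -{1}(permKV g x) mem_imset //; exact: perm_inj.
- move=> b _ + /[!ffunE]/imsetP[v vr ->].
  rewrite -(permKV g b) mem_imset; last exact: perm_inj.
  by move=> bA; rewrite gP; exact: rG vr.
Qed.

Definition realignment_act (g : Aut_graph G) (N : realignment) : realignment :=
  exist (fun M => `[< is_realignment M >]) _ (permute_data_proof g N).

Lemma permute_specification (g : {perm V}) N b v :
  permute_data g (specification N b v)
    = specification (permute_data g N) (g b) (g v).
Proof.
congr (_, _, _); rewrite /tree_vertices /tree_edges /=.
- by rewrite imsetU imset_set1.
- by rewrite imsetU imset_set1 imsetU !imset_set1.
- apply/ffunP => x; rewrite /attach /= !ffunE /=.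
  have -> : (x == g b) = (g^-1%g x == b).
    by rewrite -[RHS](inj_eq (@perm_inj _ g)) permKV.
  by case: ifP => _; rewrite ?imset0.
Qed.

Lemma realignment_act_homo (g : Aut_graph G) :
  {homo realignment_act g : M N / (M <= N)%O}.
Proof.
move=> M N /connectP[p pP ->]; apply/connectP.
exists (map (realignment_act g) p); last by rewrite last_map.
rewrite path_map; apply: sub_path pP => {M N p}M N /=.
move=> /existsP[b /existsP[v /and3P[bN vN /eqP MN]]].
apply/existsP; exists (\val g b); apply/existsP; exists (\val g v).
apply/and3P; split => /=.
- by rewrite /tree_vertices /= mem_imset //; exact: perm_inj.
- by rewrite /attach /= ffunE permK imset_f.
- by rewrite MN permute_specification.
Qed.

Definition realignment_complex_act (R : realType) (g : Aut_graph G) :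
    realignment_complex R -> realignment_complex R :=
  realisation_map (order_complex_simplicial (@realignment_act_homo g)).

Lemma universal_vertices_imset (g : Aut_graph G) :
  \val g @: universal_vertices G = universal_vertices G.
Proof.
have gP : forall x y, G (\val g x) (\val g y) = G x y.
  by apply/automorphismsP; exact: (valP g).
have dg v : degree G (\val g v) = degree G v.
  rewrite /degree -[RHS](card_imset _ (@perm_inj _ (\val g))).
  congr #|pred_of_set _|; apply/setP => w; rewrite inE.
  rewrite -(permKV (\val g) w) gP mem_imset ?inE //; exact: perm_inj.
apply/setP => w; rewrite -(permKV (\val g) w).
by rewrite mem_imset ?inE ?dg //; exact: perm_inj.
Qed.

Lemma complete_graph_simplicial (g : Aut_graph G) :
  simplicial (complete_graph (universal_vertices G))
    (complete_graph (universal_vertices G)) (\val g).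
Proof.
move=> s; rewrite !inE => /andP[sS s2]; apply/andP; split.
  by rewrite -(universal_vertices_imset g) imsetS.
by rewrite card_imset //; exact: perm_inj.
Qed.

Definition complete_graph_act (R : realType) (g : Aut_graph G) :
    realisation R (complete_graph (universal_vertices G)) ->
    realisation R (complete_graph (universal_vertices G)) :=
  realisation_map (@complete_graph_simplicial g).

End Realignment.

(* Main.v *)
Require Import Defs.
From mathcomp Require Import all_boot all_order all_fingroup all_algebra.
From mathcomp Require Import all_classical all_reals all_analysis.
From mathcomp Require Import homotopy lra ring zify.
Import numFieldNormedType.Exports.
Import Order.TTheory GRing.Theory Num.Theory.

Set Implicit Arguments.
Unset Strict Implicit.
Unset Printing Implicit Defensive.

(* A network realignment is determined by its core (the tree spanned by the
   inner vertices and the edges used by [r]) together with a position in the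
   core, a vertex or an edge, for every other vertex; specification shrinks
   positions from edges to vertices. The core can only shrink under specification,
   so [X_G] can be collapsed core by core. If a leaf [u] of the core can be
   vacated, i.e. every vertex placed at [u] is also adjacent to the core
   neighbour of [u], then pushing all positions off [u] shows that the part of
   [X_G] below the cell is a cone, and the cell can be removed; removing the
   cells with the largest cores first leaves the cells with no removable leaf.
   Their cores are single universal vertices (stars), pairs of universal
   vertices (double stars, which form the subdivided edges of the complete
   graph), or cores which are frozen. A frozen core contributes a product of
   forests, one for the positions of each vertex outside the core, hence
   contractible components, and pruning the leaves of these forests retracts
   each component to a point. All steps commute with automorphisms because all
   leaves are treated simultaneously. Finally, pulling every point of the
   complete graph towards a root [s0] at unit speed, and stretching each edge
   [ab] over the triangle [s0, a, b], turns the graph into the wedge of the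
   boundaries of these triangles. *)

Local Open Scope classical_set_scope.
Local Open Scope ring_scope.

(** * Realisations and retractions *)

(** Equivariance and strength shape the construction: cells cannot be removed one after another by
    choices, and a homotopy equivalence of posets would not suffice. So one explicit formula,
    [cone_push], deforms the realisation for a whole antichain of cells at once. It uses only the
    order and equivariant data [p] and [al], so everything after it is order theory; monotone
    idempotents that go down or up are special cases. Vacating leaves in all positions
    simultaneously could empty a position. Each pruning is therefore preceded by a raising, which
    turns a singleton at a leaf into the edge to its neighbour. The remaining danger is an edge with
    both ends to be vacated. In a core this forces the core to be that edge with both ends
    universal, which is where the double stars, and so the complete graph, come from. In the forests
    of positions such edges are kept and become part of the final cells. Having three vertices
    matters because some vertex then lies outside any given pair: this makes every tree leaf outside
    the core hang at a core vertex, and puts the centre of a star into its core. *)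

Section RealisationTopology.
Context (R : realType) (T : finType) (K : {set {set T}}).
Local Notation X := (realisation R K).

Lemma realisation_ge0 (x : X) t : 0 <= \val x t.
Proof. by have [+ _ _] := set_valP x; exact. Qed.

Lemma realisation_sum (x : X) : \sum_t \val x t = 1.
Proof. by have [_ + _] := set_valP x. Qed.

Lemma realisation_supp (x : X) : [set t | \val x t != 0]%SET \in K.
Proof. by have [_ _ +] := set_valP x. Qed.

Lemma realisationP (x y : X) : (forall t, \val x t = \val y t) -> x = y.
Proof. by move=> xy; apply: val_inj; apply/funext => t; exact: xy. Qed.

Lemma realisation_coord_continuous t : continuous (fun x : X => (\val x : {ptws T -> R}) t).
Proof.
move=> x; apply: (@continuous_comp X {ptws T -> R} R (fun x : X => \val x) (fun f => f t)).
  exact: initial_continuous.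
exact: (@proj_continuous T (fun=> R) t).
Qed.


End RealisationTopology.

Lemma continuous_ptws (R : realType) (Y : topologicalType) (U : choiceType)
    (F : Y -> {ptws U -> R}) :
  (forall t, continuous (fun y => F y t)) -> continuous F.
Proof.
move=> cF y; apply/cvg_sup => t; apply/cvg_image.
  by rewrite eqEsubset; split => // r _; exists (fun=> r).
move=> A /= At; have := cF t y A At; rewrite /= => nA.
exists ((fun g : U -> R => g t) @^-1` A) => //.
by apply: image_preimage; rewrite eqEsubset; split => // r _; exists (fun=> r).
Qed.

Lemma continuous_set_type (X Y : topologicalType) (A : set Y) (F : X -> set_type A) :
  continuous (fun x => \val (F x)) -> continuous F.
Proof.
by move=> cF x U [_ [[B oB <-]] /= Bx BU]; apply: (filterS BU); apply: cF;
  exact: open_nbhs_nbhs.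
Qed.

Lemma continuous_val (Y : topologicalType) (A : set Y) :
  continuous (fun x : set_type A => \val x).
Proof. exact: initial_continuous. Qed.

(** Lets a homotopy be given by coordinate formulas that are continuous everywhere but describe
    points of the realisation only over [W]. *)
Lemma within_realisation (R : realType) (T : finType) (K : {set {set T}})
    (Y : topologicalType) (W : set Y) (F : Y -> realisation R K)
    (f : Y -> {ptws T -> R}) :
  (forall t, continuous (fun y => f y t)) ->
  (forall y, W y -> \val (F y) = f y) ->
  {within W, continuous F}.
Proof.
move=> cf Ff; apply/subspace_sigL_continuousP; apply: continuous_set_type.
rewrite (_ : (fun _ => _) = f \o (fun y : set_type W => \val y)); last first.
  by apply/funext => y; rewrite /= Ff //; exact: set_valP.
move=> y; apply: continuous_comp; first exact: continuous_val.
exact: continuous_ptws.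
Qed.

Lemma pair_continuous (X Y Z : topologicalType) (f : X -> Y) (g : X -> Z) :
  continuous f -> continuous g -> continuous (fun x => (f x, g x)).
Proof.
move=> cf cg x.
exact: (@cvg_pair _ _ _ (nbhs x) (nbhs (f x)) (nbhs (g x)) _ _ _ f g (cf x) (cg x)).
Qed.

Lemma fst_continuous (X Y : topologicalType) : continuous (@fst X Y).
Proof. by move=> z; exact: cvg_fst. Qed.

Lemma snd_continuous (X Y : topologicalType) : continuous (@snd X Y).
Proof. by move=> z; exact: cvg_snd. Qed.

Section RealContinuity.
Context (R : realType) (X : topologicalType).
Implicit Types f g : X -> R.

Lemma rcont_cst (c : R) : continuous (fun _ : X => c).
Proof. by move=> x; exact: cvg_cst. Qed.

Lemma rcontD f g : continuous f -> continuous g -> continuous (fun x => f x + g x).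
Proof. by move=> cf cg x; apply: cvgD; [exact: cf|exact: cg]. Qed.

Lemma rcontB f g : continuous f -> continuous g -> continuous (fun x => f x - g x).
Proof. by move=> cf cg x; apply: cvgB; [exact: cf|exact: cg]. Qed.

Lemma rcontM f g : continuous f -> continuous g -> continuous (fun x => f x * g x).
Proof. by move=> cf cg x; apply: cvgM; [exact: cf|exact: cg]. Qed.

Lemma rcontV f : (forall x, f x != 0) -> continuous f -> continuous (fun x => (f x)^-1).
Proof. by move=> f0 cf x; apply: cvgV; [exact: f0|exact: cf]. Qed.

Lemma rcont_norm f : continuous f -> continuous (fun x => `|f x|).
Proof. by move=> cf x; apply: cvg_norm; exact: cf. Qed.

Lemma rcont_min f g : continuous f -> continuous g ->
  continuous (fun x => Num.min (f x) (g x)).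
Proof. by move=> cf cg x; have := @continuous_min R X f g x (cf x) (cg x); exact. Qed.

Lemma rcont_max f g : continuous f -> continuous g ->
  continuous (fun x => Num.max (f x) (g x)).
Proof. by move=> cf cg x; have := @continuous_max R X f g x (cf x) (cg x); exact. Qed.

Lemma rcont_sum (I : Type) (r : seq I) (P : pred I) (F : I -> X -> R) :
  (forall i, P i -> continuous (F i)) ->
  continuous (fun x => \sum_(i <- r | P i) F i x).
Proof.
move=> cF; elim: r => [|i r IH].
  rewrite (_ : (fun _ => _) = fun=> 0); first exact: rcont_cst.
  by apply/funext => x; rewrite big_nil.
case Pi : (P i); last first.
  rewrite (_ : (fun _ => _) = fun x => \sum_(i <- r | P i) F i x)//.
  by apply/funext => x; rewrite big_cons Pi.
rewrite (_ : (fun _ => _) = fun x => F i x + \sum_(i <- r | P i) F i x).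
  by apply: rcontD => //; exact: cF.
by apply/funext => x; rewrite big_cons Pi.
Qed.

End RealContinuity.

(** * Pushing weight off an antichain of conical points *)

Section Conical.
Context (R : realType) (T : finType) (le : rel T).
Context (le_refl : reflexive le).
Context (le_anti : antisymmetric le).
Context (le_trans : transitive le).

Definition strict (x y : T) : bool := (x != y) && le x y.
Local Notation lt := strict.

Lemma strictW x y : lt x y -> le x y.
Proof. by case/andP. Qed.

Lemma strict_irr x : lt x x = false.
Proof. by rewrite /strict eqxx. Qed.

Lemma strict_le_trans y x z : lt x y -> le y z -> lt x z.
Proof.
move=> /andP[xy lxy] lyz; rewrite /strict (le_trans lxy lyz) andbT.
by apply: contraNneq xy => xz; apply/eqP/le_anti; rewrite lxy xz lyz.
Qed.

Lemma strict_trans y x z : lt x y -> lt y z -> lt x z.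
Proof. by move=> xy /strictW; exact: strict_le_trans. Qed.

Definition rank (x : T) : nat := #|[set y | lt y x]%SET|.

Lemma rank_strict x y : lt x y -> (rank x < rank y)%N.
Proof.
move=> xy; apply: proper_card; apply/fintype.properP; split.
  by apply/fintype.subsetP => z; rewrite !inE => zx; exact: strict_trans zx xy.
by exists x; rewrite inE ?xy// strict_irr.
Qed.

Context (Q A : {set T}) (p : T -> T) (al : T -> T -> T).
Context (A_anti : {in A &, forall N N', ~~ lt N N'}).
Context (pQ : {in A, forall N, p N \in Q}).
Context (pN : {in A, forall N, lt (p N) N}).
Context (alQ : {in A & Q, forall N y, lt y N -> al N y \in Q}).
Context (alN : {in A & Q, forall N y, lt y N -> lt (al N y) N}).
Context (le_al : {in A & Q, forall N y, lt y N -> le y (al N y)}).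
Context (p_al : {in A & Q, forall N y, lt y N -> le (p N) (al N y)}).
Context (al_homo : {in A & Q & Q, forall N y z,
  lt y N -> lt z N -> le y z -> le (al N y) (al N z)}).

Definition above (x : T -> R) (N y : T) : R := \sum_(j | lt y j && lt j N) x j.

(* [le]-below a conical point [N] of [A], the map [al] is increasing with
   [y <= al y >= p N]. The weight [t * x N] leaving [N] is paired with equal
   weights leaving the points [y < N] of the chain, the greatest first, and
   each such pair [N, y] lands on [al y] with weight doubled; what remains of
   [t * x N] once the chain is exhausted lands on [p N]. Taking the greatest
   [y] first keeps the support a chain. *)
Definition moved (x : T -> R) (t : R) (N y : T) : R :=
  if lt y N then Num.min (x y) (Num.max 0 (t * x N - above x N y)) else 0.

Definition cone_term (x : T -> R) (t : R) (u N : T) : R :=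
  \sum_y moved x t N y * (2 * (al N y == u)%:R - (y == u)%:R)
  + (t * x N - \sum_y moved x t N y) * (p N == u)%:R - t * x N * (N == u)%:R.

Definition cone_push (x : T -> R) (t : R) (u : T) : R :=
  x u + \sum_(N in A) cone_term x t u N.

Section Point.
Context (x : T -> R) (t : R).
Context (x0 : forall u, 0 <= x u).
Context (x_chain : forall u v, x u != 0 -> x v != 0 -> le u v || le v u).
Context (xQ : forall u, x u != 0 -> u \in Q).
Context (t01 : 0 <= t <= 1).

Let mv N y := moved x t N y.

Lemma above_ge0 N y : 0 <= above x N y.
Proof. exact: sumr_ge0. Qed.

Lemma moved_ge0 N y : 0 <= moved x t N y.
Proof.
rewrite /moved; case: ifP => // _.
by rewrite le_min x0 le_max lexx.
Qed.

Lemma moved_le N y : moved x t N y <= x y.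
Proof. by rewrite /moved; case: ifP => // _; rewrite ge_min lexx. Qed.

Lemma moved_idle N y : x N = 0 -> moved x t N y = 0.
Proof.
move=> xN; rewrite /moved; case: ifP => // _; rewrite xN mulr0 sub0r.
have /max_idPl -> : - above x N y <= 0 by rewrite oppr_le0 above_ge0.
by apply/min_idPr; exact: x0.
Qed.

Lemma cone_term_idle u N : x N = 0 -> cone_term x t u N = 0.
Proof.
move=> xN; rewrite /cone_term xN mulr0 big1 => [|y _].
  by rewrite big1 => [|y _]; rewrite ?moved_idle// !(subrr, mul0r, addr0, subr0).
by rewrite moved_idle// mul0r.
Qed.

Lemma cone_push_idle u : {in A, forall N, x N = 0} -> cone_push x t u = x u.
Proof.
move=> xA; rewrite /cone_push big1 ?addr0// => N NA.
by rewrite cone_term_idle// xA.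
Qed.

Context (N : T).
Context (NA : N \in A).
Context (xN : x N != 0).

Let s := t * x N.

Lemma s_ge0 : 0 <= s.
Proof. by case/andP: t01 => t0 _; exact: mulr_ge0. Qed.

(** The support is a chain and [A] is an antichain, so only one apex can carry weight and the sum
    over [A] in [cone_push] collapses to one term. *)
Lemma apex_unique M : M \in A -> M != N -> x M = 0.
Proof.
move=> MA MN; apply/eqP/negPn/negP => xM; case/orP: (x_chain xM xN) => h.
  by have := A_anti MA NA; rewrite /strict MN h.
by have := A_anti NA MA; rewrite /strict eq_sym MN h.
Qed.

Lemma cone_push_apex u : cone_push x t u = x u + cone_term x t u N.
Proof.
rewrite /cone_push (bigD1 N)//= big1 ?addr0// => M /andP[MA MN].
by rewrite cone_term_idle// apex_unique.
Qed.

Lemma moved_gt0 y : mv N y != 0 -> [/\ lt y N, x y != 0 & above x N y < s].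
Proof.
rewrite /mv /moved; case: ifP => [yN mnz|]; last by rewrite eqxx.
have xy : x y != 0.
  apply: contraNneq mnz => ->; rewrite (_ : Num.min _ _ = 0)//.
  by apply/min_idPl; rewrite le_max lexx.
split=> //; rewrite ltNge; apply: contra mnz => h.
rewrite (_ : Num.max _ _ = 0) ?(min_idPr (x0 y))//.
by apply/max_idPl; rewrite subr_le0.
Qed.

(** Take the lowest point [y] that moves at all. The truncation lets it give at most
    [s - above x N y], and every other moving point lies above [y], so together they give at most
    [above x N y]. *)
Lemma sum_moved_le : \sum_y mv N y <= s.
Proof.
case: (pickP (fun y => mv N y != 0)) => [y0 y0P|all0]; last first.
  by rewrite big1 ?s_ge0// => y _; apply/eqP; have := all0 y => /negbFE.
have [y mvy ymin] := @arg_minnP _ y0 (fun y => mv N y != 0) rank y0P.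
have [yN xy yab] := moved_gt0 mvy.
have -> : \sum_z mv N z = mv N y + \sum_(z | lt y z && lt z N) mv N z.
  rewrite (bigD1 y)//=; congr (_ + _); rewrite big_mkcond [RHS]big_mkcond/=.
  apply: eq_bigr => z _.
  case: ifPn => [zy|]; last by rewrite negbK => /eqP ->; rewrite strict_irr.
  case: ifPn => // nz; apply/eqP/negPn/negP => mz.
  have [zN xz _] := moved_gt0 mz; move: nz; rewrite zN andbT /strict eq_sym zy /= => nyz.
  have := x_chain xz xy; rewrite (negbTE nyz) orbF => zley.
  have : lt z y by rewrite /strict zy zley.
  by move/rank_strict; rewrite ltnNge (ymin _ mz).
have h1 : mv N y <= s - above x N y.
  rewrite /mv /moved yN ge_min; apply/orP; right.
  by rewrite ge_max lexx andbT subr_ge0 ltW.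
have h2 : \sum_(z | lt y z && lt z N) mv N z <= above x N y.
  by apply: ler_sum => z _; exact: moved_le.
by have := lerD h1 h2; rewrite subrK.
Qed.


(** If some point below [N] kept weight, the highest such [y] would have been cut off by the budget
    and given at least [s - above x N y], while all points above it gave everything; the budget [s]
    would be used up. *)
Lemma moved_all : \sum_y mv N y < s -> forall y, lt y N -> mv N y = x y.
Proof.
move=> hs y1 y1N; apply/eqP/negPn/negP => y1P.
pose P y := lt y N && (mv N y != x y).
have Py1 : P y1 by rewrite /P y1N.
have [y /andP[yN my] ymax] := @arg_maxnP _ y1 P rank Py1.
have h1 : s - above x N y <= mv N y.
  move: my; rewrite /mv /moved yN minElt; case: ifP => [_|_ _]; first by rewrite eqxx.
  by rewrite le_max lexx orbT.
suff h2 : mv N y + above x N y <= \sum_z mv N z.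
  by move: hs; rewrite ltNge => /negP; apply; apply: Order.POrderTheory.le_trans h2; rewrite -lerBlDr.
rewrite (bigD1 y)//= lerD2l /above.
have -> : \sum_(j | lt y j && lt j N) x j = \sum_(j | lt y j && lt j N) mv N j.
  apply: eq_bigr => j /andP[yj jN]; apply/eqP; rewrite eq_sym; apply/negPn/negP => mj.
  by have := ymax j; rewrite /P jN mj => /(_ isT); rewrite /= leqNgt rank_strict.
rewrite big_mkcond [leRHS]big_mkcond/=; apply: ler_sum => z _.
case: ifP => [/andP[/andP[yz _] _]|_]; first by rewrite eq_sym yz.
by case: ifP => // _; exact: moved_ge0.
Qed.

(** The chain is emptied from the top, so a point that keeps weight lies at or below every point
    that moves. *)
Lemma moved_order u y : lt u N -> mv N u != x u -> mv N y != 0 -> x u != 0 ->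
  le u y.
Proof.
move=> uN mu my xu; have [yN xy yab] := moved_gt0 my.
case/orP: (x_chain xu xy) => // yu.
have [->|nyu] := eqVneq y u; first exact: le_refl.
case/negP: mu; apply/eqP; rewrite /mv /moved uN; apply/min_idPl.
rewrite le_max; apply/orP; right; rewrite lerBrDr.
apply: Order.POrderTheory.le_trans (ltW yab); rewrite /above [leRHS](bigD1 u)/=; last first.
  by rewrite /strict nyu yu; exact: uN.
rewrite lerD2l big_mkcond [leRHS]big_mkcond/=; apply: ler_sum => z _.
case: ifP => [/andP[uz zN]|_]; last by case: ifP.
have -> : lt y z by apply: (@strict_trans u) => //; rewrite /strict nyu.
by rewrite zN /= eq_sym; case/andP: uz => ->.
Qed.

Let rest u := x u - mv N u - s * (N == u)%:R.

Lemma cone_pushE u : cone_push x t u =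
  rest u + 2 * (\sum_(y | al N y == u) mv N y)
  + (s - \sum_y mv N y) * (p N == u)%:R.
Proof.
rewrite cone_push_apex /cone_term -/s /rest.
have -> : \sum_y moved x t N y * (2 * (al N y == u)%:R - (y == u)%:R) =
    2 * (\sum_(y | al N y == u) mv N y) - mv N u.
  have -> : mv N u = \sum_y mv N y * (y == u)%:R.
    by rewrite (bigD1 u)//= eqxx mulr1 big1 ?addr0// => y /negbTE ->; rewrite mulr0.
  rewrite [in RHS]big_mkcond/= mulr_sumr -sumrB; apply: eq_bigr => y _.
  by rewrite mulrBr mulrCA; congr (2 * _ - _); case: ifP; rewrite ?mulr1 ?mulr0.
rewrite -!/(mv _ _); ring.
Qed.

Lemma rest_ge0 u : 0 <= rest u.
Proof.
rewrite /rest; case: eqP => [<-|_]; last by rewrite mulr0 subr0 subr_ge0 moved_le.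
rewrite /mv /moved strict_irr subr0 mulr1 /s -{1}[x N]mul1r -mulrBl.
by case/andP: t01 => _ t1; rewrite mulr_ge0// subr_ge0.
Qed.

Lemma cone_push_ge0 u : 0 <= cone_push x t u.
Proof.
rewrite cone_pushE; apply: addr_ge0; last first.
  by rewrite mulr_ge0// subr_ge0 sum_moved_le.
rewrite addr_ge0 ?rest_ge0 ?mulr_ge0//.
by apply: sumr_ge0 => y _; exact: moved_ge0.
Qed.

Lemma cone_push_sum : \sum_u cone_push x t u = \sum_u x u.
Proof.
under eq_bigr do rewrite cone_push_apex.
rewrite big_split/= -[RHS]addr0; congr (_ + _); rewrite /cone_term.
have ind (v : T) : \sum_u (v == u)%:R = 1 :> R.
  by rewrite (bigD1 v)//= eqxx big1 ?addr0// => y; rewrite eq_sym => /negbTE ->.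
rewrite sumrB big_split/= -!mulr_sumr !ind !mulr1.
rewrite exchange_big/= [X in X + _ - _](_ : _ = \sum_y mv N y); last first.
  apply: eq_bigr => y _; rewrite -mulr_sumr sumrB -mulr_sumr !ind mulr1.
  by rewrite (_ : 2 - 1 = 1) ?mulr1//; lra.
by rewrite -/s subrKC subrr.
Qed.

Variant cone_supp_spec u : Prop :=
| ConeRest of x u != 0 & (lt u N -> mv N u != x u) & (u = N -> t != 1)
| ConeAl y of mv N y != 0 & u = al N y
| ConeP of u = p N & \sum_y mv N y < s.

Lemma cone_suppP u : cone_push x t u != 0 -> cone_supp_spec u.
Proof.
rewrite cone_pushE => h.
have [r0|r0] := eqVneq (rest u) 0.
  have [a0|a0] := eqVneq (\sum_(y | al N y == u) mv N y) 0.
    move: h; rewrite r0 a0 mulr0 !add0r mulf_eq0 negb_or => /andP[h1 h2].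
    constructor 3; first by move: h2; case: (p N =P u) => // _; rewrite eqxx.
    by rewrite lt_neqAle sum_moved_le andbT; apply: contraNneq h1 => ->; rewrite subrr.
  have : exists2 y, al N y == u & mv N y != 0.
    apply: contrapT => nex; case/negP: a0; apply/eqP; apply: big1 => y yu.
    by apply/eqP/negPn/negP => my; apply: nex; exists y.
  by case=> y /eqP <- my; constructor 2 with y.
have mvu : mv N u <= x u := moved_le N u.
have xu : x u != 0.
  apply: contraNneq r0 => xu0.
  have uN : (N == u) = false by apply: contraNF xN => /eqP ->; rewrite xu0.
  have m0 : mv N u = 0 by apply/eqP; rewrite eq_le moved_ge0 andbT -[leRHS]xu0.
  by rewrite /rest xu0 m0 uN mulr0 !subr0.
constructor 1 => //.
  move=> uN; apply: contraNneq r0 => mu; rewrite /rest mu subrr sub0r.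
  by case: (N =P u) uN => [->|_ _]; rewrite ?strict_irr// mulr0 oppr0.
move=> uN; apply: contraNneq r0 => t1.
by rewrite /rest uN eqxx mulr1 /s t1 mul1r /mv /moved strict_irr subr0 subrr.
Qed.

(** An old point that keeps weight is at or above [N], or lies below all moving points by
    [moved_order]; either way it is comparable with every [al N y]. The point [p N] receives weight
    only when the budget exceeds what the chain offers, and then by [moved_all] nothing is left
    strictly below [N]. *)
Lemma cone_push_chain u v : cone_push x t u != 0 -> cone_push x t v != 0 ->
  le u v || le v u.
Proof.
have side w : x w != 0 -> lt w N \/ le N w.
  move=> xw; case/orP: (x_chain xw xN) => h; last by right.
  by have [->|wN] := eqVneq w N; [right; exact: le_refl|left; rewrite /strict wN].
have alp y : mv N y != 0 -> le y (al N y) /\ lt (al N y) N /\ le (p N) (al N y).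
  move=> my; have [yN xy _] := moved_gt0 my.
  by split; [exact/le_al/yN/xQ|split; [exact/alN/yN/xQ|exact/p_al/yN/xQ]].
have rest_al w y : x w != 0 -> (lt w N -> mv N w != x w) -> mv N y != 0 ->
    le w (al N y) || le (al N y) w.
  move=> xw mw my; have [yal [alNy _]] := alp _ my.
  have [wN|Nw] := side _ xw; last by rewrite (le_trans (strictW alNy) Nw) orbT.
  by rewrite (le_trans (moved_order wN (mw wN) my xw) yal).
have rest_p w : x w != 0 -> (lt w N -> mv N w != x w) -> \sum_y mv N y < s ->
    le (p N) w.
  move=> xw mw /moved_all ms; have [wN|Nw] := side _ xw.
    by move: (mw wN); rewrite ms ?eqxx.
  exact: le_trans (strictW (pN NA)) Nw.
have al_al y z : mv N y != 0 -> mv N z != 0 ->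
    le (al N y) (al N z) || le (al N z) (al N y).
  move=> my mz; have [yN xy _] := moved_gt0 my; have [zN xz _] := moved_gt0 mz.
  case/orP: (x_chain xy xz) => h; apply/orP; [left|right].
    exact: (al_homo NA (xQ xy) (xQ xz) yN zN h).
  exact: (al_homo NA (xQ xz) (xQ xy) zN yN h).
move=> /cone_suppP[xu mu _|y my ->|-> su] /cone_suppP[xv mv' _|z mz ->|-> sv].
- exact: x_chain.
- exact: rest_al.
- by rewrite (rest_p _ xu mu sv) orbT.
- by rewrite orbC; exact: rest_al.
- exact: al_al.
- by have [_ [_ ->]] := alp _ my; rewrite orbT.
- by rewrite (rest_p _ xv mv' su).
- by have [_ [_ ->]] := alp _ mz.
- by rewrite le_refl.
Qed.

Lemma cone_push_supp u : cone_push x t u != 0 -> u \in Q.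
Proof.
move=> /cone_suppP[/xQ//|y my ->|-> _]; last exact: pQ.
by have [yN xy _] := moved_gt0 my; exact/alQ/yN/xQ.
Qed.

(** At time 1 the apex has lost all its weight, and the receiving points are strictly below [N],
    hence not in the antichain [A]. *)
Lemma cone_push_end u : t = 1 -> cone_push x t u != 0 -> u \notin A.
Proof.
move=> t1 /cone_suppP[xu _ tu|y my ->|-> _]; apply/negP => uA.
- have [uN|uN] := eqVneq u N; first by move: (tu uN); rewrite t1 eqxx.
  by rewrite apex_unique ?eqxx in xu.
- have [yN xy _] := moved_gt0 my.
  by have := A_anti uA NA; rewrite (alN NA (xQ xy) yN).
- by have := A_anti uA NA; rewrite (pN NA).
Qed.

End Point.

Lemma cone_push_equivariant (g : T -> T) (x y : T -> R) t u :
  injective g -> (forall a b, le (g a) (g b) = le a b) ->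
  (forall a, (g a \in A) = (a \in A)) ->
  {in A, forall N, p (g N) = g (p N)} ->
  {in A & Q, forall N z, lt z N -> al (g N) (g z) = g (al N z)} ->
  (forall a, y (g a) = x a) -> (forall a, 0 <= x a) ->
  (forall a, x a != 0 -> a \in Q) ->
  cone_push y t (g u) = cone_push x t u.
Proof.
move=> gi gle gA gp gal yx x0 xQ.
have glt a b : lt (g a) (g b) = lt a b by rewrite /strict gle (inj_eq gi).
have gb : bijective g by exact: injF_bij.
have reidx (P : pred T) (F : T -> R) :
    \sum_(i | P i) F i = \sum_(i | P (g i)) F (g i).
  by case: gb => g' gK g'K; rewrite (reindex g)//; exists g' => ? _.
have gab N z : above y (g N) (g z) = above x N z.
  rewrite /above reidx; apply: eq_big => [j|j _]; first by rewrite !glt.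
  exact: yx.
have gmv N z : moved y t (g N) (g z) = moved x t N z.
  by rewrite /moved glt !yx gab.
rewrite /cone_push yx; congr (_ + _); rewrite reidx; apply: eq_big => [N|N NA]; first exact: gA.
rewrite gA in NA.
rewrite /cone_term !yx gp// !(inj_eq gi) (reidx predT) (reidx predT (moved y t _)).
congr (_ + _ * _ - _); last first.
  by congr (_ - _); apply: eq_bigr => z _; rewrite gmv.
apply: eq_bigr => z _; rewrite gmv (inj_eq gi).
(* Equivariance of [al] is available only for points of [Q] below [N]; all other terms carry the
   factor zero. *)
have [-> |mz] := eqVneq (moved x t N z) 0; first by rewrite !mul0r.
have [zN xz _] := moved_gt0 x0 mz.
by rewrite (gal _ _ NA (xQ _ xz) zN) (inj_eq gi).
Qed.

End Conical.

(** * Continuity on subspaces and concatenation of homotopies *)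

Lemma within_comp (X Y Z : topologicalType) (A : set X) (W : set Y)
    (f : X -> Y) (h : Y -> Z) :
  {within A, continuous f} -> (forall x, A x -> W (f x)) ->
  {within W, continuous h} -> {within A, continuous (h \o f)}.
Proof.
move=> /subspace_sigL_continuousP cf fW /subspace_sigL_continuousP ch.
apply/subspace_sigL_continuousP.
pose f' (x : set_type A) : set_type W :=
  exist (fun y => y \in W) (f (\val x)) (mem_set (fW _ (set_valP x))).
rewrite (_ : sigL A _ = sigL W h \o f'); last exact/funext.
by move=> x; apply: continuous_comp; [exact: continuous_set_type|exact: ch].
Qed.

Lemma within_eq (X Y : topologicalType) (A : set X) (f g : X -> Y) :
  (forall x, A x -> f x = g x) -> {within A, continuous f} ->
  {within A, continuous g}.
Proof.
by move=> fg; apply: subspace_eq_continuous => x; rewrite inE; exact: fg.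
Qed.

Section Concatenation.
Context (R : realType) (X Y : topologicalType).

Definition homotopy_concat (H1 H2 : X * R -> Y) (z : X * R) : Y :=
  if z.2 <= 2^-1 then H1 (z.1, 2 * z.2) else H2 (z.1, 2 * z.2 - 1).

Lemma within_homotopy_concat (W : set X) (H1 H2 : X * R -> Y) : closed W ->
  {within W `*` `[0, 1], continuous H1} ->
  {within W `*` `[0, 1], continuous H2} ->
  (forall x, W x -> H1 (x, 1) = H2 (x, 0)) ->
  {within W `*` `[0, 1], continuous (homotopy_concat H1 H2)}.
Proof.
move=> cW c1 c2 H12.
have closedX (a b : R) : closed (W `*` `[a, b]).
  rewrite (_ : _ `*` _ = (fst @^-1` W) `&` (snd @^-1` `[a, b])); last by [].
  apply: closedI.
    by apply: closed_comp => // ? _; exact: cvg_fst.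
  by apply: closed_comp; [move=> ? _; exact: cvg_snd|exact: itv_closed].
have -> : W `*` `[0, 1] = (W `*` `[0, 2^-1]) `|` (W `*` `[2^-1, 1]) :> set (X * R).
  apply/seteqP; split => -[x t] /=; rewrite !in_itv/=.
    move=> [Wx /andP[t0 t1]]; have [t2|t2] := leP t 2^-1.
      by left; split => //; rewrite t0.
    by right; split => //; rewrite ltW.
  by move=> [|] [Wx /andP[t0 t1]]; split => //; apply/andP; split; lra.
have caff (a b : R) : continuous (fun z : X * R => (z.1, a * z.2 + b)).
  apply: pair_continuous; first exact: fst_continuous.
  by apply: rcontD; [apply: rcontM|]; try exact: rcont_cst; exact: snd_continuous.
apply: withinU_continuous => //.
  apply: (@within_eq _ _ _ (H1 \o (fun z => (z.1, 2 * z.2 + 0)))).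
    by move=> [x t] [/= _ /[!in_itv]/= /andP[_ t2]]; rewrite /homotopy_concat/= t2 addr0.
  apply: within_comp c1; first exact: continuous_subspaceT.
  by move=> [x t] /=; rewrite !in_itv/= => -[Wx /andP[? ?]]; split => //; apply/andP; split; lra.
apply: (@within_eq _ _ _ (H2 \o (fun z => (z.1, 2 * z.2 + (-1))))).
  move=> [x t] [/= Wx /[!in_itv]/= /andP[t2 _]]; rewrite /homotopy_concat/=.
  case: ifPn => // t2'; have -> : t = 2^-1 by apply/eqP; rewrite eq_le t2' t2.
  by rewrite divff// subrr H12.
apply: within_comp c2; first exact: continuous_subspaceT.
by move=> [x t] /=; rewrite !in_itv/= => -[Wx /andP[? ?]]; split => //; apply/andP; split; lra.
Qed.

End Concatenation.

(** * Full subcomplexes and equivariant retractions between them *)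

Section Retracts.
Context (R : realType) (T : finType) (K : {set {set T}}) (L : Type).
Local Notation X := (realisation R K).
Context (act : L -> X -> X).

(** The full subcomplex on the vertices in [Q]. All stages of the deformation are of this form
    inside one fixed space, which makes them easy to compose. *)
Definition supported (Q : {set T}) : set X :=
  [set x | forall t, \val x t != 0 -> t \in Q].

Lemma supportedS (Q Q' : {set T}) : Q \subset Q' -> supported Q `<=` supported Q'.
Proof. by move=> /fintype.subsetP QQ' x xQ t /xQ /QQ'. Qed.

Lemma closed_supported (Q : {set T}) : closed (supported Q).
Proof.
rewrite (_ : supported Q = (fun x : X => \sum_(t in ~: Q) \val x t) @^-1` [set 0]).
  apply: closed_comp; last exact: closed_eq.
  move=> x _; apply: rcont_sum => t _; exact: realisation_coord_continuous.
apply/seteqP; split => x /=.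
  move=> xQ; apply: big1 => t; rewrite inE => tQ; apply/eqP/negPn/negP => /xQ.
  by rewrite (negbTE tQ).
move=> /eqP; rewrite psumr_eq0 => [/allP h t xt|t _]; last exact: realisation_ge0.
apply: contraNT xt => tQ; have := h t; rewrite mem_index_enum inE tQ.
exact.
Qed.

Record retracting (Q Q' : {set T}) (H : X * R -> X) : Prop := Retracting {
  retr_cont : {within supported Q `*` `[0, 1], continuous H};
  retr0 : forall x, H (x, 0) = x;
  retr_in : forall x t, supported Q x -> 0 <= t <= 1 -> supported Q (H (x, t));
  retr1 : forall x, supported Q x -> supported Q' (H (x, 1));
  retr_fix : forall x t, 0 <= t <= 1 -> supported Q' x -> H (x, t) = x;
  retr_equi : forall g x t, 0 <= t <= 1 -> supported Q x ->
    H (act g x, t) = act g (H (x, t))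
}.

Definition retracts_to (Q Q' : {set T}) : Prop :=
  Q' \subset Q /\ exists H, retracting Q Q' H.

Lemma retracts_refl Q : retracts_to Q Q.
Proof.
split => //; exists fst; split => //.
by apply: continuous_subspaceT => z; exact: cvg_fst.
Qed.

Lemma retracts_trans Q1 Q2 Q3 :
  retracts_to Q1 Q2 -> retracts_to Q2 Q3 -> retracts_to Q1 Q3.
Proof.
move=> [Q21 [H1 [c1 z1 i1 e1 f1 g1]]] [Q32 [H2 [c2 z2 i2 e2 f2 g2]]].
split; first exact: fintype.subset_trans Q32 Q21.
have half : (2^-1 : R) < 1 by lra.
pose H2' (z : X * R) := H2 (H1 (z.1, 1), z.2).
have t01 (t : R) : 0 <= t <= 1 -> t <= 2^-1 -> 0 <= 2 * t <= 1.
  by move=> /andP[? ?] ?; apply/andP; split; lra.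
have t12 (t : R) : 0 <= t <= 1 -> ~~ (t <= 2^-1) -> 0 <= 2 * t - 1 <= 1.
  by rewrite -ltNge => /andP[? ?] ?; apply/andP; split; lra.
have one01 : 0 <= (1 : R) <= 1 by rewrite ler01 lexx.
exists (homotopy_concat H1 H2'); split.
- apply: within_homotopy_concat => //; first exact: closed_supported.
    apply: (within_comp _ _ c2).
      have : {within supported Q1 `*` `[0, 1], continuous (H1 \o (fun z : X * R => (z.1, 1)))}.
        apply: within_comp c1.
          apply: continuous_subspaceT; apply: pair_continuous; first exact: fst_continuous.
          by move=> z; exact: cvg_cst.
        by move=> [x t] [/= Qx _]; split => //=; rewrite in_itv/= one01.
      move=> c; apply: (@pair_continuous (subspace _) _ _ _ _ c).
      by apply: continuous_subspaceT; exact: snd_continuous.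
    by move=> [x t] [/= Qx t1]; split => //=; exact: e1.
  by move=> x _; rewrite /H2' /= z2.
- by move=> x; rewrite /homotopy_concat/= invr_ge0 ler0n mulr0.
- move=> x t Qx t1; rewrite /homotopy_concat/=; case: ifPn => t2.
    by apply: i1 => //; exact: t01.
  by apply: (supportedS Q21); apply: i2; [exact: e1|exact: t12].
- move=> x Qx; rewrite /homotopy_concat/= leNgt half/= /H2'/= mulr1.
  by rewrite (_ : 2 - 1 = 1); [apply: e2; exact: e1|lra].
- move=> x t t1 Qx; have Q2x := supportedS Q32 Qx; rewrite /homotopy_concat/=.
  case: ifPn => t2; first by apply: f1 => //; exact: t01.
  by rewrite /H2'/= f1// f2//; exact: t12.
- move=> g x t t1 Qx; rewrite /homotopy_concat/=; case: ifPn => t2.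
    by apply: g1 => //; exact: t01.
  by rewrite /H2'/= g1// g2//; [exact: t12|exact: e1].
Qed.

End Retracts.

(** * Removal of conical points; interior and closure operators *)

Section ConicalRemoval.
Context (R : realType) (T : finType) (K : {set {set T}}) (L : Type).
Local Notation X := (realisation R K).
Context (a : L -> T -> T) (act : L -> X -> X) (le : rel T).
Context (a_inj : forall g, injective (a g)).
Context (actE : forall g x t, \val (act g x) (a g t) = \val x t).
Context (le_refl : reflexive le).
Context (le_anti : antisymmetric le).
Context (le_trans : transitive le).
Context (a_le : forall g x y, le (a g x) (a g y) = le x y).
Context (chainP : forall s : {set T},
  reflect (s != finset.set0 /\ {in s &, forall x y, le x y || le y x}) (s \in K)).

Local Notation lt := (strict le).

Lemma strict_act g x y : lt (a g x) (a g y) = lt x y.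
Proof. by rewrite /strict a_le (inj_eq (a_inj (g := g))). Qed.

Lemma rank_act g x : rank le (a g x) = rank le x.
Proof.
rewrite /rank -[RHS](card_imset _ (a_inj (g := g))); congr #|pred_of_set _|.
apply/setP => y; rewrite inE; have [h _ hK] := injF_bij (a_inj (g := g)).
by rewrite -(hK y) strict_act mem_imset ?inE//; exact: a_inj.
Qed.

Section Antichain.
Context (Q A : {set T}) (p : T -> T) (al : T -> T -> T).
Context (A_anti : {in A &, forall N N', ~~ lt N N'}).
Context (pQ : {in A, forall N, p N \in Q}).
Context (pN : {in A, forall N, lt (p N) N}).
Context (alQ : {in A & Q, forall N y, lt y N -> al N y \in Q}).
Context (alN : {in A & Q, forall N y, lt y N -> lt (al N y) N}).
Context (le_al : {in A & Q, forall N y, lt y N -> le y (al N y)}).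
Context (p_al : {in A & Q, forall N y, lt y N -> le (p N) (al N y)}).
Context (al_homo : {in A & Q & Q, forall N y z,
  lt y N -> lt z N -> le y z -> le (al N y) (al N z)}).
Context (aQ : forall g x, (a g x \in Q) = (x \in Q)).
Context (aA : forall g x, (a g x \in A) = (x \in A)).
Context (ap : forall g, {in A, forall N, p (a g N) = a g (p N)}).
Context (aal : forall g, {in A & Q, forall N z, lt z N ->
  al (a g N) (a g z) = a g (al N z)}).

Lemma realisation_chain (x : X) u v : \val x u != 0 -> \val x v != 0 ->
  le u v || le v u.
Proof.
by move=> xu xv; have /chainP[_] := realisation_supp x; apply; rewrite inE.
Qed.

Let push (z : X * R) : {ptws T -> R} := cone_push le A p al (\val z.1) z.2.

Lemma push_in x t : supported Q x -> 0 <= t <= 1 ->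
  push (x, t) \in @realisation_set R T K /\
  forall u, push (x, t) u != 0 -> u \in Q /\ (t = 1 -> u \notin A).
Proof.
move=> Qx t01; have x0 u : 0 <= \val x u := realisation_ge0 x u.
have xc := @realisation_chain x.
have [h|h] := pselect (exists2 N, N \in A & \val x N != 0); last first.
  have xA : {in A, forall N, \val x N = 0}.
    by move=> N NA; apply/eqP/negPn/negP => xN; apply: h; exists N.
  have -> : push (x, t) = \val x by apply/funext => u; rewrite /push/= cone_push_idle.
  split; first exact: valP.
  move=> u xu; split; first exact: Qx.
  by move=> _; apply/negP => /xA /eqP; rewrite (negbTE xu).
have [N NA xN] := h.
split.
  rewrite inE; split.
  - by move=> u; exact: (cone_push_ge0 le_anti le_trans p al A_anti x0 xc t01 NA xN).
  - rewrite -(realisation_sum x).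
    exact: (cone_push_sum p al A_anti t x0 xc NA xN).
  - apply/chainP; split.
      apply/negP => /eqP s0.
      have : \sum_u push (x, t) u = 1.
        rewrite -(realisation_sum x).
        exact: (cone_push_sum p al A_anti t x0 xc NA xN).
      rewrite big1 => [|u _]; first by move/eqP; rewrite eq_sym oner_eq0.
      apply/eqP/negPn/negP => xu; have : u \in finset.set0 by rewrite -s0 inE.
      by rewrite inE.
    move=> u v; rewrite !inE.
    exact: (cone_push_chain le_refl le_anti le_trans A_anti pN alN le_al p_al
      al_homo x0 xc Qx t01 NA xN).
move=> u pu; split.
  exact: (cone_push_supp le_anti le_trans A_anti pQ alQ x0 xc Qx t01 NA xN pu).
by move=> t1; exact: (cone_push_end le_anti le_trans A_anti pN alN x0 xc Qx t01 NA xN t1 pu).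
Qed.

Lemma push_continuous u : continuous (fun z => push z u).
Proof.
have cx v : continuous (fun z : X * R => \val z.1 v).
  move=> z; apply: (@continuous_comp _ _ _ fst (fun x : X => \val x v)).
    exact: cvg_fst.
  exact: realisation_coord_continuous.
have ct : continuous (fun z : X * R => z.2) by exact: snd_continuous.
have cm N y : continuous (fun z : X * R => moved le (\val z.1) z.2 N y).
  rewrite /moved; case: (lt y N); last exact: rcont_cst.
  apply: rcont_min => //; apply: rcont_max; first exact: rcont_cst.
  by apply: rcontB; [exact: rcontM|exact: rcont_sum].
apply: rcontD => //; apply: rcont_sum => N _; rewrite /cone_term.
apply: rcontB.
  apply: rcontD.
    by apply: rcont_sum => y _; apply: rcontM; [exact: cm|exact: rcont_cst].
  apply: rcontM; last exact: rcont_cst.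
  by apply: rcontB; [exact: rcontM|apply: rcont_sum => y _; exact: cm].
by apply: rcontM; [exact: rcontM|exact: rcont_cst].
Qed.

Lemma antichain_removal : retracts_to act Q (Q :\: A).
Proof.
split; first exact: subsetDl.
(* Away from [supported Q] and the unit interval the pushed coordinates need not define a point of
   the realisation; the default [z.1] is harmless there. *)
pose H (z : X * R) : X := insubd z.1 (push z).
have HE x t : supported Q x -> 0 <= t <= 1 -> \val (H (x, t)) = push (x, t).
  by move=> Qx t01; rewrite insubdK//; have [] := push_in Qx t01.
have fix0 x t : supported (Q :\: A) x -> push (x, t) = \val x.
  move=> xQ; apply/funext => u; apply: cone_push_idle; first exact: realisation_ge0.
  by move=> N NA; apply/eqP/negPn/negP => /xQ; rewrite inE NA.
exists H; split.
- apply: (within_realisation push_continuous) => -[x t] [/= Qx].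
  by rewrite in_itv/=; exact: HE.
- move=> x; apply: val_inj; rewrite /H; have -> : push (x, 0) = \val x.
    apply/funext => u; rewrite /push /cone_push/= big1 ?addr0// => N _.
    have m0 y : moved le (\val x) 0 N y = 0.
      rewrite /moved; case: ifP => // _; rewrite mul0r sub0r.
      have /max_idPl -> : - above le (\val x) N y <= 0.
        by rewrite oppr_le0; apply: sumr_ge0 => j _; exact: realisation_ge0.
      exact/min_idPr/realisation_ge0.
    rewrite /cone_term !mul0r big1 => [|y _]; last by rewrite m0 mul0r.
    by rewrite big1 ?subrr ?mul0r ?addr0 ?subr0// => y _; exact: m0.
  by rewrite insubdK//; exact: valP.
- by move=> x t Qx t01 u; rewrite HE// => /(push_in Qx t01).2[].
- move=> x Qx u; have t01 : 0 <= (1 : R) <= 1 by rewrite ler01 lexx.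
  by rewrite HE// => /(push_in Qx t01).2[uQ uA]; rewrite inE uQ uA.
- move=> x t t01 xQ; apply: val_inj; rewrite HE ?fix0//.
  exact: supportedS (subsetDl _ _) _ xQ.
- move=> g x t t01 Qx; apply: realisationP => u.
  have [h _ hK] := injF_bij (a_inj (g := g)); rewrite -(hK u) actE !HE//; last first.
    by move=> v; have [k _ kK] := injF_bij (a_inj (g := g)); rewrite -(kK v) actE aQ; exact: Qx.
  apply: (cone_push_equivariant t (h u) (a_inj (g := g)) (a_le g) (aA g) (@ap g) (@aal g)) => //.
  - by move=> v; rewrite actE.
  - exact: realisation_ge0.
Qed.

End Antichain.

(** The points of [B] are removed in order of increasing rank. Points of equal rank form an
    antichain, and when rank [i] is treated, whatever is left strictly below such a point is already
    outside [B]; this is why the data [al] are only needed on [Q :\: B]. *)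
Lemma conical_removal (Q B : {set T}) (p : T -> T) (al : T -> T -> T) :
  B \subset Q ->
  {in B, forall N, p N \in Q :\: B} ->
  {in B, forall N, lt (p N) N} ->
  {in B & Q :\: B, forall N y, lt y N -> al N y \in Q :\: B} ->
  {in B & Q :\: B, forall N y, lt y N -> lt (al N y) N} ->
  {in B & Q :\: B, forall N y, lt y N -> le y (al N y)} ->
  {in B & Q :\: B, forall N y, lt y N -> le (p N) (al N y)} ->
  {in B & Q :\: B & Q :\: B, forall N y z,
    lt y N -> lt z N -> le y z -> le (al N y) (al N z)} ->
  (forall g x, (a g x \in Q) = (x \in Q)) ->
  (forall g x, (a g x \in B) = (x \in B)) ->
  (forall g, {in B, forall N, p (a g N) = a g (p N)}) ->
  (forall g, {in B & Q :\: B, forall N z, lt z N ->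
    al (a g N) (a g z) = a g (al N z)}) ->
  retracts_to act Q (Q :\: B).
Proof.
move=> BQ pQ pN alQ alN le_al p_al al_homo aQ aB ap aal.
pose Qi i := Q :\: [set x in B | (rank le x < i)%N]%SET.
have QiP i x : (x \in Qi i) = (x \in Q) && ((x \in B) ==> (i <= rank le x)%N).
  by rewrite !inE negb_and -leqNgt -implybE andbC.
have QB i : Q :\: B \subset Qi i.
  by apply/fintype.subsetP => x; rewrite QiP inE => /andP[/negbTE -> ->].
suff H i : retracts_to act Q (Qi i).
  rewrite (_ : Q :\: B = Qi #|T|.+1); first exact: H.
  apply/setP => x; rewrite QiP inE andbC; case: (x \in B) => //=.
  by rewrite leqNgt ltnS max_card.
elim: i => [|i IH].
  rewrite (_ : Qi 0 = Q); first exact: retracts_refl.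
  by apply/setP => x; rewrite QiP implybT andbT.
apply: (retracts_trans IH).
pose A := [set x in B | rank le x == i]%SET.
have AB N : N \in A -> N \in B by rewrite inE => /andP[].
have below N y : N \in A -> y \in Qi i -> lt y N -> y \in Q :\: B.
  rewrite QiP !inE => /andP[NB /eqP Ni] /andP[-> yB] /(rank_strict le_anti le_trans).
  rewrite Ni ltnNge andbT; apply: contra => yB'.
  by move: yB; rewrite yB'.
rewrite (_ : Qi i.+1 = Qi i :\: A); last first.
  apply/setP => x; rewrite [RHS]inE !QiP inE; case: (x \in B) => //=.
  by rewrite andbCA ltn_neqAle eq_sym.
apply: (antichain_removal (p := p) (al := al)).
- move=> N N'; rewrite !inE => /andP[_ /eqP Ni] /andP[_ /eqP Ni'].
  by apply/negP => /(rank_strict le_anti le_trans); rewrite Ni Ni' ltnn.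
- by move=> N /AB NB; exact/(fintype.subsetP (QB i))/pQ.
- by move=> N /AB; exact: pN.
- move=> N y NA yQ yN; apply: (fintype.subsetP (QB i)).
  exact: (alQ _ _ (AB _ NA) (below _ _ NA yQ yN) yN).
- by move=> N y NA yQ yN; exact: (alN _ _ (AB _ NA) (below _ _ NA yQ yN) yN).
- by move=> N y NA yQ yN; exact: (le_al _ _ (AB _ NA) (below _ _ NA yQ yN) yN).
- by move=> N y NA yQ yN; exact: (p_al _ _ (AB _ NA) (below _ _ NA yQ yN) yN).
- move=> N y z NA yQ zQ yN zN.
  exact: (al_homo _ _ _ (AB _ NA) (below _ _ NA yQ yN) (below _ _ NA zQ zN) yN zN).
- by move=> g x; rewrite !QiP aQ aB rank_act.
- by move=> g x; rewrite !inE aB rank_act.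
- by move=> g N /AB; exact: ap.
- by move=> g N y NA yQ yN; exact: (aal _ _ _ (AB _ NA) (below _ _ NA yQ yN) yN).
Qed.

(** The points moved by [f] are conical with constant data [p N = al N y = f N]: a fixed point [y]
    below [N] satisfies [y = f y <= f N]. *)
Lemma kernel_retract (Q : {set T}) (f : T -> T) :
  {in Q, forall x, f x \in Q} -> {in Q, forall x, le (f x) x} ->
  {in Q, forall x, f (f x) = f x} ->
  {in Q &, forall x y, le x y -> le (f x) (f y)} ->
  (forall g x, (a g x \in Q) = (x \in Q)) ->
  (forall g, {in Q, forall x, f (a g x) = a g (f x)}) ->
  retracts_to act Q [set x in Q | f x == x]%SET.
Proof.
move=> fQ fle ff fhomo aQ af.
pose B := [set x in Q | f x != x]%SET.
have -> : [set x in Q | f x == x]%SET = Q :\: B.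
  by apply/setP => x; rewrite !inE; case: (x \in Q); rewrite /= ?negbK ?andbT ?andbF.
have QB y : y \in Q :\: B -> y \in Q /\ f y = y.
  by rewrite !inE negb_and negbK => /andP[+ yQ]; rewrite yQ => /eqP.
have BQ y : y \in B -> y \in Q by rewrite inE => /andP[].
have fB x : x \in B -> f x \in Q :\: B.
  move=> /BQ xQ; rewrite !inE negb_and negbK fQ// ff// eqxx//.
have flt x : x \in B -> lt (f x) x.
  by move=> xB; rewrite /strict fle ?BQ// andbT; move: xB; rewrite inE => /andP[].
apply: (conical_removal (p := f) (al := fun N _ => f N)).
- by apply/fintype.subsetP => x /BQ.
- exact: fB.
- exact: flt.
- by move=> N y NB _ _; exact: fB.
- by move=> N y NB _ _; exact: flt.
- by move=> N y NB /QB[yQ fy] /strictW yN; rewrite -fy; apply: fhomo => //; exact: BQ.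
- by move=> N y NB _ _; exact: le_refl.
- by move=> N y z NB _ _ _ _ _; exact: le_refl.
- exact: aQ.
- move=> g x; rewrite !inE aQ; case xQ : (x \in Q) => //=.
  by rewrite af// (inj_eq (a_inj (g := g))).
- by move=> g N /BQ; exact: af.
- by move=> g N y /BQ NQ _ _; exact: af.
Qed.

End ConicalRemoval.

(** Reversing the order does not change which sets are chains, so this is [kernel_retract] for the
    dual order. *)
Lemma closure_retract (R : realType) (T : finType) (K : {set {set T}}) (L : Type)
    (a : L -> T -> T) (act : L -> realisation R K -> realisation R K)
    (le : rel T) (Q : {set T}) (f : T -> T) :
  (forall g, injective (a g)) ->
  (forall g x t, \val (act g x) (a g t) = \val x t) ->
  reflexive le -> antisymmetric le -> transitive le ->
  (forall g x y, le (a g x) (a g y) = le x y) ->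
  (forall s : {set T},
    reflect (s != finset.set0 /\ {in s &, forall x y, le x y || le y x}) (s \in K)) ->
  {in Q, forall x, f x \in Q} -> {in Q, forall x, le x (f x)} ->
  {in Q, forall x, f (f x) = f x} ->
  {in Q &, forall x y, le x y -> le (f x) (f y)} ->
  (forall g x, (a g x \in Q) = (x \in Q)) ->
  (forall g, {in Q, forall x, f (a g x) = a g (f x)}) ->
  retracts_to act Q [set x in Q | f x == x]%SET.
Proof.
move=> ai aE lr la lt al cP fQ fle ff fh.
apply: (@kernel_retract R T K L a act (fun x y => le y x)) => //.
- by move=> x y; rewrite andbC; exact: la.
- by move=> y x z xy yz; exact: lt yz xy.
- by move=> s; apply: (iffP (cP s)) => -[s0 h]; split => // x y xs ys; rewrite orbC h.
- by move=> x y xQ yQ; exact: fh.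
Qed.

(** * Cores and positions *)

Section Skeleton.
Import boot.finset boot.fintype.
Local Open Scope nat_scope.
Local Open Scope set_scope.
Context (V : finType) (G : simple_graph V).

Lemma universalP (v : V) :
  reflect (forall w, w != v -> G v w) (v \in universal_vertices G).
Proof.
have sub : [set w | G v w] \subset [set~ v].
  by apply/subsetP => w; rewrite !inE; apply: contraTneq => ->; rewrite adj_irr.
rewrite inE /degree -(cardsC1 v); apply: (iffP eqP) => [h w wv|h].
  have /eqP e : [set w | G v w] == [set~ v] by rewrite eqEcard sub h leqnn.
  have : w \in [set w | G v w] by rewrite e !inE.
  by rewrite inE.
congr #|pred_of_set _|; apply/eqP; rewrite eqEsubset sub; apply/subsetP => w.
by rewrite !inE; exact: h.
Qed.

Lemma edgesP (x y : V) : ([set x; y] \in edges G) = G x y.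
Proof.
rewrite inE; apply/existsP/idP => [[u /existsP[v /andP[uv /eqP e]]]|xy]; last first.
  by exists x; apply/existsP; exists y; rewrite xy eqxx.
have nuv : u != v by apply: contraTneq uv => ->; rewrite adj_irr.
have xin : x \in [set u; v] by rewrite -e set21.
have yin : y \in [set u; v] by rewrite -e set22.
have uin : u \in [set x; y] by rewrite e set21.
have vin : v \in [set x; y] by rewrite e set22.
move: xin yin uin vin; rewrite !inE.
case/orP => /eqP -> /orP[] /eqP ->; rewrite ?orbb; move=> a b.
- by move: b; rewrite eq_sym (negbTE nuv).
- exact: uv.
- by rewrite adj_sym.
- by move: a; rewrite (negbTE nuv).
Qed.

Lemma edgeE (e : {set V}) : e \in edges G -> exists x y, e = [set x; y] /\ G x y.
Proof.
by rewrite inE => /existsP[x /existsP[y /andP[xy /eqP ->]]]; exists x, y.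
Qed.

Lemma card_edge (e : {set V}) : e \in edges G -> #|e| = 2.
Proof.
move=> /edgeE[x [y [-> xy]]]; rewrite cards2.
by have -> : x != y by apply: contraTneq xy => ->; rewrite adj_irr.
Qed.

Definition nb (E : {set {set V}}) (x : V) : {set V} := [set w | [set x; w] \in E].

Lemma nbP E x w : (w \in nb E x) = ([set x; w] \in E).
Proof. by rewrite inE. Qed.

Lemma nb_sym E x w : (w \in nb E x) = (x \in nb E w).
Proof. by rewrite !inE setUC. Qed.

Lemma tree_rel_sym (E : {set {set V}}) : symmetric (tree_rel E).
Proof. by move=> x y; rewrite /tree_rel /= setUC. Qed.

Lemma tree_connect_sym (E : {set {set V}}) : connect_sym (tree_rel E).
Proof. exact/sym_connect_sym/tree_rel_sym. Qed.

(** Rotate the cycle so that it starts at [x]; its second and its last vertex are the two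
    neighbours. This is used to see that a vertex with a single neighbour lies on no cycle. *)
Lemma ucycle_nbrs (e : rel V) c x : ucycle e c -> 2 < size c -> x \in c ->
  exists y z, [/\ y != z, y \in c, z \in c, e x y & e z x].
Proof.
move=> /andP[ec uc] sc xc; have [i s rs] := rot_to xc.
have : path.cycle e (x :: s) by rewrite -rs rot_cycle.
have us : uniq (x :: s) by rewrite -rs rot_uniq.
have ms : {subset s <= c}.
  by move=> y ys; rewrite -(mem_rot i) rs inE ys orbT.
have : 2 < size (x :: s) by rewrite -rs size_rot.
case: s rs us ms => [|y [|z s]]//= rs us ms _.
rewrite rcons_path => /and3P[xy _ /andP[_ lx]].
exists y, (last z s); split => //.
- by apply: contraTneq us => ->; rewrite mem_last /= !andbF.
- by apply: ms; rewrite mem_head.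
- by apply: ms; rewrite inE mem_last orbT.
Qed.

Lemma edge_in_subtree A E x y : is_subtree G A E -> [set x; y] \in E ->
  [/\ x \in A, y \in A & G x y].
Proof.
move=> [EG EA _ _] xy; have := EA _ xy.
rewrite subUset !sub1set => /andP[xA yA]; split => //.
by rewrite -edgesP; exact: (subsetP EG).
Qed.

Lemma nb_card_gt0 A E x : is_subtree G A E -> 2 <= #|A| -> x \in A ->
  0 < #|nb E x|.
Proof.
move=> [_ _ cn _] A2 xA.
have /card_gt0P[y] : 0 < #|A :\ x| by move: A2; rewrite (cardsD1 x) xA.
rewrite !inE => /andP[yx yA].
have /connectP[[|z p]/= pP yl] := cn _ _ xA yA; first by rewrite yl eqxx in yx.
by apply/card_gt0P; exists z; rewrite inE; case/andP: pP.
Qed.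

(* A realignment is encoded by a tree [(C, E)], its core, and the position
   [pos b] of each vertex [b] outside [C]: a singleton [[set v]] if [b] is a leaf
   of the tree hanging at [v], and an edge [r b] otherwise. Specification then
   shrinks positions. *)
Definition cell (C : {set V}) (E : {set {set V}}) (X : {set V}) :=
  (X \in E) \/ (exists2 v, v \in C & X = [set v]).

(** The set [C] is allowed to be larger than the core of the resulting realignment: a cell below [M]
    is written over the core of [M], although its own core may have shrunk. *)
Definition valid (C : {set V}) (E : {set {set V}}) (pos : {ffun V -> {set V}}) :=
  [/\ 2 <= #|C|, is_subtree G C E, forall b, b \in C -> pos b = set0,
      forall b, b \notin C -> cell C E (pos b)
    & forall b v, v \in pos b -> G b v].

Definition mk (C : {set V}) (E : {set {set V}}) (pos : {ffun V -> {set V}}) :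
    realignment_data V :=
  (C :|: [set b | #|pos b| == 1],
   E :|: [set e | [exists b, exists v, (pos b == [set v]) && (e == [set v; b])]],
   [ffun b => if #|pos b| == 2 then pos b else set0]).

Section Valid.
Context (C : {set V}) (E : {set {set V}}) (pos : {ffun V -> {set V}}).
Context (vP : valid C E pos).

Lemma valid_tree : is_subtree G C E. Proof. by case: vP. Qed.

Lemma valid_edge e : e \in E -> e \in edges G /\ e \subset C.
Proof. by have [EG EC _ _] := valid_tree; split; [exact: (subsetP EG)|exact: EC]. Qed.

Lemma pos_sub b v : v \in pos b -> [/\ b \notin C, v \in C & G b v].
Proof.
have [_ _ p0 pc pG] := vP => vb; have bC : b \notin C.
  by apply/negP => /p0 pb; rewrite pb inE in vb.
split => //; last exact: pG.
case: (pc b bC) vb => [/valid_edge[_ /subsetP h] /h//|[w wC ->]].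
by rewrite inE => /eqP ->.
Qed.

Lemma pos_neq0 b : b \notin C -> pos b != set0.
Proof.
have [_ _ _ pc _] := vP => /pc[/valid_edge[/card_edge h _]|[w _ ->]].
  by rewrite -card_gt0 h.
by apply/set0Pn; exists w; rewrite inE.
Qed.

Lemma card_pos b : b \notin C -> (#|pos b| = 1) \/ (#|pos b| = 2 /\ pos b \in E).
Proof.
have [_ _ _ pc _] := vP => /pc[h|[w _ ->]]; last by left; rewrite cards1.
by right; split => //; have [/card_edge ] := valid_edge h.
Qed.

Lemma card_pos_notin b : 0 < #|pos b| -> b \notin C.
Proof. by case/card_gt0P => v /pos_sub[]. Qed.

Lemma mk_verticesP b : (b \in tree_vertices (mk C E pos)) = (b \in C) || (#|pos b| == 1).
Proof. by rewrite !inE. Qed.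

Lemma mk_edgesP x y : ([set x; y] \in tree_edges (mk C E pos)) =
  [|| [set x; y] \in E, pos x == [set y] | pos y == [set x]].
Proof.
rewrite !inE; congr (_ || _); apply/existsP/orP => [[b /existsP[v]]|]; last first.
  case=> h; first by exists x; apply/existsP; exists y; rewrite h setUC eqxx.
  by exists y; apply/existsP; exists x; rewrite h eqxx.
case/andP => /eqP pb /eqP e.
have [bC vC bv] : [/\ b \notin C, v \in C & G b v] by apply: pos_sub; rewrite pb inE.
have vb : v != b by apply: contraNneq bC => <-.
have : x \in [set v; b] by rewrite -e set21.
have : y \in [set v; b] by rewrite -e set22.
have : b \in [set x; y] by rewrite e set22.
have : v \in [set x; y] by rewrite e set21.
rewrite !inE => h1 h2 /orP[] /eqP yE /orP[] /eqP xE.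
- by move: h2; rewrite xE yE orbb eq_sym (negbTE vb).
- by left; rewrite xE yE pb.
- by right; rewrite xE yE pb.
- by move: h1; rewrite xE yE orbb (negbTE vb).
Qed.

Lemma mk_nb_out b : b \notin C -> #|pos b| = 1 -> nb (tree_edges (mk C E pos)) b = pos b.
Proof.
move=> bC /eqP/cards1P[v pv]; apply/setP => w; rewrite nbP mk_edgesP pv inE.
rewrite (inj_eq set1_inj) [v == w]eq_sym.
case: (w =P v) => [->|vw] /=; rewrite ?orbT//; apply/negbTE/norP; split.
  by apply: contra bC => /valid_edge[_ /subsetP]; apply; rewrite set21.
apply: contra bC => /eqP h; have [] : [/\ w \notin C, b \in C & G w b] by apply: pos_sub; rewrite h inE.
by [].
Qed.

Lemma mk_nb_in x : x \in C ->
  nb (tree_edges (mk C E pos)) x = nb E x :|: [set b | pos b == [set x]].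
Proof.
move=> xC; apply/setP => w; rewrite nbP mk_edgesP !inE; congr (_ || _).
have [_ _ p0 _ _] := vP; rewrite p0//.
rewrite (_ : (set0 == [set w]) = false)//.
by apply/negbTE/eqP => h; have := set11 w; rewrite -h inE.
Qed.

Lemma mk_attach b : attach (mk C E pos) b = if #|pos b| == 2 then pos b else set0.
Proof. by rewrite /attach /= ffunE. Qed.

(** A vertex outside [C] joins the tree only through a singleton position, so it has one neighbour
    and lies on no cycle; every cycle therefore stays in [C] and already exists in [E]. *)
Lemma mk_tree : is_subtree G (tree_vertices (mk C E pos)) (tree_edges (mk C E pos)).
Proof.
have [EG EC cn ac] := valid_tree.
have newP e : e \in tree_edges (mk C E pos) -> e \in E \/
    exists b v, [/\ pos b = [set v], e = [set v; b], b \notin C, v \in C & G b v].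
  rewrite !inE => /orP[|/existsP[b /existsP[v /andP[/eqP pb /eqP ->]]]]; first by left.
  right; exists b, v; have [] : [/\ b \notin C, v \in C & G b v] by apply: pos_sub; rewrite pb inE.
  by [].
split.
- apply/subsetP => e /newP[/(subsetP EG)//|[b [v [_ -> _ _ bv]]]].
  by rewrite edgesP adj_sym.
- move=> e /newP[/EC h|[b [v [pb -> _ vC _]]]].
    exact: subset_trans h (subsetUl _ _).
  by rewrite subUset !sub1set !mk_verticesP vC pb cards1 eqxx orbT.
- have toC x : x \in tree_vertices (mk C E pos) ->
      exists2 c, c \in C & connect (tree_rel (tree_edges (mk C E pos))) x c.
    rewrite mk_verticesP => /orP[xC|/cards1P[v pv]]; first by exists x.
    have [_ vC _] : [/\ x \notin C, v \in C & G x v] by apply: pos_sub; rewrite pv inE.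
    exists v => //; apply: connect1; rewrite /tree_rel /= -/(tree_edges (mk C E pos)) mk_edgesP pv eqxx.
    by rewrite orbT.
  have inC x y : x \in C -> y \in C -> connect (tree_rel (tree_edges (mk C E pos))) x y.
    move=> xC yC; have := cn x y xC yC; apply: connect_sub => u v uv.
    by apply: connect1; rewrite /tree_rel /= inE; apply/orP; left.
  move=> x y /toC[c cC xc] /toC[d dC yd].
  apply: connect_trans xc _; apply: connect_trans (inC _ _ cC dC) _.
  by rewrite tree_connect_sym.
- move=> c uc; rewrite leqNgt; apply/negP => c2.
  have cC x : x \in c -> x \in C.
    move=> xc; apply/negPn/negP => xC.
    have adj y : tree_rel (tree_edges (mk C E pos)) x y -> pos x = [set y].
      rewrite /tree_rel /= -/(tree_edges (mk C E pos)) mk_edgesP => /or3P[h|/eqP//|/eqP h].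
        by have [_ /subsetP/(_ x)] := valid_edge h; rewrite set21 (negbTE xC) => /(_ isT).
      have [_ xC' _] : [/\ y \notin C, x \in C & G y x] by apply: pos_sub; rewrite h inE.
      by rewrite xC' in xC.
    have [y [z [yz _ _ xy zx]]] := ucycle_nbrs uc c2 xc.
    rewrite tree_rel_sym in zx; move: (adj _ xy); rewrite (adj _ zx) => /set1_inj zy.
    by rewrite zy eqxx in yz.
  have : ucycle (tree_rel E) c.
    move: uc => /andP[cc uc]; apply/andP; split => //.
    have P : all (mem C) c by apply/allP.
    apply: (sub_in_cycle _ P cc) => x y /= xC yC.
    rewrite /tree_rel /= -/(tree_edges (mk C E pos)) mk_edgesP => /or3P[//|/eqP h|/eqP h].
      have [xC' _ _] : [/\ x \notin C, y \in C & G x y] by apply: pos_sub; rewrite h inE.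
      by rewrite xC in xC'.
    have [yC' _ _] : [/\ y \notin C, x \in C & G y x] by apply: pos_sub; rewrite h inE.
    by rewrite yC in yC'.
  by move/ac; rewrite leqNgt c2.
Qed.

Lemma mk_realignment : is_realignment G (mk C E pos).
Proof.
have [C2 _ p0 pc pG] := vP; split.
- exact: leq_trans C2 (subset_leq_card (subsetUl _ _)).
- exact: mk_tree.
- apply/pffun_onP; split.
    apply/subsetP => b; rewrite !inE mk_attach.
    case: ifP => [/eqP b2 _|]; last by rewrite eqxx.
    by rewrite negb_or b2 /= andbT; apply: card_pos_notin; rewrite b2.
  move=> _ /imageP[b + ->]; rewrite in_setC mk_verticesP => /norP[bC b1].
  rewrite mk_attach; have [h|[h1 h2]] := card_pos bC; first by rewrite h eqxx in b1.
  by rewrite h1 eqxx inE h2.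
- move=> b v _; rewrite mk_attach; case: ifP => _; last by rewrite inE.
  exact: pG.
Qed.

End Valid.
End Skeleton.

(** * The order as inclusion of positions, and the core of an encoded cell *)

Section PositionUpdates.
Import boot.finset boot.fintype.
Local Open Scope nat_scope.
Local Open Scope set_scope.
Context (V : finType) (G : simple_graph V).

Definition upd (pos : {ffun V -> {set V}}) (b : V) (X : {set V}) : {ffun V -> {set V}} :=
  [ffun x => if x == b then X else pos x].

(** A nonempty part of a position is either the whole position or one endpoint of an edge, hence
    again a position. *)
Lemma sub_valid C E (pos pos' : {ffun V -> {set V}}) : valid G C E pos ->
  (forall b, pos' b \subset pos b) -> (forall b, b \notin C -> pos' b != set0) ->
  valid G C E pos'.
Proof.
move=> vP sub n0; have [C2 tr p0 pc pG] := vP; split => //.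
- by move=> b bC; apply/eqP; rewrite -subset0 -(p0 _ bC).
- move=> b bC; have p'0 : 0 < #|pos' b| by rewrite card_gt0 n0.
  have := subset_leq_card (sub b); have [p1|[p2 pE]] := card_pos vP bC.
    rewrite p1 => le1; have -> : pos' b = pos b by apply/eqP; rewrite eqEcard sub p1.
    exact: pc.
  rewrite p2 leq_eqVlt => /orP[p'2|].
    by left; have -> : pos' b = pos b by apply/eqP; rewrite eqEcard sub p2 (eqP p'2).
  rewrite ltnS => le1; have /cards1P[v pv] : #|pos' b| == 1 by rewrite eqn_leq le1.
  have vb : v \in pos b by apply: (subsetP (sub b)); rewrite pv inE.
  by right; exists v => //; have [] := pos_sub vP vb.
- by move=> b v /(subsetP (sub b)); exact: pG.
Qed.

Lemma upd_valid C E (pos : {ffun V -> {set V}}) b v : valid G C E pos ->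
  v \in pos b -> valid G C E (upd pos b [set v]).
Proof.
move=> vP vb; apply: (sub_valid vP) => x; rewrite ffunE.
  by case: eqP => [->|//]; rewrite sub1set.
move=> xC; case: (x =P b) => _; last exact: (pos_neq0 vP).
by apply/set0Pn; exists v; rewrite inE.
Qed.

Lemma specification_mk C E (pos : {ffun V -> {set V}}) b v : valid G C E pos ->
  v \in pos b -> #|pos b| = 2 ->
  specification (mk C E pos) b v = mk C E (upd pos b [set v]).
Proof.
move=> vP vb b2; have [bC vC bv] := pos_sub vP vb.
congr (_, _, _).
- apply/setP => x; rewrite !inE ffunE.
  by case: (x =P b) => [->|]; rewrite ?cards1 ?eqxx ?orbT.
- apply/setP => e; rewrite !inE orbCA; congr (_ || _).
  apply/orP/existsP => [[/eqP ->|/existsP[x /existsP[w /andP[pw ew]]]]|].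
  + by exists b; apply/existsP; exists v; rewrite ffunE !eqxx.
  + exists x; apply/existsP; exists w; rewrite ffunE ew andbT.
    by case: (x =P b) => // xb; move: b2; rewrite -xb (eqP pw) cards1.
  + case=> x /existsP[w]; rewrite ffunE; case: (x =P b) => [->|_] /andP[pw ew].
      by left; rewrite (eqP ew) (set1_inj (eqP pw)).
    by right; apply/existsP; exists x; apply/existsP; exists w; rewrite pw.
- apply/ffunP => x; rewrite !ffunE.
  by case: (x =P b) => // _; rewrite cards1.
Qed.

Implicit Types (N K M : realignment G).

(** Together with [le_mk] this replaces the order generated by specifications with inclusion of
    positions over a fixed tree [(C, E)]. *)
Lemma lower_mk N K C E pos : val K = mk C E pos -> valid G C E pos ->
  realignment_le N K -> exists pos' : {ffun V -> {set V}},
  [/\ valid G C E pos', forall b, pos' b \subset pos b & val N = mk C E pos'].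
Proof.
move=> KE vP /connectP[p pP KL]; elim: p N pP KL => [|M p IH] N /=.
  by move=> _ <-; exists pos; split.
case/andP => NM pM KL; have [pos1 [v1 s1 ME]] := IH _ pM KL.
move: NM => /existsP[b /existsP[v /and3P[bM vM /eqP NE]]].
move: bM vM NE; rewrite ME mk_attach mk_verticesP => /norP[bC b1].
case: ifP => [/eqP b2 vb|]; last by rewrite inE.
rewrite (specification_mk v1 vb b2) => NE; exists (upd pos1 b [set v]); split => //.
  exact: upd_valid.
move=> x; rewrite ffunE; case: eqP => [->|_]; last exact: s1.
by rewrite sub1set; exact: (subsetP (s1 b)).
Qed.

Lemma mk_isub C E pos : valid G C E pos ->
  exists K : realignment G, val K = mk C E pos.
Proof.
move=> vP.
have h : `[< is_realignment G (mk C E pos) >] by apply/asboolP; exact: mk_realignment.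
by exists (exist (fun D => `[< is_realignment G D >]) _ h).
Qed.

(** Induction on the number of vertices whose positions differ: at each of them an edge has to
    shrink to one of its ends, which is a single specification. *)
Lemma le_mk N K C E (pos pos' : {ffun V -> {set V}}) :
  val K = mk C E pos -> val N = mk C E pos' ->
  valid G C E pos -> valid G C E pos' -> (forall b, pos' b \subset pos b) ->
  realignment_le N K.
Proof.
move=> KE NE vP vP' sub.
have [n] := ubnP #|[set b | pos' b != pos b]|.
elim: n K pos KE vP sub => // n IH K pos KE vP sub cn.
have [e|/set0Pn[b]] := eqVneq [set b | pos' b != pos b] set0.
  have pp : pos' = pos.
    apply/ffunP => b; apply/eqP/negPn/negP => h.
    by move/setP: e => /(_ b); rewrite !inE h.
  have -> : N = K by apply: val_inj; rewrite KE NE pp.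
  exact: connect0.
rewrite inE => pb.
have bC : b \notin C.
  by apply: contra pb => bC; have [_ _ -> // _ _] := vP; have [_ _ -> // _ _] := vP'.
have p'b := pos_neq0 vP' bC.
have b2 : #|pos b| = 2.
  have [h|[]//] := card_pos vP bC; case/negP: pb.
  by rewrite eqEcard sub h card_gt0.
have /cards1P[v pv] : #|pos' b| == 1.
  have := proper_card (_ : pos' b \proper pos b); rewrite b2 properEneq pb sub.
  by rewrite ltnS => /(_ isT) h; rewrite eqn_leq h card_gt0.
have vb : v \in pos b by apply: (subsetP (sub b)); rewrite pv inE.
have v1 := upd_valid vP vb; have [M ME] := mk_isub v1.
apply: (@connect_trans _ _ M).
  apply: (IH M _ ME v1).
    by move=> x; rewrite ffunE; case: eqP => [->|_]; rewrite ?pv.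
  rewrite -ltnS; apply: leq_trans cn; rewrite ltnS; apply: proper_card.
  apply/properP; split; last by exists b; rewrite !inE// ffunE eqxx pv eqxx.
  by apply/subsetP => x; rewrite !inE ffunE; case: (x =P b) => [->|//]; rewrite pv eqxx.
apply: connect1; apply/existsP; exists b; apply/existsP; exists v.
rewrite KE mk_attach mk_verticesP negb_or bC b2 /= vb /=.
by rewrite ME (specification_mk vP vb b2).
Qed.

(** For [D] below [M] and [C] the core of [M] this recovers the positions of [D] over the tree of
    [M], even when the own core of [D] is smaller. *)
Definition posover (C : {set V}) (D : realignment_data V) : {ffun V -> {set V}} :=
  [ffun b => if b \in C then set0
    else if b \in tree_vertices D then nb (tree_edges D) b else attach D b].

Definition core (D : realignment_data V) : {set V} :=
  [set x | 2 <= #|nb (tree_edges D) x|] :|: \bigcup_b attach D b.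

Definition ecore (D : realignment_data V) : {set {set V}} :=
  [set e in tree_edges D | e \subset core D].

Definition posn (D : realignment_data V) := posover (core D) D.

Lemma posover_mk C E pos : valid G C E pos -> posover C (mk C E pos) = pos.
Proof.
move=> vP; apply/ffunP => b; rewrite ffunE; case: ifPn => bC.
  by have [_ _ ->] := vP.
rewrite (mk_verticesP C E) (negbTE bC) /= (mk_attach C E); case: (#|pos b| =P 1) => [h|/eqP/negbTE h] /=.
  exact: (mk_nb_out vP bC h).
by have [h1|[-> _]//] := card_pos vP bC; rewrite h1 in h.
Qed.

(** A vertex outside [C] has at most one tree neighbour and never enters the core. Consequently a
    leaf of [(C, E)] drops out of the core exactly when no position contains it, which is the
    mechanism behind all pruning of cores. *)
Lemma core_mk C E pos : valid G C E pos -> core (mk C E pos) =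
  [set x in C | (2 <= #|nb E x|) || [exists b, x \in pos b]].
Proof.
move=> vP; have [C2 tr p0 pc pG] := vP; apply/setP => x; rewrite !inE.
apply/orP/andP => [[x2|/bigcupP[b _]]|[xC /orP[x2|/existsP[b xb]]]].
- have [xC|xC] := boolP (x \in C).
    split => //; move: x2; rewrite (mk_nb_in vP)//.
    have [->|/set0Pn[b]] := eqVneq [set b | pos b == [set x]] set0.
      by rewrite setU0 => ->.
    rewrite inE => /eqP pb _; apply/orP; right; apply/existsP; exists b.
    by rewrite pb inE.
  exfalso; have /card_gt0P[w] : 0 < #|nb (tree_edges (mk C E pos)) x| by exact: ltn_trans x2.
  have [h|[h hE]] := card_pos vP xC; first by rewrite (mk_nb_out vP) // h in x2.
  rewrite nbP (mk_edgesP vP) => /or3P[xw|/eqP xw|/eqP xw].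
  + by have [_ /subsetP/(_ x)] := valid_edge vP xw; rewrite set21 (negbTE xC) => /(_ isT).
  + by rewrite xw cards1 in h.
  + by have [] : [/\ w \notin C, x \in C & G w x]; [apply: (pos_sub vP); rewrite xw inE|rewrite (negbTE xC)].
- rewrite mk_attach; case: ifP => [_ xb|_]; last by rewrite inE.
  have [_ xC _] := pos_sub vP xb; split => //; apply/orP; right.
  by apply/existsP; exists b.
- by left; apply: leq_trans x2 _; rewrite (mk_nb_in vP)// subset_leq_card// subsetUl.
- have [bC _ _] := pos_sub vP xb.
  have [/eqP/cards1P[y yb]|[b2 bE]] := card_pos vP bC; last first.
    by right; apply/bigcupP; exists b; rewrite // mk_attach b2.
  (* The vertex [b] hangs here, and there is also a neighbour inside [E]; the two sets of neighbours
     are disjoint, so their sizes add up to at least two. *)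
  left; rewrite (mk_nb_in vP)// cardsU; move: xb; rewrite yb inE => /eqP xy; subst y.
  rewrite (_ : _ :&: _ = set0) ?cards0 ?subn0; last first.
    apply/setP => w; rewrite !inE; apply/negbTE/negP => /andP[xw /eqP pw].
    have [] : [/\ w \notin C, x \in C & G w x] by apply: (pos_sub vP); rewrite pw inE.
    have [_ /subsetP/(_ w)] := valid_edge vP xw; rewrite set22 => /(_ isT) -> //.
  rewrite -[2]/(1 + 1) leq_add// ?(nb_card_gt0 tr)//.
  by apply/card_gt0P; exists b; rewrite inE yb.
Qed.

Lemma ecore_mk C E pos : valid G C E pos -> core (mk C E pos) = C ->
  ecore (mk C E pos) = E.
Proof.
move=> vP cC; apply/setP => e; rewrite inE cC.
apply/andP/idP => [[eE eC]|eE]; last first.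
  by have [_ ->] := valid_edge vP eE; rewrite inE eE.
have [EG _ _ _] := mk_tree vP.
have [x [y [exy xy]]] := edgeE (subsetP EG _ eE).
move: eE eC; rewrite exy (mk_edgesP vP) subUset !sub1set.
case/or3P => [//|/eqP pe|/eqP pe] /andP[xC yC].
  by have [] : [/\ x \notin C, y \in C & G x y]; [apply: (pos_sub vP); rewrite pe inE|rewrite xC].
by have [] : [/\ y \notin C, x \in C & G y x]; [apply: (pos_sub vP); rewrite pe inE|rewrite yC].
Qed.

Lemma posn_mk C E pos : valid G C E pos -> core (mk C E pos) = C ->
  posn (mk C E pos) = pos.
Proof. by move=> vP cC; rewrite /posn cC posover_mk. Qed.

End PositionUpdates.

(** * Every realignment is encoded by its core, except the spanning stars *)

Section CanonicalForm.
Import boot.finset boot.fintype.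
Local Open Scope nat_scope.
Local Open Scope set_scope.
Context (V : finType) (G : simple_graph V) (hn : 3 <= #|V|).

Definition star (y : V) : realignment_data V :=
  ([set: V], [set [set y; x] | x in [set~ y]], [ffun=> set0]).

Section Canonical.
Context (D : realignment_data V).
Context (hD : is_realignment G D).
Let A := tree_vertices D.
Let E := tree_edges D.
Let I := core D.

Lemma attach_in b : b \in A -> attach D b = set0.
Proof.
move=> bA; have [_ _ /pffun_onP[/subsetP sp _] _] := hD.
by apply/eqP/negPn/negP => h; have := sp b; rewrite !inE bA => /(_ h).
Qed.

Lemma attach_out b : b \notin A -> attach D b \in E.
Proof.
move=> bA; have [_ _ /pffun_onP[_ im] _] := hD.
by apply: im; apply: image_f; rewrite inE.
Qed.

Lemma real_tree : is_subtree G A E. Proof. by case: hD. Qed.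

Lemma real_edge e : e \in E -> e \in edges G.
Proof. by have [EG _ _ _] := real_tree; exact: (subsetP EG). Qed.

Lemma nb_vertex x w : w \in nb E x -> [/\ x \in A, w \in A & G x w].
Proof. by rewrite nbP => h; have [] := edge_in_subtree real_tree h. Qed.

Lemma coreA : I \subset A.
Proof.
apply/subsetP => x; rewrite !inE => /orP[x2|/bigcupP[b _ xb]].
  have /card_gt0P[w /nb_vertex[]//] : 0 < #|nb E x| by exact: ltn_trans x2.
have bA : b \notin A by apply/negP => /attach_in h; rewrite h inE in xb.
have [_ EA _ _] := real_tree.
exact: (subsetP (EA _ (attach_out bA))).
Qed.

Lemma attach_core b : attach D b \subset I.
Proof. by apply: subset_trans (subsetUr _ _); exact: bigcup_sup. Qed.

Lemma leaf_nb x : x \in A -> x \notin I -> exists y, nb E x = [set y].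
Proof.
have [A2 _ _ _] := hD; move=> xA; rewrite !inE negb_or -leqNgt => /andP[x1 _].
by apply/cards1P; rewrite eqn_leq x1 (nb_card_gt0 real_tree).
Qed.

Lemma leaf_nb_core x y : x \in A -> x \notin I -> nb E x = [set y] -> y \in I.
Proof.
move=> xA xI xy; apply/negPn/negP => yI.
have yx : y \in nb E x by rewrite xy inE.
have [_ yA xyG] := nb_vertex yx.
have [z yz] := leaf_nb yA yI.
have zx : z = x by move: yx; rewrite nb_sym yz inE => /eqP.
have [_ _ cn _] := real_tree.
have all2 z' : z' \in A -> z' \in [set x; y].
  move=> zA; have /connectP[p pP ->] := cn _ _ xA zA.
  suff H : forall u, u \in [set x; y] -> path (tree_rel E) u p -> last u p \in [set x; y].
    by apply: H => //; rewrite set21.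
  elim: p {pP} => [|v p IH] u //= uxy /andP[uv pv]; apply: IH => //.
  have : v \in nb E u by rewrite nbP.
  by case/set2P: uxy => ->; rewrite ?xy ?yz ?zx !inE => /eqP ->; rewrite eqxx ?orbT.
have Ac : #|A| <= 2.
  apply: leq_trans (subset_leq_card (_ : A \subset [set x; y])) _.
    by apply/subsetP => z' /all2.
  by rewrite cards2; case: (x != y).
have /subsetPn[b _ bA] : ~~ ([set: V] \subset A).
  apply/negP => /subset_leq_card; rewrite cardsT => h.
  by move: (leq_trans (leq_trans hn h) Ac).
have bE := attach_out bA; have [_ EA _ _] := real_tree.
have /subsetP sub : attach D b \subset [set x; y].
  by apply/subsetP => w /(subsetP (EA _ bE)); exact: all2.
have c2 := card_edge (real_edge bE).
have e : attach D b = [set x; y].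
  by apply/eqP; rewrite eqEcard c2 cards2; case: (x != y); rewrite ?andbT; apply/subsetP.
by have := subsetP (attach_core b) x; rewrite e set21 (negbTE xI) => /(_ isT).
Qed.

Lemma mk_core_valid : 2 <= #|I| -> valid G I (ecore D) (posn D).
Proof.
move=> I2; have [A2 [EG EA cn ac] _ rG] := hD.
have ecP e : (e \in ecore D) = (e \in E) && (e \subset I) by rewrite inE.
have posE b : b \notin I -> posn D b = if b \in A then nb E b else attach D b.
  by move=> bI; rewrite /posn ffunE (negbTE bI).
split => //.
- split.
  + by apply/subsetP => e; rewrite ecP => /andP[/(subsetP EG)].
  + by move=> e; rewrite ecP => /andP[].
  (* The map [rho] sends every leaf to its neighbour and fixes the core. It turns tree paths into
     walks in the core, which is therefore connected. *)
  + pose rho z := if z \in I then z else if [pick w in nb E z] is Some w then w else z.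
    have rhoI z : z \in I -> rho z = z by rewrite /rho => ->.
    have rhoN z w : z \in A -> z \notin I -> w \in nb E z -> rho z = w.
      move=> zA zI; have [y zy] := leaf_nb zA zI; rewrite zy inE => /eqP ->.
      rewrite /rho (negbTE zI) zy; case: pickP => [v|/(_ y)]; rewrite inE; first by move/eqP.
      by rewrite eqxx.
    have step u w : tree_rel E u w -> connect (tree_rel (ecore D)) (rho u) (rho w).
      move=> uw; have wu : w \in nb E u by rewrite nbP.
      have uw' : u \in nb E w by rewrite nb_sym.
      have [uA wA _] := nb_vertex wu.
      have [uI|uI] := boolP (u \in I); last first.
        have [y uy] := leaf_nb uA uI; have yI := leaf_nb_core uA uI uy.
        have wy : w = y by move: wu; rewrite uy inE => /eqP.
        by rewrite (rhoN _ _ uA uI wu) rhoI ?connect0// wy.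
      have [wI|wI] := boolP (w \in I); last first.
        by rewrite (rhoN _ _ wA wI uw') rhoI ?connect0.
      rewrite !rhoI//; apply: connect1; rewrite /tree_rel /= ecP.
      by rewrite -nbP wu subUset !sub1set uI wI.
    move=> x y xI yI; rewrite -(rhoI _ xI) -(rhoI _ yI).
    have /connectP[p pP ->] := cn _ _ (subsetP coreA _ xI) (subsetP coreA _ yI).
    elim: p x {xI} pP => [|v p IH] x //= /andP[xv pv].
    exact: connect_trans (step _ _ xv) (IH _ pv).
  + move=> c /andP[cc uc]; apply: ac; apply/andP; split => //.
    by apply: sub_cycle cc => x y; rewrite /tree_rel /= ecP => /andP[].
- by move=> b bI; rewrite /posn ffunE bI.
- move=> b bI; rewrite posE//; case: ifPn => bA.
    by have [y by_] := leaf_nb bA bI; right; exists y => //; exact: leaf_nb_core by_.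
  by left; rewrite ecP attach_out// attach_core.
- move=> b v; rewrite /posn ffunE; case: ifP => [_|bI]; first by rewrite inE.
  case: ifPn => bA; first by case/nb_vertex.
  exact: rG.
Qed.

Lemma mk_core : 2 <= #|I| -> D = mk I (ecore D) (posn D).
Proof.
move=> I2; have [A2 [EG EA cn ac] _ rG] := hD.
have posE b : posn D b = if b \in I then set0 else if b \in A then nb E b else attach D b.
  by rewrite ffunE.
have att2 b : b \notin A -> #|attach D b| = 2 by move=> bA; exact: card_edge (real_edge (attach_out bA)).
have nI b : b \notin A -> b \notin I by apply: contra; exact: (subsetP coreA).
rewrite [LHS](_ : D = (A, E, attach D)); last by rewrite /A /E /attach /tree_vertices /tree_edges; case: (D) => [[]].
congr (_, _, _).
- apply/setP => b; rewrite in_setU (_ : (b \in [set _ | _]) = (#|posn D b| == 1)); last by rewrite inE.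
  rewrite posE; have [bI|bI] /= := boolP (b \in I).
    by rewrite (subsetP coreA).
  case: ifPn => bA; last by rewrite att2.
  by have [y ->] := leaf_nb bA bI; rewrite cards1.
- apply/setP => e; rewrite !inE; apply/idP/idP => [eE|].
    have [u [w [euw uw]]] := edgeE (real_edge eE).
    have wu : w \in nb E u by rewrite nbP -euw.
    have [uA wA _] := nb_vertex wu.
    rewrite eE /=; have [uI|uI] := boolP (u \in I); last first.
      apply/orP; right; apply/existsP; exists u; apply/existsP; exists w.
      rewrite posE (negbTE uI) uA euw setUC eqxx andbT.
      by have [y uy] := leaf_nb uA uI; move: wu; rewrite uy inE => /eqP ->.
    have [wI|wI] := boolP (w \in I).
      by rewrite euw subUset !sub1set uI wI.
    apply/orP; right; apply/existsP; exists w; apply/existsP; exists u.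
    rewrite posE (negbTE wI) wA euw eqxx andbT.
    have [y wy] := leaf_nb wA wI; move: wu; rewrite nb_sym wy inE => /eqP ->.
    by [].
  case/orP => [/andP[]//|/existsP[b /existsP[v /andP[/eqP pb /eqP ->]]]].
  move: pb; rewrite posE; case: ifP => [_ h|_]; first by have := set11 v; rewrite -h inE.
  case: ifPn => bA h; first by rewrite setUC -nbP h inE.
  by have := att2 _ bA; rewrite h cards1.
- apply/ffunP => b; rewrite ffunE posE; have [bI|bI] := boolP (b \in I).
    by rewrite cards0 /= attach_in// (subsetP coreA).
  have [bA|bA] := boolP (b \in A); last by rewrite att2.
  by have [y ->] := leaf_nb bA bI; rewrite cards1 /= attach_in.
Qed.

(** A vertex outside the tree would contribute the two ends of an edge to the core. So the tree
    spans, and every vertex other than the unique core vertex is a leaf hanging at it. *)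
Lemma small_core_star : #|I| < 2 ->
  exists y, [/\ y \in universal_vertices G, I = [set y] & D = star y].
Proof.
move=> I1; have AT x : x \in A.
  apply/negPn/negP => xA; have := subset_leq_card (attach_core x).
  by rewrite (card_edge (real_edge (attach_out xA))) => /leq_ltn_trans/(_ I1).
have /card_gt0P[x0 _] : 0 < #|V| by exact: ltn_trans hn.
have [y yI] : exists y, y \in I.
  have [xI|xI] := boolP (x0 \in I); first by exists x0.
  by have [y xy] := leaf_nb (AT x0) xI; exists y; exact: leaf_nb_core xy.
have Iy : I = [set y].
  by apply/eqP; rewrite eq_sym eqEcard sub1set yI cards1 -ltnS.
have nbx x : x != y -> nb E x = [set y].
  move=> xy; have xI : x \notin I by rewrite Iy inE.
  have [z xz] := leaf_nb (AT x) xI.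
  by have := leaf_nb_core (AT x) xI xz; rewrite Iy inE xz => /eqP ->.
exists y; split => //.
  apply/universalP => w wy; have : y \in nb E w by rewrite nbx// inE.
  by case/nb_vertex => _ _; rewrite adj_sym.
rewrite [LHS](_ : D = (A, E, attach D)); last by rewrite /A /E /attach /tree_vertices /tree_edges; case: (D) => [[]].
congr (_, _, _).
- by apply/setP => x; rewrite inE AT.
- apply/setP => e; apply/idP/imsetP => [eE|[x]].
    have [u [w [euw uw]]] := edgeE (real_edge eE).
    have wu : w \in nb E u by rewrite nbP -euw.
    have [uy|uy] := eqVneq u y.
      exists w; rewrite ?euw ?uy// !inE -uy.
      by apply: contraTneq uw => ->; rewrite adj_irr.
    exists u; first by rewrite !inE.
    by move: wu; rewrite nbx// inE => /eqP <-; rewrite setUC.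
  rewrite !inE => xy ->; rewrite setUC -nbP nbx// inE//.
- by apply/ffunP => b; rewrite ffunE attach_in.
Qed.

End Canonical.

Lemma nb_pair (x y u : V) : x != y ->
  nb [set [set x; y]] u = if u == x then [set y] else if u == y then [set x] else set0.
Proof.
move=> xy.
have nb1 v w : ([set v; w] \in [set [set x; y]]) = (v == x) && (w == y) || (v == y) && (w == x).
  rewrite inE; apply/eqP/orP => [e|[/andP[/eqP-> /eqP->]//|/andP[/eqP-> /eqP->]]]; last by rewrite setUC.
  have : v \in [set x; y] by rewrite -e set21.
  have : w \in [set x; y] by rewrite -e set22.
  have : x \in [set v; w] by rewrite e set21.
  have : y \in [set v; w] by rewrite e set22.
  rewrite !inE => h1 h2 /orP[]/eqP wE /orP[]/eqP vE; rewrite wE vE ?eqxx ?orbT; auto.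
    by move: h1; rewrite wE vE orbb eq_sym (negbTE xy).
  by move: h2; rewrite wE vE orbb (negbTE xy).
apply/setP => w; rewrite nbP nb1.
case: (u =P x) => [->|_] /=; first by rewrite (negbTE xy) orbF inE.
by case: (u =P y) => _ /=; rewrite inE.
Qed.

Lemma pair_tree (x y : V) : G x y -> is_subtree G [set x; y] [set [set x; y]].
Proof.
move=> Gxy; have xy : x != y by apply: contraTneq Gxy => ->; rewrite adj_irr.
split.
- by rewrite sub1set edgesP.
- by move=> e; rewrite inE => /eqP ->.
- have uv : connect (tree_rel [set [set x; y]]) x y.
    by apply: connect1; rewrite /tree_rel /= inE.
  by move=> u v /set2P[] -> /set2P[] -> //; rewrite tree_connect_sym.
- move=> c uc; rewrite leqNgt; apply/negP => c2.
  case: c uc c2 => // u c uc c2.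
  have [v [w [vw _ _ uv wu]]] := ucycle_nbrs uc c2 (mem_head u c).
  have h1 : v \in nb [set [set x; y]] u by rewrite nbP.
  have h2 : w \in nb [set [set x; y]] u by rewrite nb_sym nbP.
  move: h1 h2 vw; rewrite nb_pair//; case: (u == x); last case: (u == y);
    by rewrite !inE => // /eqP -> /eqP ->; rewrite eqxx.
Qed.

Lemma star_realignment y : y \in universal_vertices G ->
  is_realignment G (star y) /\ core (star y) = [set y].
Proof.
move=> /universalP yU.
have [x xy] : exists x, x != y.
  have /card_gt0P[x] : 0 < #|[set~ y]| by rewrite cardsC1 -subn1 subn_gt0; exact: ltn_trans hn.
  by rewrite !inE => xy; exists x.
(* The star is encoded over the auxiliary edge [xy] with all other vertices placed at [y], so that
   the results on [mk] apply. Nothing is placed at [x], which leaves the core, while a third vertex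
   keeps [y] in it. *)
pose pos : {ffun V -> {set V}} := [ffun b => if b \in [set x; y] then set0 else [set y]].
have vP : valid G [set x; y] [set [set x; y]] pos.
  split.
  - by rewrite cards2 xy.
  - by apply: pair_tree; rewrite adj_sym yU.
  - by move=> b h; rewrite ffunE h.
  - by move=> b h; rewrite ffunE (negbTE h); right; exists y; rewrite ?set22.
  - move=> b v; rewrite ffunE; case: ifP => [_|]; rewrite ?inE// => /norP[_ bY] /eqP ->.
    by rewrite adj_sym yU.
have sE : star y = mk [set x; y] [set [set x; y]] pos.
  congr (_, _, _).
  - by apply/setP => b; rewrite !inE ffunE !inE; case: ifP => //= _; rewrite cards1.
  - apply/setP => e; rewrite !inE; apply/imsetP/orP => [[b]|].
      rewrite !inE => bY ->; have [->|bx] := eqVneq b x; first by left; rewrite setUC.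
      right; apply/existsP; exists b; apply/existsP; exists y.
      by rewrite ffunE !inE (negbTE bx) (negbTE bY) !eqxx.
    case=> [/eqP ->|/existsP[b /existsP[v]]]; first by exists x; rewrite ?inE// setUC.
    rewrite ffunE !inE; case: ifP => [_ /andP[/eqP h]|/norP[_ bY] /andP[/eqP h /eqP ->]].
      by have := set11 v; rewrite -h inE.
    by exists b; rewrite ?inE// (set1_inj h).
  - by apply/ffunP => b; rewrite !ffunE; case: (b \in [set x; y]); rewrite ?cards0// cards1.
rewrite sE; split; first exact: mk_realignment.
rewrite (core_mk vP); apply/setP => u; rewrite !inE nb_pair//.
have [->|uy] := eqVneq u y.
  rewrite orbT /=; have /card_gt0P[z] : 0 < #|~: [set x; y]|.
    by rewrite cardsCs setCK cards2 xy subn_gt0.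
  rewrite !inE => /norP[zx zy]; apply/orP; right; apply/existsP; exists z.
  by rewrite ffunE !inE (negbTE zx) (negbTE zy) /= inE.
rewrite orbF; have [->|//] := eqVneq u x; rewrite cards1 /=.
apply/negbTE/negP => /existsP[b]; rewrite ffunE; case: ifP => _; rewrite !inE//.
exact/negP.
Qed.

Lemma core_neq0 (N : realignment G) : core (val N) != set0.
Proof.
have /asboolP hN := valP N; have [h|/small_core_star] := leqP 2 #|core (val N)|.
  by rewrite -card_gt0; exact: ltn_trans h.
by case/(_ hN) => y [_ -> _]; apply/set0Pn; exists y; rewrite inE.
Qed.

End CanonicalForm.

(** * Automorphisms, comparison of cores, removable leaves *)

Section CoreEquivariance.
Import boot.finset boot.fintype.
Local Open Scope nat_scope.
Local Open Scope set_scope.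
Context (V : finType) (G : simple_graph V) (hn : 3 <= #|V|).

Section Equivariance.
Context (g : {perm V}).
Context (gP : forall x y, G (g x) (g y) = G x y).

Let gE (E : {set {set V}}) : {set {set V}} := [set g @: e | e : {set V} in E].

Lemma mem_gim (X : {set V}) x : (g x \in g @: X) = (x \in X).
Proof. by rewrite mem_imset //; exact: perm_inj. Qed.

Lemma nb_permute E x : nb (gE E) (g x) = g @: nb E x.
Proof.
apply/setP => w; rewrite -(permKV g w) mem_gim !nbP.
exact: tree_rel_permute.
Qed.

Lemma gim_inj : injective (fun X : {set V} => g @: X).
Proof. by apply: imset_inj; exact: perm_inj. Qed.

Lemma attach_permute (D : realignment_data V) b : attach (permute_data g D) (g b) = g @: attach D b.
Proof. by rewrite /attach /permute_data /= ffunE permK. Qed.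

Lemma in_core (D : realignment_data V) x : (x \in core D) = (2 <= #|nb (tree_edges D) x|) || [exists b : V, x \in attach D b].
Proof.
rewrite in_setU (_ : (x \in [set _ | _]) = (2 <= #|nb (tree_edges D) x|)); last by rewrite inE.
congr (_ || _); apply/bigcupP/existsP => [[b _ h]|[b h]]; by exists b.
Qed.

Opaque core.

Lemma core_permute (D : realignment_data V) : core (permute_data g D) = g @: core D.
Proof.
apply/setP => x; rewrite -(permKV g x); set y := (g^-1)%g x; rewrite mem_gim !in_core.
rewrite [tree_edges _]/(gE (tree_edges D)) nb_permute card_imset; last exact: perm_inj.
congr (_ || _); apply/existsP/existsP => -[b].
  by rewrite -(permKV g b) attach_permute mem_gim => h; exists ((g^-1)%g b).
by move=> h; exists (g b); rewrite attach_permute mem_gim.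
Qed.

Lemma in_ecore (D : realignment_data V) e : (e \in ecore D) = (e \in tree_edges D) && (e \subset core D).
Proof. by rewrite inE. Qed.

Lemma ecore_permute (D : realignment_data V) : ecore (permute_data g D) = gE (ecore D).
Proof.
apply/setP => e; rewrite in_ecore core_permute; apply/andP/imsetP => [[]|].
  move=> /imsetP[e' e'E ->] /subsetP h; exists e' => //; rewrite in_ecore e'E /=.
  by apply/subsetP => x xe; rewrite -mem_gim h// mem_gim.
move=> [e' + ->]; rewrite in_ecore => /andP[e'E eC]; split; first exact: imset_f.
exact: imsetS.
Qed.

Lemma posn_permute (D : realignment_data V) b : posn (permute_data g D) (g b) = g @: posn D b.
Proof.
rewrite /posn !ffunE core_permute mem_gim; case: (b \in core D); first by rewrite imset0.
rewrite (_ : (g b \in tree_vertices _) = (b \in tree_vertices D)); last exact: mem_gim.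
rewrite [tree_edges _]/(gE (tree_edges D)) nb_permute permK.
by case: ifP.
Qed.

Lemma mk_permute (C : {set V}) E (pos pos' : {ffun V -> {set V}}) :
  (forall b, pos' (g b) = g @: pos b) ->
  mk (g @: C) (gE E) pos' = permute_data g (mk C E pos).
Proof.
move=> pp; congr (_, _, _); rewrite /tree_vertices /tree_edges /=.
- rewrite imsetU; congr (_ :|: _); apply/setP => b; rewrite -(permKV g b) mem_gim !inE.
  by rewrite pp card_imset//; exact: perm_inj.
- rewrite imsetU; congr (_ :|: _); apply/setP => e; rewrite inE.
  apply/existsP/imsetP => [[b /existsP[v /andP[/eqP pb /eqP ->]]]|[e' + ->]].
    exists [set (g^-1)%g v; (g^-1)%g b]; last by rewrite imsetU !imset_set1 !permKV.
    rewrite inE; apply/existsP; exists ((g^-1)%g b); apply/existsP; exists ((g^-1)%g v).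
    rewrite eqxx andbT; apply/eqP/gim_inj.
    by rewrite -pp permKV imset_set1 permKV.
  rewrite inE => /existsP[b /existsP[v /andP[/eqP pb /eqP ->]]].
  exists (g b); apply/existsP; exists (g v).
  by rewrite pp pb imsetU !imset_set1 !eqxx.
- apply/ffunP => b; rewrite -(permKV g b); set y := (g^-1)%g b.
  rewrite !ffunE permK pp card_imset; last exact: perm_inj.
  by case: ifP => //; rewrite imset0.
Qed.

End Equivariance.

Lemma aut_permP (g : Aut_graph G) x y : G (\val g x) (\val g y) = G x y.
Proof. by have /automorphismsP := valP g. Qed.

Lemma realignment_act_inj (g : Aut_graph G) : injective (@realignment_act V G g).
Proof.
move=> N M /(congr1 val) e; apply: val_inj.
have {e} : permute_data (\val g) (val N) = permute_data (\val g) (val M) := e.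
case: (val N) (val M) => [[A E] r] [[A' E'] r'].
rewrite /permute_data /tree_vertices /tree_edges /= => -[/gim_inj -> eE eR].
have -> : E = E' by move: eE; apply: imset_inj; exact: gim_inj.
congr (_, _, _); apply/ffunP => x.
have := congr1 (fun f : {ffun V -> {set V}} => f (\val g x)) eR.
by rewrite !ffunE permK => /gim_inj.
Qed.

Lemma universal_act (g : Aut_graph G) v :
  (\val g v \in universal_vertices G) = (v \in universal_vertices G).
Proof. by rewrite -{1}(universal_vertices_imset g) mem_gim. Qed.

Implicit Types (N K M : realignment G).

Lemma real_is N : is_realignment G (val N).
Proof. exact/asboolP/(valP N). Qed.

Lemma repP N : 2 <= #|core (val N)| ->
  valid G (core (val N)) (ecore (val N)) (posn (val N)) /\
  val N = mk (core (val N)) (ecore (val N)) (posn (val N)).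
Proof.
by move=> h; split; [apply: mk_core_valid|apply: mk_core] => //; exact: real_is.
Qed.

(** A core with fewer than two vertices belongs to a star, which has no edge position left to
    specify and is therefore minimal. *)
Lemma lowerP N M : realignment_le N M -> N = M \/
  [/\ 2 <= #|core (val M)|,
      valid G (core (val M)) (ecore (val M)) (posover (core (val M)) (val N)),
      forall b, posover (core (val M)) (val N) b \subset posn (val M) b
    & val N = mk (core (val M)) (ecore (val M)) (posover (core (val M)) (val N))].
Proof.
move=> NM; have [h|h] := leqP 2 #|core (val M)|; last first.
  left; have [y [_ _ My]] := small_core_star hn (real_is M) h.
  case/connectP: NM => p; elim: p N => [|K p IH] N /=; first by move=> _ ->.
  case/andP => NK pK KM; move: NK; rewrite (IH _ pK KM).
  case/existsP => b /existsP[v /and3P[_ + _]].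
  by rewrite My /attach /= ffunE inE.
have [vM ME] := repP h.
have [pos [vp sp NE]] := lower_mk ME vM NM.
by right; rewrite NE (posover_mk vp).
Qed.

Lemma core_homo N M : realignment_le N M -> core (val N) \subset core (val M).
Proof.
move=> /lowerP[->//|[h vp _ NE]]; rewrite {1}NE (core_mk vp).
by apply/subsetP => x; rewrite inE => /andP[].
Qed.

Lemma le_same_core N M : realignment_le N M -> core (val N) = core (val M) ->
  ecore (val N) = ecore (val M) /\
  (forall b, posn (val N) b \subset posn (val M) b).
Proof.
move=> /lowerP[->//|[h vp sp NE]] e.
have e' : core (mk (core (val M)) (ecore (val M)) (posover (core (val M)) (val N))) = core (val M).
  by rewrite -NE.
split; first by rewrite {1}NE (ecore_mk vp).
by rewrite /posn e.
Qed.

Lemma same_core_le N M : core (val N) = core (val M) ->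
  ecore (val N) = ecore (val M) ->
  (forall b, posn (val N) b \subset posn (val M) b) ->
  2 <= #|core (val M)| -> realignment_le N M.
Proof.
move=> e e' sub h; have [vM ME] := repP h; have hN : 2 <= #|core (val N)| by rewrite e.
have [vN NE] := repP hN.
rewrite e e' in vN NE; exact: le_mk ME NE vM vN sub.
Qed.

Lemma same_core_eq N M : core (val N) = core (val M) ->
  ecore (val N) = ecore (val M) -> posn (val N) = posn (val M) ->
  2 <= #|core (val M)| -> N = M.
Proof.
move=> e e' p h; have [vM ME] := repP h; have hN : 2 <= #|core (val N)| by rewrite e.
have [vN NE] := repP hN.
by apply: val_inj; rewrite NE e e' p -ME.
Qed.

Definition pnb (D : realignment_data V) x := nb (ecore D) x.

Lemma pnb_core N x y : y \in pnb (val N) x -> x \in core (val N) /\ y \in core (val N).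
Proof. by rewrite nbP in_ecore subUset !sub1set => /and3P[]. Qed.

Lemma pnb_gt0 N x : 2 <= #|core (val N)| -> x \in core (val N) -> 0 < #|pnb (val N) x|.
Proof.
by move=> h xC; have [vN _] := repP h; exact: nb_card_gt0 (valid_tree vN) h xC.
Qed.

(* A leaf [u] of the core is removable when every vertex positioned at [u] can
   be moved along the core edge at [u]. The double stars on two universal
   vertices, which make up the embedded complete graph, are left alone. *)
Definition special (D : realignment_data V) :=
  (#|core D| == 2) && (core D \subset universal_vertices G).

Definition removable (D : realignment_data V) : {set V} :=
  if special D then set0 else
  [set u in core D | (#|pnb D u| == 1) &&
    [forall b, (u \in posn D b) ==> [forall v, (v \in pnb D u) ==> G b v]]].

Lemma special_removable (D : realignment_data V) : special D -> removable D = set0.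
Proof. by rewrite /removable => ->. Qed.

Lemma removableP (D : realignment_data V) u : reflect
  [/\ ~~ special D, u \in core D, #|pnb D u| = 1 &
    forall b v, u \in posn D b -> v \in pnb D u -> G b v] (u \in removable D).
Proof.
rewrite /removable; case: ifP => sp; first by rewrite in_set0; constructor => -[].
rewrite in_set; apply: (iffP and3P) => [[uC /eqP u1 /forallP h]|[_ uC u1 h]].
  split => // b v ub vu; have /implyP/(_ ub)/forallP/(_ v)/implyP := h b; exact.
split => //; first exact/eqP.
by apply/forallP => b; apply/implyP => ub; apply/forallP => v; apply/implyP; exact: h.
Qed.

Lemma special_act (g : Aut_graph G) N : special (val (realignment_act g N)) = special (val N).
Proof.
rewrite /special core_permute card_imset; last exact: perm_inj.
congr (_ && _); apply/subsetP/subsetP => h x xC.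
  by rewrite -(universal_act g) h// mem_gim.
by move: xC => /imsetP[y yC ->]; rewrite universal_act h.
Qed.

Lemma pnb_act (g : Aut_graph G) N x :
  pnb (val (realignment_act g N)) (\val g x) = \val g @: pnb (val N) x.
Proof. by rewrite /pnb ecore_permute nb_permute. Qed.

Lemma removable_act (g : Aut_graph G) N u :
  (\val g u \in removable (val (realignment_act g N))) = (u \in removable (val N)).
Proof.
have E (x : V) (X : {set V}) : (\val g x \in \val g @: X) = (x \in X) by exact: mem_gim.
apply/removableP/removableP => -[sp uC u1 h]; split.
- by rewrite special_act in sp.
- by rewrite core_permute E in uC.
- by rewrite pnb_act card_imset in u1; last exact: perm_inj.
- move=> b v ub vu; rewrite -(aut_permP g); apply: h.
    by rewrite posn_permute E.
  by rewrite pnb_act E.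
- by rewrite special_act.
- by rewrite core_permute E.
- by rewrite pnb_act card_imset; last exact: perm_inj.
- move=> b v; rewrite -(permKV (\val g) b) -(permKV (\val g) v).
  by rewrite posn_permute pnb_act !E aut_permP; exact: h.
Qed.

Lemma posn_sub N b v : v \in posn (val N) b -> 2 <= #|core (val N)| ->
  [/\ b \notin core (val N), v \in core (val N) & G b v].
Proof. by move=> vb /repP[vN _]; exact: (pos_sub vN vb). Qed.

Lemma special_same N M : core (val N) = core (val M) -> special (val N) = special (val M).
Proof. by rewrite /special => ->. Qed.

(** Only one case is delicate: a vertex [b] at [u] in [M] may have moved off [u] in [N]. Its
    position then was the core edge at [u] and shrank to the other end, which is the unique
    neighbour of [u]; so [b] is adjacent to it anyway. *)
Lemma removable_same N M : realignment_le N M -> core (val N) = core (val M) ->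
  removable (val N) = removable (val M).
Proof.
move=> NM e; have [ee sub] := le_same_core NM e.
have pe x : pnb (val N) x = pnb (val M) x by rewrite /pnb ee.
have es := special_same e.
have [h|h] := leqP 2 #|core (val M)|; last first.
  by case: (lowerP NM) => [->//|[h' _ _ _]]; rewrite leqNgt h in h'.
have hN : 2 <= #|core (val N)| by rewrite e.
apply/setP => u; apply/removableP/removableP => -[sp uC u1 hh]; rewrite ?es ?pe ?e in sp uC u1 hh *; split => //.
  move=> b v ub vu; have [bC _ Gbu] := posn_sub ub h.
  have [ubN|ubN] := boolP (u \in posn (val N) b); first by apply: hh; rewrite ?pe.
  have [vN _] := repP hN; have [vM _] := repP h.
  have bCN : b \notin core (val N) by rewrite e.
  have /set0Pn[w wb] := pos_neq0 vN bCN.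
  have wbM := subsetP (sub b) _ wb.
  have wu : w != u by apply: contraNneq ubN => <-.
  have [h1|[h2 bE]] := card_pos vM bC.
    by move/eqP/cards1P: h1 => [z pz]; move: ub wbM wu; rewrite pz !inE => /eqP -> /eqP ->; rewrite eqxx.
  have : w \in pnb (val M) u.
    rewrite nbP (_ : [set u; w] = posn (val M) b)//; apply/eqP.
    by rewrite eqEcard subUset !sub1set ub wbM h2 cards2 eq_sym wu.
  move/eqP/cards1P: u1 => [z pz]; move: vu; rewrite pz !inE => /eqP -> /eqP <-.
  by have [] := posn_sub wb hN.
by move=> b v ub vu; apply: hh; rewrite // (subsetP (sub b)).
Qed.

(** If [x] leaves the core, then it is a leaf of the larger core and no position over that core
    contains it any more. Every vertex formerly placed at [x] thus had the core edge as its position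
    and moved to the other end, so it is adjacent to that end. *)
Lemma lost_removable N M x : realignment_le N M -> x \in core (val M) ->
  x \notin core (val N) -> ~~ special (val M) ->
  x \in removable (val M) /\ x \notin \bigcup_b posover (core (val M)) (val N) b.
Proof.
move=> /lowerP[->|[h vp sp NE]] xM; first by rewrite xM.
rewrite {1}NE (core_mk vp) inE xM /= negb_or -ltnNge ltnS => /andP[x1 /existsPn xb] nsp.
have xnot : x \notin \bigcup_b posover (core (val M)) (val N) b.
  by apply/bigcupP => -[b _]; rewrite (negbTE (xb b)).
split => //; apply/removableP; split => //.
  by apply/eqP; rewrite eqn_leq x1 (pnb_gt0 h xM).
have [vM _] := repP h.
move=> b v ub vx; have [bC _ Gbx] := posn_sub ub h.
have /set0Pn[w wb] := pos_neq0 vp bC.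
have wbM := subsetP (sp b) _ wb.
have wx : w != x by apply: contraTneq wb => ->; exact: xb.
have [h1|[h2 bE]] := card_pos vM bC.
  by move/eqP/cards1P: h1 => [z pz]; move: ub wbM wx; rewrite pz !inE => /eqP -> /eqP ->; rewrite eqxx.
have wx' : w \in pnb (val M) x.
  rewrite nbP (_ : [set x; w] = posn (val M) b)//; apply/eqP.
  by rewrite eqEcard subUset !sub1set ub wbM h2 cards2 eq_sym wx.
have /cards1P[z pz] : #|pnb (val M) x| == 1 by rewrite eqn_leq x1 (pnb_gt0 h xM).
by move: vx wx'; rewrite pz !inE => /eqP -> /eqP <-; have [] := pos_sub vp wb.
Qed.

End CoreEquivariance.

(** * Changing positions over a fixed core; raising singletons to edges *)

Section Raising.
Import boot.finset boot.fintype.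
Local Open Scope nat_scope.
Local Open Scope set_scope.
Context (V : finType) (G : simple_graph V) (hn : 3 <= #|V|).
Local Opaque core.
Implicit Types (N K M : realignment G).

Lemma permute_dataK (g : {perm V}) : cancel (permute_data g) (permute_data g^-1%g).
Proof.
have sK (X : {set V}) : g^-1%g @: (g @: X) = X.
  by rewrite -imset_comp -[RHS]imset_id; apply: eq_imset => x /=; rewrite permK.
move=> [[A E] r]; congr (_, _, _); rewrite /tree_vertices /tree_edges /=.
- exact: sK.
- by rewrite -imset_comp -[RHS]imset_id; apply: eq_imset => x /=; rewrite sK.
- by apply/ffunP => x; rewrite /attach /= !ffunE invgK sK permK.
Qed.

Lemma realignment_act_le (g : Aut_graph G) N M :
  realignment_le (realignment_act g N) (realignment_act g M) = realignment_le N M.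
Proof.
apply/idP/idP; last exact: realignment_act_homo.
pose g' : Aut_graph G := exist (fun h => h \in automorphism_group G) _ (groupVr (valP g)).
have gK K : realignment_act g' (realignment_act g K) = K.
  by apply: val_inj; exact: permute_dataK.
by move/(@realignment_act_homo V G g'); rewrite !gK.
Qed.

Lemma order_complexP (s : {set realignment G}) :
  reflect (s != set0 /\ {in s &, forall x y, realignment_le x y || realignment_le y x})
    (s \in order_complex (realignment G)).
Proof.
rewrite inE; apply: (iffP andP) => -[s0 h]; split => //.
  by move=> x y xs ys; have /forall_inP/(_ _ xs)/forall_inP/(_ _ ys) := h.
by apply/forall_inP => x xs; apply/forall_inP => y ys; exact: h.
Qed.

Section Reduction.
Context (R : realType).

Lemma realignment_complex_actE (g : Aut_graph G) (x : realignment_complex G R) N :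
  \val (realignment_complex_act g x) (realignment_act g N) = \val x N.
Proof.
rewrite /= (bigD1 N)//= big1 ?addr0// => M /andP[/eqP/realignment_act_inj ->].
by rewrite eqxx.
Qed.

Definition reduces (Q Q' : {set realignment G}) :=
  retracts_to (@realignment_complex_act V G R) Q Q'.

Definition stable (Q : {set realignment G}) :=
  forall (g : Aut_graph G) N, (realignment_act g N \in Q) = (N \in Q).

Lemma reduces_closure (Q : {set realignment G}) f :
  {in Q, forall N, f N \in Q} -> {in Q, forall N, realignment_le N (f N)} ->
  {in Q, forall N, f (f N) = f N} ->
  {in Q &, forall N M, realignment_le N M -> realignment_le (f N) (f M)} ->
  stable Q ->
  (forall g : Aut_graph G, {in Q, forall N, f (realignment_act g N) = realignment_act g (f N)}) ->
  reduces Q [set N in Q | f N == N].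
Proof.
move=> *; apply: (@closure_retract R _ _ _ (@realignment_act V G) _ (@realignment_le V G)) => //.
- exact: realignment_act_inj.
- exact: realignment_complex_actE.
- exact: realignment_le_refl.
- exact: realignment_le_anti.
- exact: realignment_le_trans.
- exact: realignment_act_le.
- exact: order_complexP.
Qed.

Lemma reduces_kernel (Q : {set realignment G}) f :
  {in Q, forall N, f N \in Q} -> {in Q, forall N, realignment_le (f N) N} ->
  {in Q, forall N, f (f N) = f N} ->
  {in Q &, forall N M, realignment_le N M -> realignment_le (f N) (f M)} ->
  stable Q ->
  (forall g : Aut_graph G, {in Q, forall N, f (realignment_act g N) = realignment_act g (f N)}) ->
  reduces Q [set N in Q | f N == N].
Proof.
move=> *; apply: (@kernel_retract R _ _ _ (@realignment_act V G) _ (@realignment_le V G)) => //.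
- exact: realignment_act_inj.
- exact: realignment_complex_actE.
- exact: realignment_le_refl.
- exact: realignment_le_anti.
- exact: realignment_le_trans.
- exact: realignment_act_le.
- exact: order_complexP.
Qed.

End Reduction.

Definition repos_pos N (h : V -> {set V} -> {set V}) : {ffun V -> {set V}} :=
  [ffun b => if b \in core (val N) then set0 else h b (posn (val N) b)].

(** The default value [N] only matters when the new positions violate [repos_ok]. *)
Definition repos N (h : V -> {set V} -> {set V}) : realignment G :=
  insubd N (mk (core (val N)) (ecore (val N)) (repos_pos N h)).

Definition repos_ok N (h : V -> {set V} -> {set V}) :=
  forall b, b \notin core (val N) ->
    cell (core (val N)) (ecore (val N)) (h b (posn (val N) b)) /\
    (forall v, v \in h b (posn (val N) b) -> G b v).

Lemma posn_core N b : b \in core (val N) -> posn (val N) b = set0.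
Proof. by move=> h; rewrite ffunE h. Qed.

Lemma repos_pos_homo N M (h h' : V -> {set V} -> {set V}) :
  core (val N) = core (val M) ->
  (forall b, h b (posn (val N) b) \subset h' b (posn (val M) b)) ->
  forall b, repos_pos N h b \subset repos_pos M h' b.
Proof.
move=> cE hh b; rewrite [repos_pos N h b]ffunE [repos_pos M h' b]ffunE cE.
by case: ifP => _; [exact: sub0set|exact: hh].
Qed.

Lemma le_of_posn N M (p q : {ffun V -> {set V}}) :
  core (val N) = core (val M) -> ecore (val N) = ecore (val M) ->
  2 <= #|core (val M)| -> posn (val N) = p -> posn (val M) = q ->
  (forall b, p b \subset q b) -> realignment_le N M.
Proof.
by move=> cE eE c2 pN pM pq; apply: (same_core_le hn cE eE) => // b; rewrite pN pM.
Qed.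

Lemma reposP N h : 2 <= #|core (val N)| -> repos_ok N h ->
  valid G (core (val N)) (ecore (val N)) (repos_pos N h) /\
  val (repos N h) = mk (core (val N)) (ecore (val N)) (repos_pos N h).
Proof.
move=> h2 ok; have [[_ tr _ _ _] _] := repP hn h2.
have vp : valid G (core (val N)) (ecore (val N)) (repos_pos N h).
  split => //.
  - by move=> b bC; rewrite ffunE bC.
  - by move=> b bC; rewrite ffunE (negbTE bC); have [] := ok b bC.
  - move=> b v; rewrite ffunE; case: ifPn => bC; first by rewrite in_set0.
    by have [_] := ok b bC; exact.
by split=> //; rewrite insubdK//; apply/asboolP; exact: mk_realignment.
Qed.

Lemma repos_lower N h : 2 <= #|core (val N)| -> repos_ok N h ->
  (forall b, b \notin core (val N) -> h b (posn (val N) b) \subset posn (val N) b) ->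
  realignment_le (repos N h) N.
Proof.
move=> h2 ok sub; have [vN NE] := repP hn h2; have [vp pE] := reposP h2 ok.
apply: (le_mk NE pE vN vp) => b; rewrite ffunE; case: ifPn => [_|]; first exact: sub0set.
exact: sub.
Qed.

(** Enlarging positions keeps the core: it cannot shrink by [core_homo], and by [core_mk] it stays
    inside the tree over which the cell is written. *)
Lemma repos_upper N h : 2 <= #|core (val N)| -> repos_ok N h ->
  (forall b, b \notin core (val N) -> posn (val N) b \subset h b (posn (val N) b)) ->
  [/\ realignment_le N (repos N h), core (val (repos N h)) = core (val N),
      ecore (val (repos N h)) = ecore (val N)
    & posn (val (repos N h)) = repos_pos N h].
Proof.
move=> h2 ok sub; have [vN NE] := repP hn h2; have [vp pE] := reposP h2 ok.
have le : realignment_le N (repos N h).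
  apply: (le_mk pE NE vp vN) => b; rewrite [repos_pos N h b]ffunE.
  by case: ifPn => [/posn_core ->|] //; exact: sub.
have ce : core (val (repos N h)) = core (val N).
  apply/eqP; rewrite eqEsubset (core_homo hn le) andbT {1}pE (core_mk vp).
  by apply/subsetP => x; rewrite in_set => /andP[].
split => //; first by rewrite pE (ecore_mk vp) -?pE.
by rewrite pE (posn_mk vp) -?pE.
Qed.

Lemma repos_act (g : Aut_graph G) N h h' : 2 <= #|core (val N)| ->
  repos_ok N h ->
  (forall b, b \notin core (val N) ->
    h' (\val g b) (\val g @: posn (val N) b) = \val g @: h b (posn (val N) b)) ->
  repos (realignment_act g N) h' = realignment_act g (repos N h).
Proof.
move=> h2 ok hh; have [vp pE] := reposP h2 ok.
have rE : mk (core (val (realignment_act g N))) (ecore (val (realignment_act g N)))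
    (repos_pos (realignment_act g N) h') = permute_data (\val g) (val (repos N h)).
  rewrite pE core_permute ecore_permute; apply: mk_permute => b.
  rewrite [LHS]ffunE [repos_pos N h b]ffunE core_permute mem_gim.
  case: ifPn => bC; first by rewrite imset0.
  by rewrite posn_permute hh.
apply: val_inj; rewrite /repos insubdK rE//.
exact: (valP (realignment_act g (repos N h))).
Qed.

Lemma permute_sub (g : {perm V}) (X Y : {set V}) : (g @: X \subset g @: Y) = (X \subset Y).
Proof.
apply/idP/idP; last exact: imsetS.
by move/subsetP => h; apply/subsetP => x xX; rewrite -(mem_gim g) h// mem_gim.
Qed.

Section Raise.
Context (R : realType) (Q : {set realignment G}) (act : pred (realignment G)).
Context (Z W : realignment G -> V -> {set V}).
Context (act_core : {in Q, forall N, act N -> 2 <= #|core (val N)|}).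
Context (act_same : forall N M, realignment_le N M -> core (val N) = core (val M) ->
  [/\ act N = act M, forall b, Z N b = Z M b & forall b, W N b = W M b]).
Context (target : {in Q, forall N, act N -> forall b u, b \notin core (val N) ->
  posn (val N) b = [set u] -> u \in Z N b ->
  exists2 v, pnb (val N) u :&: W N b = [set v] & G b v}).
Context (act_homo : {in Q &, forall N M, realignment_le N M -> act N ->
  core (val N) = core (val M)}).
Context (wide : {in Q, forall N, act N -> forall b u v, u \in Z N b ->
  u \in posn (val N) b -> v \in posn (val N) b -> v != u -> v \in W N b}).

(* Enlarges the singleton positions [[set u]], [u] in [Z N b], to the edges
   joining [u] to its core neighbours in [W N b]. *)
Definition raiseh N b (X : {set V}) :=
  if [exists u, (u \in Z N b) && (X == [set u])]
  then X :|: ((\bigcup_(u in X) pnb (val N) u) :&: W N b) else X.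

(** Used three times: with [Z] the removable leaves of the core and [W] everything; with [Z] the
    vertices about to be pruned from the forest of [b]; and with [Z] the leaves remaining in that
    forest. In the last two cases [W] is the forest. *)
Definition raise N := if act N then repos N (raiseh N) else N.

Lemma raise_inactive N : ~~ act N -> raise N = N.
Proof. by rewrite /raise => /negbTE ->. Qed.

Lemma raisehP N b : N \in Q -> act N -> b \notin core (val N) ->
  (exists u v, [/\ posn (val N) b = [set u], u \in Z N b,
      pnb (val N) u :&: W N b = [set v], G b v
    & raiseh N b (posn (val N) b) = [set u; v]]) \/
  ((forall u, posn (val N) b = [set u] -> u \notin Z N b) /\
    raiseh N b (posn (val N) b) = posn (val N) b).
Proof.
move=> NQ aN bC; rewrite /raiseh; case: ifPn => [/existsP[u /andP[uZ /eqP pu]]|h].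
  have [v uv Gv] := target NQ aN bC pu uZ.
  by left; exists u, v; rewrite pu big_set1 uv.
right; split => // u pu; apply: contra h => uZ; apply/existsP; exists u.
by rewrite uZ pu eqxx.
Qed.

Lemma raise_ok N : N \in Q -> act N -> repos_ok N (raiseh N).
Proof.
move=> NQ aN b bC; have h2 := act_core NQ aN; have [vN _] := repP hn h2.
have [_ _ _ pc pG] := vN.
have [[u [v [pu uZ uv Gv ->]]]|[_ ->]] := raisehP NQ aN bC; last first.
  by split; [exact: pc|move=> v; exact: pG].
have : v \in pnb (val N) u :&: W N b by rewrite uv in_set1.
rewrite in_setI nbP => /andP[uvE _]; split; first by left.
by move=> w /set2P[] -> //; apply: pG; rewrite pu in_set1.
Qed.

Lemma raise_sub N b : N \in Q -> act N -> b \notin core (val N) ->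
  posn (val N) b \subset raiseh N b (posn (val N) b).
Proof. by move=> *; rewrite /raiseh; case: ifP => // _; exact: subsetUl. Qed.

Lemma raiseP N : N \in Q -> act N ->
  [/\ realignment_le N (raise N), core (val (raise N)) = core (val N),
      ecore (val (raise N)) = ecore (val N)
    & posn (val (raise N)) = repos_pos N (raiseh N)].
Proof.
move=> NQ aN; rewrite /raise aN; apply: repos_upper; first exact: act_core.
  exact: raise_ok.
by move=> b bC; exact: raise_sub.
Qed.

Lemma raise_fix N : N \in Q -> act N -> raise N = N ->
  forall b u, b \notin core (val N) -> posn (val N) b = [set u] -> u \notin Z N b.
Proof.
move=> NQ aN fN b u bC pu; apply/negP => uZ.
have [_ _ _] := raiseP NQ aN; rewrite fN => /ffunP/(_ b).
rewrite [in RHS]ffunE (negbTE bC).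
have [[u' [v [pu' _ uv _ ->]]]|[h _ _]] := raisehP NQ aN bC; last first.
  by have := h _ pu; rewrite uZ.
rewrite pu' => /setP/(_ v); rewrite set22 in_set1 => /eqP vu'.
have : v \in pnb (val N) u' :&: W N b by rewrite uv in_set1.
rewrite in_setI vu' nbP => /andP[h _]; have h2 := act_core NQ aN; have [vN _] := repP hn h2.
by have [_ _] := edge_in_subtree (valid_tree vN) h; rewrite adj_irr.
Qed.

Lemma raise_id N : N \in Q -> act N ->
  (forall b u, b \notin core (val N) -> posn (val N) b = [set u] -> u \notin Z N b) ->
  raise N = N.
Proof.
move=> NQ aN h; have [_ cE eE pE] := raiseP NQ aN.
apply: (same_core_eq hn) => //; last exact: act_core.
rewrite pE; apply/ffunP => b; rewrite ffunE; case: ifPn => bC; first by rewrite posn_core.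
by have [[u [v [pu uZ _ _ _]]]|[_ ->]//] := raisehP NQ aN bC; rewrite (negbTE (h _ _ bC pu)) in uZ.
Qed.

Context (raiseQ : {in Q, forall N, act N -> raise N \in Q}).
Context (stQ : stable Q).
Context (act_act : forall (g : Aut_graph G) N, act (realignment_act g N) = act N).
Context (Z_act : forall (g : Aut_graph G) N b u,
  (\val g u \in Z (realignment_act g N) (\val g b)) = (u \in Z N b)).
Context (W_act : forall (g : Aut_graph G) N b u,
  (\val g u \in W (realignment_act g N) (\val g b)) = (u \in W N b)).

Lemma raise_equivariant (g : Aut_graph G) N : N \in Q ->
  raise (realignment_act g N) = realignment_act g (raise N).
Proof.
move=> NQ; rewrite /raise act_act; case: ifPn => // aN.
apply: repos_act; [exact: act_core|exact: raise_ok|].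
move=> b bC; rewrite /raiseh.
have -> : [exists u, (u \in Z (realignment_act g N) (\val g b)) &&
    (\val g @: posn (val N) b == [set u])] =
  [exists u, (u \in Z N b) && (posn (val N) b == [set u])].
  apply/existsP/existsP => -[u /andP[uZ /eqP pu]].
    exists ((\val g)^-1%g u); rewrite -(Z_act g) permKV uZ /=.
    by apply/eqP/(@gim_inj V (\val g)); rewrite pu imset_set1 permKV.
  by exists (\val g u); rewrite Z_act uZ pu imset_set1 eqxx.
case: ifP => // _; rewrite imsetU; congr (_ :|: _).
apply/setP => w; rewrite -(permKV (\val g) w); set y := ((\val g)^-1%g w).
rewrite (mem_gim (\val g)) !in_setI W_act; congr (_ && _).
apply/bigcupP/bigcupP => -[u ub].
  move: ub => /imsetP[u' ub ->]; rewrite pnb_act (mem_gim (\val g)) => h.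
  by exists u'.
by move=> h; exists (\val g u); rewrite ?pnb_act ?(mem_gim (\val g)).
Qed.

Lemma raise_reduces : reduces R Q [set N in Q | raise N == N].
Proof.
have rQ N : N \in Q -> raise N \in Q.
  by move=> NQ; have [/(raiseQ NQ)//|aN] := boolP (act N); rewrite /raise (negbTE aN).
apply: reduces_closure => //.
- move=> N NQ; have [aN|aN] := boolP (act N); first by have [] := raiseP NQ aN.
  by rewrite /raise (negbTE aN) realignment_le_refl.
- move=> N NQ; have [aN|aN] := boolP (act N); last by rewrite /raise !(negbTE aN).
  have [le cE eE pE] := raiseP NQ aN.
  have [aE ZE WE] := act_same le (esym cE).
  apply: raise_id; [exact: rQ|by rewrite -aE|].
  rewrite cE => b u bC; rewrite pE ffunE (negbTE bC) -ZE.
  have [[u' [v [pu uZ uv Gv ->]]]|[h ->]] := raisehP NQ aN bC; last exact: h.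
  move=> e; have vu : v = u' by move/setP: e => e; have := e v; have := e u'; rewrite set21 set22 !in_set1 => /esym/eqP -> /esym/eqP ->.
  have : v \in pnb (val N) u' :&: W N b by rewrite uv in_set1.
  rewrite in_setI vu nbP => /andP[hE _]; have [vN _] := repP hn (act_core NQ aN).
  by have [_ _] := edge_in_subtree (valid_tree vN) hE; rewrite adj_irr.
- move=> N M NQ MQ NM.
  have [aN|aN] := boolP (act N); last first.
    rewrite {1}/raise (negbTE aN).
    have [aM|aM] := boolP (act M); last by rewrite /raise (negbTE aM).
    by have [le _ _ _] := raiseP MQ aM; exact: realignment_le_trans NM le.
  have cE := act_homo NQ MQ NM aN; have [aE ZE WE] := act_same NM cE.
  have aM : act M by rewrite -aE.
  have [eE sub] := le_same_core hn NM cE.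
  have [_ cN eN pN] := raiseP NQ aN; have [_ cM eM pM] := raiseP MQ aM.
  apply: (same_core_le hn); rewrite ?cN ?cM ?eN ?eM//; last exact: act_core.
  move=> b; rewrite pN pM [repos_pos N _ b]ffunE [repos_pos M _ b]ffunE cE; case: ifPn => // bC.
  have bCN : b \notin core (val N) by rewrite cE.
  have [[u [v [pu uZ uv Gv ->]]]|[h ->]] := raisehP NQ aN bCN; last first.
    by apply: subset_trans (sub b) _; exact: raise_sub.
  have ub : u \in posn (val M) b by apply: (subsetP (sub b)); rewrite pu in_set1.
  have uvM : pnb (val M) u :&: W M b = [set v] by rewrite -uv /pnb eE WE.
  have uZM : u \in Z M b by rewrite -ZE.
  have [[u' [v' [pu' uZ' uv' Gv' ->]]]|[h ->]] := raisehP MQ aM bC.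
    move: ub; rewrite pu' in_set1 => /eqP uu'; move: uv'; rewrite -uu' uvM => /set1_inj ->.
    exact: subxx.
  have [vM _] := repP hn (act_core MQ aM).
  have [/eqP/cards1P[z pz]|[h2 hE]] := card_pos vM bC.
    move: ub; rewrite pz in_set1 => /eqP uz.
    by have := h z pz; rewrite -uz uZM.
  (* Here [M] already places [b] on an edge at [u]. By [wide] the other end of this edge lies in
     [W], so it is the target [v], and the raised position of [N] is contained in it. *)
  have : 0 < #|posn (val M) b :\ u| by move: h2; rewrite (cardsD1 u) ub add1n => -[->].
  case/card_gt0P => w; rewrite !in_setD1 => /andP[wu wb].
  have wv : w \in pnb (val M) u :&: W M b.
    rewrite in_setI (wide MQ aM uZM ub wb wu) andbT nbP.
    rewrite (_ : [set u; w] = posn (val M) b)//; apply/eqP.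
    by rewrite eqEcard subUset !sub1set ub wb h2 cards2 eq_sym wu.
  move: wv; rewrite uvM in_set1 => /eqP <-.
  by rewrite subUset !sub1set ub wb.
- by move=> g N NQ; exact: raise_equivariant.
Qed.

End Raise.

End Raising.

(** * Pruning the cores *)

Section PruningCores.
Import boot.finset boot.fintype.
Local Open Scope nat_scope.
Local Open Scope set_scope.
Context (V : finType) (G : simple_graph V) (hn : 3 <= #|V|).
Local Opaque core raise repos.
Local Notation removable := (removable G).
Local Notation special := (special G).
Implicit Types (N K M : realignment G).

Lemma reduces_conical (R : realType) (Q B : {set realignment G}) p al :
  B \subset Q ->
  {in B, forall N, p N \in Q :\: B} ->
  {in B, forall N, strict (@realignment_le V G) (p N) N} ->
  {in B & Q :\: B, forall N y, strict (@realignment_le V G) y N ->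
    [/\ al N y \in Q :\: B, strict (@realignment_le V G) (al N y) N,
        realignment_le y (al N y) & realignment_le (p N) (al N y)]} ->
  {in B & Q :\: B & Q :\: B, forall N y z,
    strict (@realignment_le V G) y N -> strict (@realignment_le V G) z N ->
    realignment_le y z -> realignment_le (al N y) (al N z)} ->
  stable Q -> stable B ->
  (forall g : Aut_graph G, {in B, forall N, p (realignment_act g N) = realignment_act g (p N)}) ->
  (forall g : Aut_graph G, {in B & Q :\: B, forall N y, strict (@realignment_le V G) y N ->
    al (realignment_act g N) (realignment_act g y) = realignment_act g (al N y)}) ->
  reduces R Q (Q :\: B).
Proof.
move=> BQ pQ pN alP *.
apply: (@conical_removal R _ _ _ (@realignment_act V G) _ (@realignment_le V G)
  _ _ _ _ _ _ _ _ _ p al) => //.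
- exact: realignment_act_inj.
- exact: realignment_complex_actE.
- exact: realignment_le_refl.
- exact: realignment_le_anti.
- exact: realignment_le_trans.
- exact: realignment_act_le.
- exact: order_complexP.
- by move=> N y NB yQ yN; have [] := alP _ _ NB yQ yN.
- by move=> N y NB yQ yN; have [] := alP _ _ NB yQ yN.
- by move=> N y NB yQ yN; have [] := alP _ _ NB yQ yN.
- by move=> N y NB yQ yN; have [] := alP _ _ NB yQ yN.
Qed.

Lemma two_leaf_tree A E x y : is_subtree G A E -> x \in A ->
  nb E x = [set y] -> nb E y = [set x] -> A \subset [set x; y].
Proof.
move=> [_ _ cn _] xA xy yx; apply/subsetP => z zA.
have /connectP[p pP ->] := cn _ _ xA zA.
suff H : forall u, u \in [set x; y] -> path (tree_rel E) u p -> last u p \in [set x; y].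
  by apply: H => //; rewrite set21.
elim: p {pP} => [|v p IH] u //= uxy /andP[uv pv]; apply: IH => //.
have : v \in nb E u by rewrite nbP.
by case/set2P: uxy => ->; rewrite ?xy ?yx !in_set1 => /eqP ->; rewrite ?set21 ?set22.
Qed.

Lemma two_core N u v w : 2 <= #|core (val N)| -> core (val N) \subset [set u; v] ->
  w \notin core (val N) -> u \in posn (val N) w \/ v \in posn (val N) w.
Proof.
move=> h2 /subsetP sub wC; have [vN _] := repP hn h2.
have /set0Pn[z zw] := pos_neq0 vN wC.
by have [_ zC _] := pos_sub vN zw; move: zw; case/set2P: (sub _ zC) => -> h; [left|right].
Qed.

(** Two adjacent leaves make up the whole core. Each outside vertex sits at one of them and by
    removability is adjacent to the other as well, so both are universal and the cell would be
    [special]. This determines which cells have to be exempted from pruning. *)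
Lemma removable_adj N u v : u \in removable (val N) -> v \in removable (val N) ->
  [set u; v] \notin ecore (val N).
Proof.
move=> /removableP[nsp uC u1 hu] /removableP[_ vC v1 hv]; apply/negP => uv.
have vu : v \in pnb (val N) u by rewrite nbP.
have uv' : u \in pnb (val N) v by rewrite nbP setUC.
have pu : pnb (val N) u = [set v].
  by move/eqP/cards1P: u1 vu => [z ->]; rewrite in_set1 => /eqP ->.
have pv : pnb (val N) v = [set u].
  by move/eqP/cards1P: v1 uv' => [z ->]; rewrite in_set1 => /eqP ->.
have uvE : u != v.
  by move: uv; rewrite in_ecore => /andP[/(real_edge (real_is N))/card_edge + _];
    rewrite cards2; case: (u != v).
have h2 : 2 <= #|core (val N)|.
  by apply: leq_trans (subset_leq_card (_ : [set u; v] \subset _));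
    rewrite ?cards2 ?uvE// subUset !sub1set uC.
have [vN _] := repP hn h2.
have sub := two_leaf_tree (valid_tree vN) uC pu pv.
have cE : core (val N) = [set u; v].
  by apply/eqP; rewrite eqEsubset sub subUset !sub1set uC vC.
have adj : G u v by have [_ _] := edge_in_subtree (valid_tree vN) uv.
case/negP: nsp; rewrite /special cE cards2 uvE /= subUset !sub1set.
have U x y : [set x; y] = core (val N) -> G x y -> (forall b, x \in posn (val N) b -> G b y) ->
    y \in universal_vertices G.
  move=> xyC xy hx; apply/universalP => w wy; rewrite adj_sym.
  have [wC|wC] := boolP (w \in core (val N)).
    by move: wC; rewrite -xyC => /set2P[->//|wE]; rewrite wE eqxx in wy.
  have [|xw|yw] := @two_core N x y w h2 _ wC; first by rewrite xyC.
    exact: hx.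
  by have [] := pos_sub vN yw.
apply/andP; split; last by apply: (U u v) => // b ub; exact: hu.
apply: (U v u); rewrite ?cE 1?setUC// 1?adj_sym// => b vb; exact: hv.
Qed.

Lemma repos_ok_sub N (h : V -> {set V} -> {set V}) : 2 <= #|core (val N)| ->
  (forall b, b \notin core (val N) -> h b (posn (val N) b) \subset posn (val N) b /\
    h b (posn (val N) b) != set0) -> repos_ok N h.
Proof.
move=> h2 hh b bC; have [vN _] := repP hn h2.
have vp : valid G (core (val N)) (ecore (val N)) (repos_pos N h).
  apply: (sub_valid vN) => x; rewrite ffunE.
    by case: ifPn => xC; [exact: sub0set|have [] := hh x xC].
  by move=> xC; rewrite (negbTE xC); have [] := hh x xC.
have [_ _ _ pc pG] := vp.
have := pc b bC; rewrite ffunE (negbTE bC) => hc; split => // v vb.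
by apply: pG; rewrite ffunE (negbTE bC).
Qed.

Lemma posover_permute (g : {perm V}) (C : {set V}) (D : realignment_data V) b :
  posover (g @: C) (permute_data g D) (g b) = g @: posover C D b.
Proof.
rewrite !ffunE (mem_gim g); case: (b \in C); first by rewrite imset0.
rewrite (_ : (g b \in tree_vertices _) = (b \in tree_vertices D)); last exact: mem_gim.
rewrite permK; case: ifP => // _; exact: nb_permute.
Qed.

Lemma core_unreached N (h : V -> {set V} -> {set V}) u : 2 <= #|core (val N)| -> repos_ok N h ->
  u \in core (val N) -> #|pnb (val N) u| = 1 ->
  (forall b, b \notin core (val N) -> u \notin h b (posn (val N) b)) ->
  u \notin core (val (repos N h)).
Proof.
move=> h2 ok uC u1 hu; have [vp ->] := reposP hn h2 ok.
rewrite (core_mk vp) in_set uC /= negb_or -ltnNge [#|_|]u1 /=.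
apply/existsPn => b; rewrite ffunE; case: ifPn => bC; first by rewrite in_set0.
exact: hu.
Qed.

Lemma imsetD (g : {perm V}) (X Y : {set V}) : g @: (X :\: Y) = (g @: X) :\: (g @: Y).
Proof.
by apply/setP => x; rewrite -(permKV g x) in_setD !(mem_gim g) in_setD.
Qed.

Lemma removable_imset (g : Aut_graph G) N :
  removable (val (realignment_act g N)) = \val g @: removable (val N).
Proof.
by apply/setP => x; rewrite -(permKV (\val g) x) (mem_gim (\val g)) removable_act.
Qed.

Section Level.
Context (R : realType) (m : nat).
Context (m2 : 2 <= m).

Lemma leq_level c : (c <= m.-1) = (c < m).
Proof. by case: (m) m2. Qed.

(** For [k = #|V|] this is everything, and for [k = 1] exactly the cells without removable leaves,
    since a leaf of a core requires two core vertices. Lowering [k] step by step carries out the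
    pruning. *)
Definition level (k : nat) : {set realignment G} :=
  [set N | (#|core (val N)| <= k) || (removable (val N) == set0)].

Definition top N := (#|core (val N)| == m) && (removable (val N) != set0).

Lemma levelP k N : reflect (#|core (val N)| <= k \/ removable (val N) = set0) (N \in level k).
Proof. by rewrite in_set; apply: (iffP orP) => -[h|/eqP h]; [left|right|left|right]. Qed.

Lemma card_core_act (g : Aut_graph G) N :
  #|core (val (realignment_act g N))| = #|core (val N)|.
Proof. by rewrite core_permute card_imset//; exact: perm_inj. Qed.

Lemma removable0_act (g : Aut_graph G) N :
  (removable (val (realignment_act g N)) == set0) = (removable (val N) == set0).
Proof. by rewrite removable_imset imset_eq0. Qed.

Lemma level_stable k : stable (level k).
Proof. by move=> g N; rewrite !in_set card_core_act removable0_act. Qed.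

Local Opaque level.

Lemma top_act (g : Aut_graph G) N : top (realignment_act g N) = top N.
Proof. by rewrite /top card_core_act removable0_act. Qed.

(** If the core of [M] has more than [m] vertices, then [M] has no removable leaf, so by
    [lost_removable] nothing below it loses a core vertex. A special [M] could, but only down to one
    vertex, and [m] is at least two. *)
Lemma core_of_level N M : realignment_le N M -> M \in level m ->
  #|core (val N)| = m -> core (val N) = core (val M).
Proof.
move=> NM /levelP[le cN|rM cN].
  by apply/eqP; rewrite eqEcard (core_homo hn NM) cN.
apply/eqP; rewrite eqEsubset (core_homo hn NM); apply/negPn/negP => /subsetPn[x xM xN].
have [nsp|sp] := boolP (~~ special (val M)).
  by have [] := lost_removable hn NM xM xN nsp; rewrite rM in_set0.
move: sp; rewrite negbK => /andP[/eqP cM _].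
have : proper (mem (core (val N))) (mem (core (val M))).
  by apply/properP; split; [exact: (core_homo hn)|exists x].
by move/proper_card; rewrite cN cM ltnNge m2.
Qed.

Definition tops N (b : V) := removable (val N).
Definition whole (N : realignment G) (b : V) : {set V} := setT.

Lemma level_target : {in level m, forall N, top N -> forall b u, b \notin core (val N) ->
  posn (val N) b = [set u] -> u \in tops N b ->
  exists2 v, pnb (val N) u :&: whole N b = [set v] & G b v}.
Proof.
move=> N _ _ b u bC pu /removableP[_ _ /eqP/cards1P[v uv] h]; exists v; first by rewrite setIT.
by apply: h; rewrite ?pu ?uv in_set1.
Qed.

Lemma top_core N : top N -> 2 <= #|core (val N)|.
Proof. by case/andP => /eqP ->. Qed.

Lemma top_same N M : realignment_le N M -> core (val N) = core (val M) ->
  [/\ top N = top M, forall b, tops N b = tops M b & forall b, whole N b = whole M b].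
Proof.
move=> NM e; have r := removable_same hn NM e.
by split => //; rewrite /top e r.
Qed.

(** A singleton at a removable leaf would become empty when the leaf is vacated, so it is first
    enlarged to the edge at that leaf. *)
Lemma level_raise : reduces R (level m) [set N in level m | raise top tops whole N == N].
Proof.
apply: (raise_reduces hn).
- by move=> N _; exact: top_core.
- exact: top_same.
- exact: level_target.
- by move=> N M _ MQ NM /andP[/eqP cN _]; exact: core_of_level.
- by move=> N _ _ b u v _ _ _ _; rewrite in_setT.
- move=> N NQ tN; have [_ cE _ _] := raiseP hn (fun N _ => @top_core N) level_target NQ tN.
  by apply/levelP; left; rewrite cE; case/andP: tN => /eqP ->.
- exact: level_stable.
- exact: top_act.
- by move=> g N b u; exact: removable_act.
- by move=> g N b u; rewrite !in_setT.
Qed.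

Definition lifted : {set realignment G} := [set N in level m | raise top tops whole N == N].
Definition lifted_top : {set realignment G} := [set N in lifted | top N].
Local Notation Q := lifted.
Local Notation B := lifted_top.

Lemma in_lifted N : (N \in Q) = (N \in level m) && (raise top tops whole N == N).
Proof. by rewrite in_set. Qed.

Lemma in_lifted_top N : (N \in B) = (N \in Q) && top N.
Proof. by rewrite in_set. Qed.

(* The data of the conical removal: all positions of [N] are pushed off the
   removable leaves, so that the core of [low N] is smaller, and [join N y] is
   the upper bound of [y] and [low N] obtained by uniting positions. *)
Definition lowh N (b : V) (X : {set V}) := X :\: removable (val N).
Definition joinh N (y : realignment G) b (X : {set V}) :=
  posover (core (val N)) (val y) b :|: (X :\: removable (val N)).
Definition low N := repos N (lowh N).
Definition join N (y : realignment G) := repos N (joinh N y).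

Local Opaque lifted lifted_top.

Lemma in_level_pred N : (N \in level m.-1) = (N \in level m) && ~~ top N.
Proof.
apply/levelP/andP => [h|[/levelP h]].
  split; first by apply/levelP; case: h => h; [left; exact: leq_trans h (leq_pred _)|right].
  apply/negP => /andP[/eqP cN r]; case: h => [|h]; last by rewrite h eqxx in r.
  by rewrite leq_level cN ltnn.
rewrite negb_and negbK => /orP[cN|/eqP r]; last by right.
by case: h => h; [left; rewrite leq_level ltn_neqAle cN h|right].
Qed.

Lemma level_diff : Q :\: B = level m.-1.
Proof.
apply/setP => N; rewrite in_setD in_lifted_top in_lifted in_level_pred negb_and.
case tN : (top N); first by case: (_ \in _); case: (_ == _).
by rewrite raise_inactive ?tN// eqxx; case: (_ \in _).
Qed.

(** After the raising there are no singletons at removable leaves, and by [removable_adj] no core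
    edge has two removable ends. *)
Lemma low_ok N : N \in B -> forall b, b \notin core (val N) ->
  posn (val N) b :\: removable (val N) != set0.
Proof.
rewrite in_lifted_top => /andP[NQ tN] b bC; have h2 := top_core tN; have [vN _] := repP hn h2.
move: NQ; rewrite in_lifted => /andP[NQ /eqP fN].
apply/negP; rewrite setD_eq0 => /subsetP sub.
have [/eqP/cards1P[u pu]|[p2 pE]] := card_pos vN bC.
  have := raise_fix hn (fun N _ => @top_core N) level_target NQ tN fN bC pu.
  by rewrite /tops sub// pu in_set1.
have [u [v [pe uv]]] := edgeE (proj1 (valid_edge vN pE)).
have uR : u \in removable (val N) by apply: sub; rewrite pe set21.
have vR : v \in removable (val N) by apply: sub; rewrite pe set22.
by have := removable_adj uR vR; rewrite -pe pE.
Qed.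

Lemma low_sub N : N \in B -> forall b, b \notin core (val N) ->
  posn (val N) b :\: removable (val N) \subset posn (val N) b /\
  posn (val N) b :\: removable (val N) != set0.
Proof. by move=> NB b bC; split; [exact: subsetDl|exact: low_ok]. Qed.

Lemma B_top N : N \in B -> top N.
Proof. by rewrite in_lifted_top => /andP[]. Qed.

(** If all core vertices of [N] survived in [y], then [y] would have the same removable leaves and
    would be one of the cells to be removed. So some removable leaf [u] is already vacated in [y];
    it stays vacated in [join N y], which is why the join lies strictly below [N]. *)
Lemma below_B N y : N \in B -> y \in Q :\: B ->
  strict (@realignment_le V G) y N ->
  [/\ valid G (core (val N)) (ecore (val N)) (posover (core (val N)) (val y)),
      forall b, posover (core (val N)) (val y) b \subset posn (val N) b,
      val y = mk (core (val N)) (ecore (val N)) (posover (core (val N)) (val y))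
    & exists2 u, u \in removable (val N) & forall b, u \notin posover (core (val N)) (val y) b].
Proof.
rewrite level_diff => NB yQ /andP[yN leyN].
have tN := B_top NB; case: (lowerP hn leyN) => [e|[h2 vp sp yE]]; first by rewrite e eqxx in yN.
split => //.
have nsp : ~~ special (val N).
  by case/andP: tN => _ /set0Pn[u /removableP[]].
have [/subsetPn[x xN xy]|] := boolP (~~ (core (val N) \subset core (val y))).
  have [xr xb] := lost_removable hn leyN xN xy nsp; exists x => // b.
  by apply: contra xb => xb; apply/bigcupP; exists b.
rewrite negbK => sub; exfalso.
have e : core (val y) = core (val N).
  by apply/eqP; rewrite eqEsubset sub (core_homo hn).
have r := removable_same hn leyN e; move: yQ tN => /levelP[|h /andP[_]]; last by rewrite -r h eqxx.
rewrite e => h /andP[/eqP cN _]; move: h m2; rewrite cN.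
by case: (m) => // k; rewrite ltnn.
Qed.

Lemma join_sub N y : N \in B -> y \in Q :\: B -> strict (@realignment_le V G) y N ->
  forall b, b \notin core (val N) ->
  posover (core (val N)) (val y) b :|: (posn (val N) b :\: removable (val N)) \subset posn (val N) b /\
  posover (core (val N)) (val y) b :|: (posn (val N) b :\: removable (val N)) != set0.
Proof.
move=> NB yQ yN b bC; have [_ sp _ _] := below_B NB yQ yN.
have [lo l0] := low_sub NB bC; split; first by rewrite subUset sp lo.
by rewrite setU_eq0 negb_and l0 orbT.
Qed.

Lemma lowP N : N \in B -> repos_ok N (lowh N).
Proof. by move=> NB; apply: repos_ok_sub (low_sub NB); exact: top_core (B_top NB). Qed.

Lemma joinP N y : N \in B -> y \in Q :\: B -> strict (@realignment_le V G) y N ->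
  repos_ok N (joinh N y).
Proof.
move=> NB yQ yN; apply: repos_ok_sub; first exact: top_core (B_top NB).
exact: join_sub.
Qed.

Lemma lifted_stable : stable Q.
Proof.
move=> g N; rewrite (in_lifted N) (in_lifted (realignment_act g N)).
rewrite (level_stable m g N).
have H : N \in level m -> (raise top tops whole (realignment_act g N) == realignment_act g N)
    = (raise top tops whole N == N).
  move=> NQ; rewrite (@raise_equivariant _ _ hn (level m) top tops whole (fun N _ => @top_core N)
    level_target top_act _ _ g N NQ).
  - exact: (inj_eq (@realignment_act_inj V G g)).
  - by move=> h M b u; exact: removable_act.
  - by move=> h M b u; rewrite !in_setT.
have [NQ|NQ] := boolP (N \in level m); first by rewrite (H NQ).
exact: (erefl false).
Qed.

(** The conical data at [N] are [p = low] and [al = join]. Both vacate some removable leaf of [N],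
    so their cores have fewer than [m] vertices and they lie in [level m.-1]. *)
Lemma level_step : reduces R Q (level m.-1).
Proof.
rewrite -level_diff; apply: (@reduces_conical R Q B low join).
- by apply/subsetP => N; rewrite in_lifted_top => /andP[].
- move=> N NB; rewrite level_diff; apply/levelP; left.
  have h2 := top_core (B_top NB); have ok := lowP NB.
  have /andP[/eqP cN /set0Pn[u ur]] := B_top NB; have /removableP[_ uC u1 _] := ur.
  rewrite leq_level -cN; apply: proper_card.
  apply/properP; split.
    apply: (core_homo hn); apply: (repos_lower hn) => // b bC; exact: subsetDl.
  exists u => //; apply: core_unreached => // b _.
  by rewrite in_setD ur.
- move=> N NB; have h2 := top_core (B_top NB); have ok := lowP NB.
  have le : realignment_le (low N) N.
    by apply: (repos_lower hn) => // b bC; exact: subsetDl.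
  rewrite /strict le andbT; apply/negP => /eqP e.
  have /andP[_ /set0Pn[u ur]] := B_top NB; have /removableP[_ uC u1 _] := ur.
  have : u \notin core (val (low N)).
    by apply: core_unreached => // b _; rewrite in_setD ur.
  by rewrite e uC.
- move=> N y NB yQ yN; have h2 := top_core (B_top NB).
  have ok := joinP NB yQ yN.
  have okl := lowP NB.
  have [vp sp yE [u ur ub]] := below_B NB yQ yN.
  have le : realignment_le (join N y) N.
    by apply: (repos_lower hn) => // b bC; have [] := join_sub NB yQ yN bC.
  have uj : u \notin core (val (join N y)).
    have /removableP[_ uC u1 _] := ur; apply: core_unreached => // b _.
    by rewrite in_setU (negbTE (ub b)) in_setD ur.
  have uC : u \in core (val N) by have /removableP[] := ur.
  have [vj jE] := reposP hn h2 ok; have [vl lE] := reposP hn h2 okl.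
  split.
  + rewrite level_diff; apply/levelP; left.
    have /andP[/eqP cN _] := B_top NB.
    rewrite leq_level -cN; apply: proper_card.
    by apply/properP; split; [exact: (core_homo hn)|exists u].
  + by rewrite /strict le andbT; apply/negP => /eqP e; rewrite e uC in uj.
  + apply: (le_mk jE yE vj vp) => b; rewrite [repos_pos _ _ b]ffunE.
    case: ifPn => bC; last exact: subsetUl.
    by have [_ _ -> //] := vp.
  + apply: (le_mk jE lE vj vl) => b.
    rewrite [repos_pos N (lowh N) b]ffunE [repos_pos N (joinh N y) b]ffunE.
    by case: ifPn => bC //; exact: subsetUr.
- move=> N y z NB yQ zQ yN zN yz; have h2 := top_core (B_top NB).
  have [vy jyE] := reposP hn h2 (joinP NB yQ yN).
  have [vz jzE] := reposP hn h2 (joinP NB zQ zN).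
  have [vpz _ zE _] := below_B NB zQ zN.
  have [pos' [vp' sub' yE]] := lower_mk zE vpz yz.
  have yP : posover (core (val N)) (val y) = pos' by rewrite yE (posover_mk vp').
  apply: (le_mk jzE jyE vz vy) => b.
  rewrite [repos_pos N (joinh N y) b]ffunE [repos_pos N (joinh N z) b]ffunE.
  case: ifPn => bC; first exact: sub0set.
  by rewrite /joinh setSU// yP.
- exact: lifted_stable.
- by move=> g N; rewrite !in_lifted_top lifted_stable top_act.
- move=> g N NB; apply: (repos_act hn (top_core (B_top NB)) (lowP NB)) => b _.
  by rewrite /lowh removable_imset imsetD.
- move=> g N y NB yQ yN.
  apply: (repos_act hn (top_core (B_top NB)) (joinP NB yQ yN)) => b _.
  by rewrite /joinh removable_imset -imsetD core_permute posover_permute imsetU.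
Qed.

Lemma level_reduces : reduces R (level m) (level m.-1).
Proof. exact: retracts_trans level_raise level_step. Qed.

End Level.

Lemma removable_small N : #|core (val N)| <= 1 -> removable (val N) = set0.
Proof.
move=> c1; apply/setP => u; rewrite in_set0; apply/negbTE/negP.
move=> /removableP[_ uC /eqP/cards1P[v uv] _].
have vu : v \in pnb (val N) u by rewrite uv in_set1.
have [uC' vC] := pnb_core vu.
move: vu; rewrite nbP in_ecore => /andP[/(real_edge (real_is N))/card_edge e _].
have : #|[set u; v]| <= #|core (val N)|.
  by apply: subset_leq_card; rewrite subUset !sub1set uC' vC.
by rewrite e => /leq_trans/(_ c1).
Qed.

Lemma removable0_reduces (R : realType) :
  @reduces V G R setT [set N | removable (val N) == set0].
Proof.
have H k : k < #|V| -> reduces R setT (level (#|V| - k)).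
  elim: k => [_|k IH kV].
    rewrite (_ : level _ = setT); first exact: retracts_refl.
    by apply/setP => N; rewrite in_setT; apply/levelP; left; rewrite subn0 max_card.
  rewrite subnS; apply: retracts_trans (IH (ltnW kV)) _; apply: level_reduces.
  by rewrite ltn_subRL addn1.
rewrite (_ : [set N | _] = level (#|V| - #|V|.-1)).
  by apply: H; rewrite prednK// (ltn_trans _ hn).
apply/setP => N; rewrite in_set.
have -> : #|V| - #|V|.-1 = 1 by case: #|V| hn => // k _; rewrite subSnn.
by apply/eqP/levelP => [h|[/removable_small|]//]; right.
Qed.

End PruningCores.

(** * Pruning of forests; filling the double stars; frozen cells *)

Section Filling.
Import boot.finset boot.fintype.
Local Open Scope nat_scope.
Local Open Scope set_scope.
Context (V : finType) (G : simple_graph V) (hn : 3 <= #|V|).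
Local Opaque core raise repos.
Local Notation removable := (removable G).
Local Notation special := (special G).
Implicit Types (N K M : realignment G).

Section Forest.
Context (E : {set {set V}}).
Context (E_edges : E \subset edges G).
Context (E_acyclic : forall c, ucycle (tree_rel E) c -> size c <= 2).

Lemma nb_irr x : x \notin nb E x.
Proof.
rewrite nbP; apply/negP => /(subsetP E_edges)/card_edge.
by rewrite setUid cards1.
Qed.

(** Otherwise a path in [X] could always be prolonged at its front by a neighbour other than the
    next vertex: meeting the path again would close a cycle, so there would be simple paths of every
    length. *)
Lemma forest_leaf (X : {set V}) : {in X, forall x, 2 <= #|nb E x :&: X|} -> X = set0.
Proof.
move=> X2; apply/eqP/negPn/negP => /set0Pn[x0 x0X].
have H n : exists x p, [/\ size p = n, path (tree_rel E) x p, uniq (x :: p) & x \in X].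
  elim: n => [|n [x [p [sp pp up xX]]]]; first by exists x0, [::].
  (* For the one-vertex path the excluded vertex is the default [x], which is not its own
     neighbour. *)
  have [z /andP[zx zX] zp] : exists2 z, (z \in nb E x) && (z \in X) & z != head x p.
    have := X2 _ xX; rewrite (cardsD1 (head x p)) => h.
    have /card_gt0P[z] : 0 < #|(nb E x :&: X) :\ head x p|.
      by case: (_ \in _) h => //=; rewrite add0n; exact: ltn_trans.
    by rewrite in_setD1 in_setI => /andP[? ?]; exists z.
  have zx' : tree_rel E z x by rewrite tree_rel_sym /tree_rel /= -nbP.
  have zNx : z != x by apply: contraTneq zx => ->; exact: nb_irr.
  have [zin|zin] := boolP (z \in p); last first.
    exists z, (x :: p); split => //=; first by rewrite sp.
      by rewrite zx' pp.
    by rewrite in_cons negb_or zNx zin.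
  case/splitPr: zin sp pp up zp => p1 p2 _; rewrite cat_path /= => /and3P[pp1 lz _].
  rewrite mem_cat negb_or -cat_rcons cat_uniq => /andP[/andP[xp1 _] /andP[up1 _]] zh.
  have : ucycle (tree_rel E) (x :: rcons p1 z).
    apply/andP; split; first by rewrite /= rcons_path last_rcons zx' rcons_path pp1 lz.
    by rewrite /= mem_rcons in_cons negb_or eq_sym zNx xp1.
  move/E_acyclic; rewrite /= size_rcons !ltnS leqn0 => /nilP p10.
  by move: zh; rewrite p10 /= eqxx.
have [x [p [sp _ up _]]] := H #|V|.
by have := max_card (mem (x :: p)); rewrite (card_uniqP up) /= sp ltnn.
Qed.

Definition nbw (W : {set V}) x := nb E x :&: W.

(** A leaf whose neighbour is a leaf as well is kept: removing both would destroy an isolated edge,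
    and choosing one of them would not be equivariant. *)
Definition prunable (W : {set V}) : {set V} :=
  [set x in W | (#|nbw W x| == 1) && [exists y, (y \in nbw W x) && (2 <= #|nbw W y|)]].

Definition prune (W : {set V}) := W :\: prunable W.

(** When nothing is prunable, a vertex of degree at least two has no leaf among its neighbours. The
    vertices of degree at least two then have two neighbours among themselves, so [forest_leaf]
    shows that there are none, and only isolated vertices and edges remain. *)
Lemma prune_stable (W : {set V}) u v : prune W = W -> u \in W -> v \in nbw W u ->
  #|nbw W u| = 1.
Proof.
move=> pW uW vu; apply/eqP; rewrite eqn_leq andbC; apply/andP; split.
  by apply/card_gt0P; exists v.
rewrite leqNgt; apply/negP => u2.
pose X := [set x in W | 2 <= #|nbw W x|].
suff X0 : X = set0 by have : u \in X; [rewrite in_set uW|rewrite X0 in_set0].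
apply: forest_leaf => x; rewrite in_set => /andP[xW x2].
rewrite (_ : nb E x :&: X = nbw W x)//; apply/setP => y.
rewrite in_setI [y \in X]in_set in_setI; apply/and3P/andP => [[yx yW _]|[yx yW]] //.
split => //; rewrite ltnNge; apply/negP => y1.
have yp : y \in prunable W.
  have xy : x \in nbw W y by rewrite in_setI nb_sym yx.
  rewrite in_set yW eqn_leq y1 /=; apply/andP; split.
    by apply/card_gt0P; exists x.
  by apply/existsP; exists x; rewrite xy x2.
by move/setP: pW => /(_ y); rewrite in_setD yp yW.
Qed.

(** Every step that is not yet stationary loses a vertex, so [#|V|] steps suffice. *)
Lemma iter_prune_stable (W : {set V}) : prune (iter #|V| prune W) = iter #|V| prune W.
Proof.
have H i : prune (iter i prune W) = iter i prune W \/ #|iter i prune W| + i <= #|V|.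
  elim: i => [|i [IH|IH]]; first by right; rewrite addn0 max_card.
    by left; rewrite iterS IH.
  set Wi := iter i prune W in IH *.
  have [e|ne] := eqVneq (prune Wi) Wi; first by left; rewrite iterS -/Wi e.
  right; rewrite iterS -/Wi addnS; apply: leq_trans IH; rewrite ltn_add2r.
  by apply: proper_card; rewrite properEneq ne subsetDl.
have [//|h] := H #|V|.
have /eqP -> : iter #|V| prune W == set0.
  by rewrite -cards_eq0 -leqn0 -(leq_add2r #|V|) add0n.
by rewrite /prune set0D.
Qed.

End Forest.

Lemma special_core_edge N : special (val N) -> core (val N) \in ecore (val N).
Proof.
move=> /andP[/eqP c2 _]; have h2 : 2 <= #|core (val N)| by rewrite c2.
have [vN _] := repP hn h2.
have /card_gt0P[u uC] : 0 < #|core (val N)| by rewrite c2.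
have /card_gt0P[v vu] := pnb_gt0 hn h2 uC.
have [_ vC] := pnb_core vu.
move: (vu); rewrite nbP => uv; rewrite (_ : core _ = [set u; v])//.
apply/eqP; rewrite eq_sym eqEcard subUset !sub1set uC vC c2.
by rewrite (card_edge (proj1 (valid_edge vN uv))).
Qed.

Definition fillh N (b : V) (X : {set V}) := core (val N).
(** Over a core of two universal vertices any outside vertex may be placed on the core edge. This
    gives the greatest cell with that core, the full double star. *)
Definition fill N := if special (val N) then repos N (fillh N) else N.

Lemma special_card N : special (val N) -> 2 <= #|core (val N)|.
Proof. by case/andP => /eqP ->. Qed.

Lemma fill_ok N : special (val N) -> repos_ok N (fillh N).
Proof.
move=> sN b bC; split; first by left; exact: special_core_edge.
move=> v vC; have /andP[_ /subsetP/(_ _ vC)/universalP] := sN.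
by rewrite adj_sym; apply; apply: contraNneq bC => ->.
Qed.

Lemma fillP N : special (val N) ->
  [/\ realignment_le N (fill N), core (val (fill N)) = core (val N),
      ecore (val (fill N)) = ecore (val N)
    & posn (val (fill N)) = repos_pos N (fillh N)].
Proof.
move=> sN; rewrite /fill sN; apply: (repos_upper hn (special_card sN) (fill_ok sN)).
move=> b bC; have [vN _] := repP hn (special_card sN).
by apply/subsetP => v /(pos_sub vN)[].
Qed.

Lemma fill_inactive N : ~~ special (val N) -> fill N = N.
Proof. by rewrite /fill => /negbTE ->. Qed.

(** Without removable leaves no core vertex can be lost below [M], by [lost_removable]; a special
    [M] has two core vertices and could only drop to a single one. *)
Lemma special_le_core N M : realignment_le N M -> removable (val M) = set0 ->
  2 <= #|core (val N)| -> core (val N) = core (val M).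
Proof.
move=> NM rM N2; apply/eqP; rewrite eqEsubset (core_homo hn NM).
apply/negPn/negP => /subsetPn[x xM xN].
have [nsp|/negPn sp] := boolP (~~ special (val M)).
  by have [] := lost_removable hn NM xM xN nsp; rewrite rM in_set0.
have : proper (mem (core (val N))) (mem (core (val M))).
  by apply/properP; split; [exact: (core_homo hn)|exists x].
by move/proper_card; case/andP: sp => /eqP -> _; rewrite ltnNge N2.
Qed.

Definition flat : {set realignment G} := [set N | removable (val N) == set0].
Definition filled : {set realignment G} := [set N in flat | fill N == N].

Lemma in_flat N : reflect (removable (val N) = set0) (N \in flat).
Proof. by rewrite in_set; exact: eqP. Qed.


Lemma flat_reduces (R : realType) : @reduces V G R setT flat.
Proof. exact: removable0_reduces. Qed.

Local Opaque flat fill.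

Lemma flat_stable : stable flat.
Proof.
move=> g N; apply/in_flat/in_flat; rewrite removable_imset => /eqP;
  by rewrite ?imset_eq0 => /eqP // ->; rewrite imset0.
Qed.

Lemma fill_act (g : Aut_graph G) N : fill (realignment_act g N) = realignment_act g (fill N).
Proof.
have [sN|sN] := boolP (special (val N)); last by rewrite !fill_inactive ?special_act.
have sg : special (val (realignment_act g N)) by rewrite special_act.
Local Transparent fill.
rewrite /fill sN sg; apply: (repos_act hn (special_card sN) (fill_ok sN)) => b _.
by rewrite /fillh core_permute.
Qed.
Local Opaque fill.

Lemma fill_special N : special (val N) -> special (val (fill N)).
Proof. by move=> sN; have [_ cE _ _] := fillP sN; rewrite (special_same cE). Qed.

Lemma fill_same N M : special (val N) -> core (val N) = core (val M) ->
  ecore (val N) = ecore (val M) -> fill N = fill M.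
Proof.
move=> sN cE eE; have sM : special (val M) by rewrite -(special_same cE).
have [_ cN eN pN] := fillP sN; have [_ cM eM pM] := fillP sM.
apply: (same_core_eq hn); rewrite ?cN ?cM ?eN ?eM//; last exact: special_card.
by rewrite pN pM; apply/ffunP => b; rewrite [LHS]ffunE [RHS]ffunE /fillh cE.
Qed.

Lemma filled_reduces (R : realType) : reduces R flat filled.
Proof.
have flatF N : special (val N) -> N \in flat by move=> sN; apply/in_flat; exact: special_removable.
apply: reduces_closure.
- move=> N NQ; have [sN|sN] := boolP (special (val N)); last by rewrite fill_inactive.
  exact/flatF/fill_special.
- move=> N NQ; have [sN|sN] := boolP (special (val N)); first by have [] := fillP sN.
  by rewrite fill_inactive// realignment_le_refl.
- move=> N NQ; have [sN|sN] := boolP (special (val N)); last by rewrite !fill_inactive.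
  by have [_ cN eN _] := fillP sN; apply: fill_same => //; exact: fill_special.
- move=> N M NQ MQ NM; have [sN|sN] := boolP (special (val N)); last first.
    rewrite (fill_inactive sN); have [sM|sM] := boolP (special (val M)).
      by have [le _ _ _] := fillP sM; exact: realignment_le_trans NM le.
    by rewrite fill_inactive.
  have rM : removable (val M) = set0 by exact/in_flat.
  have cE := special_le_core NM rM (special_card sN).
  have [eE _] := le_same_core hn NM cE.
  by rewrite (fill_same sN cE eE) realignment_le_refl.
- exact: flat_stable.
- by move=> g N _; exact: fill_act.
Qed.

Definition frozen N := (2 <= #|core (val N)|) && ~~ special (val N).

Lemma in_filled N : (N \in filled) = (N \in flat) && (fill N == N).
Proof. by rewrite in_set. Qed.

Lemma filled_flat N : N \in filled -> removable (val N) = set0.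
Proof. by rewrite in_filled => /andP[/in_flat]. Qed.

Lemma frozen_filled N : frozen N -> removable (val N) = set0 -> N \in filled.
Proof.
move=> /andP[_ nsp] r; rewrite in_filled fill_inactive// eqxx andbT.
exact/in_flat.
Qed.

Lemma frozen_same N M : core (val N) = core (val M) -> frozen N = frozen M.
Proof. by move=> e; rewrite /frozen (special_same e) e. Qed.

Lemma frozen_core N M : realignment_le N M -> removable (val M) = set0 ->
  frozen N || frozen M -> core (val N) = core (val M).
Proof.
move=> NM rM /orP[/andP[N2 _]|/andP[M2 nsp]]; first exact: special_le_core.
apply/eqP; rewrite eqEsubset (core_homo hn NM).
apply/negPn/negP => /subsetPn[x xM xN].
by have [] := lost_removable hn NM xM xN nsp; rewrite rM in_set0.
Qed.

Lemma frozen_act (g : Aut_graph G) N : frozen (realignment_act g N) = frozen N.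
Proof. by rewrite /frozen special_act card_core_act. Qed.

Lemma filled_stable : stable filled.
Proof.
move=> g N; rewrite (in_filled N) (in_filled (realignment_act g N)) fill_act flat_stable.
congr (_ && _); exact: (inj_eq (@realignment_act_inj V G g)).
Qed.

End Filling.

(** * Pruning the positions *)

Section PruningPositions.
Import boot.finset boot.fintype.
Local Open Scope nat_scope.
Local Open Scope set_scope.
Context (V : finType) (G : simple_graph V) (hn : 3 <= #|V|).
Local Opaque core raise repos fill flat filled posn ecore.
Local Notation removable := (removable G).
Implicit Types (N K M : realignment G).
Local Notation frozen := (@frozen V G).
Local Notation filled := (@filled V G).

(* For a frozen core, the possible positions of [b] range over the forest
   induced by the core neighbours of [b]; the forests are pruned step by step. *)
Definition place N b i : {set V} :=
  iter i (prune (ecore (val N))) (core (val N) :&: [set w | G b w]).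

Lemma placeS N b i : place N b i.+1 = prune (ecore (val N)) (place N b i).
Proof. by []. Qed.

Lemma place_pred N b i : place N b i.+1 \subset place N b i.
Proof. by rewrite placeS subsetDl. Qed.

Lemma place_adj N b i w : w \in place N b i -> w \in core (val N) /\ G b w.
Proof.
elim: i => [|i IH]; first by rewrite in_setI [w \in [set _ | _]]in_set => /andP.
by move/(subsetP (place_pred N b i)); exact: IH.
Qed.

Lemma place_same N M b i : core (val N) = core (val M) ->
  ecore (val N) = ecore (val M) -> place N b i = place M b i.
Proof. by rewrite /place => -> ->. Qed.

Lemma place_act (g : Aut_graph G) N b i :
  place (realignment_act g N) (\val g b) i = \val g @: place N b i.
Proof.
have nE (X : {set V}) x : nbw (ecore (val (realignment_act g N))) (\val g @: X) (\val g x)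
    = \val g @: nbw (ecore (val N)) X x.
  by rewrite /nbw ecore_permute nb_permute -imsetI//; move=> ? ? _ _; exact: perm_inj.
elim: i => [|i IH].
  apply/setP => w; rewrite -(permKV (\val g) w) (mem_gim (\val g)) !in_setI.
  by rewrite core_permute (mem_gim (\val g)) !in_set aut_permP.
rewrite !placeS IH /prune imsetD; congr (_ :\: _).
apply/setP => w; rewrite -(permKV (\val g) w); set x := ((\val g)^-1%g w).
rewrite (mem_gim (\val g)) [LHS]in_set [RHS]in_set (mem_gim (\val g)) nE.
rewrite card_imset; last exact: perm_inj.
congr [&& _, _ & _]; apply/existsP/existsP => -[y /andP[yx y2]].
  exists ((\val g)^-1%g y); move: yx y2; rewrite -{1 2}(permKV (\val g) y) nE.
  by rewrite (mem_gim (\val g)) card_imset; [move=> -> ->|exact: perm_inj].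
exists (\val g y); rewrite nE (mem_gim (\val g)) card_imset; last exact: perm_inj.
by rewrite yx.
Qed.

Lemma frozen_card N : frozen N -> 2 <= #|core (val N)|.
Proof. by case/andP. Qed.

Lemma ecore_forest N : 2 <= #|core (val N)| ->
  ecore (val N) \subset edges G /\
  (forall c, ucycle (tree_rel (ecore (val N))) c -> size c <= 2).
Proof. by move=> h2; have [vN _] := repP hn h2; case: (valid_tree vN). Qed.

Definition zone i : {set realignment G} :=
  [set N in filled | frozen N ==>
    [forall b, (b \notin core (val N)) ==> (posn (val N) b \subset place N b i)]].

Lemma zoneP i N : reflect (N \in filled /\ (frozen N ->
    forall b, b \notin core (val N) -> posn (val N) b \subset place N b i))
  (N \in zone i).
Proof.
rewrite [X in reflect _ X]in_set; apply: (iffP andP) => -[NF h]; split => //.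
  by move=> fN b bC; have /forallP/(_ b)/implyP := implyP h fN; exact.
apply/implyP => fN; apply/forallP => b; apply/implyP; exact: h.
Qed.

Local Opaque zone.

Lemma zone_flat i N : N \in zone i -> removable (val N) = set0.
Proof. by case/zoneP => /filled_flat. Qed.

Lemma zone_stable i : stable (zone i).
Proof.
move=> g N; apply/zoneP/zoneP => -[NF h].
  rewrite (filled_stable hn) in NF; split => // fN b bC.
  have := h _ (\val g b); rewrite frozen_act core_permute (mem_gim (\val g)) => /(_ fN bC).
  by rewrite posn_permute place_act permute_sub.
rewrite (filled_stable hn); split => //; rewrite frozen_act => fN b.
rewrite -(permKV (\val g) b); set c := ((\val g)^-1%g b).
rewrite core_permute (mem_gim (\val g)) => cC.
by rewrite posn_permute place_act permute_sub; exact: h.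
Qed.

Section ZoneRaise.
Context (R : realType) (i : nat) (Z : realignment G -> V -> {set V}).
Context (Z_place : forall N b u, frozen N -> u \in Z N b ->
  u \in place N b i /\ #|nbw (ecore (val N)) (place N b i) u| = 1).
Context (Z_same : forall N M b, core (val N) = core (val M) ->
  ecore (val N) = ecore (val M) -> Z N b = Z M b).
Context (Z_act : forall (g : Aut_graph G) N b u,
  (\val g u \in Z (realignment_act g N) (\val g b)) = (u \in Z N b)).

Local Notation zraise := (raise frozen Z (fun N b => place N b i)).

(** The set [Z] is kept abstract because it is the fringe in a pruning step and the set of all
    leaves at the end; only degree one inside the forest is used. *)
Lemma zone_target : {in zone i, forall N, frozen N -> forall b u, b \notin core (val N) ->
  posn (val N) b = [set u] -> u \in Z N b ->
  exists2 v, pnb (val N) u :&: place N b i = [set v] & G b v}.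
Proof.
move=> N _ fN b u bC pu uZ; have [_ /eqP/cards1P[v uv]] := Z_place fN uZ.
exists v; first exact: uv.
have : v \in nbw (ecore (val N)) (place N b i) u by rewrite uv in_set1.
by rewrite in_setI => /andP[_ /place_adj[]].
Qed.

Lemma zone_core : {in zone i, forall N, frozen N -> 2 <= #|core (val N)|}.
Proof. by move=> N _; exact: frozen_card. Qed.

Lemma zraise_place N b : N \in zone i -> frozen N -> b \notin core (val N) ->
  raiseh Z (fun N b => place N b i) N b (posn (val N) b) \subset place N b i.
Proof.
move=> NQ fN bC; have [_ sub] := zoneP _ _ NQ.
have [[u [v [pu uZ uv Gv ->]]]|[_ ->]] := raisehP zone_target NQ fN bC; last exact: sub.
rewrite subUset !sub1set (proj1 (Z_place fN uZ)) /=.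
have : v \in pnb (val N) u :&: place N b i by rewrite uv in_set1.
by rewrite in_setI => /andP[].
Qed.

Lemma zraise_zone : {in zone i, forall N, frozen N -> zraise N \in zone i}.
Proof.
move=> N NQ fN; have [le cE eE pE] := raiseP hn zone_core zone_target NQ fN.
have fr : frozen (zraise N) by rewrite (frozen_same cE).
apply/zoneP; split.
  apply: (frozen_filled fr).
  by rewrite -(removable_same hn le (esym cE)) (zone_flat NQ).
move=> _ b; rewrite cE => bC; rewrite pE [repos_pos _ _ b]ffunE (negbTE bC).
by rewrite (place_same _ _ cE eE) zraise_place.
Qed.

Lemma zraise_act (g : Aut_graph G) N b u :
  (\val g u \in place (realignment_act g N) (\val g b) i) = (u \in place N b i).
Proof. by rewrite place_act (mem_gim (\val g)). Qed.

Lemma zraise_same N M : realignment_le N M -> core (val N) = core (val M) ->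
  [/\ frozen N = frozen M, forall b, Z N b = Z M b & forall b, place N b i = place M b i].
Proof.
move=> NM cE; have [eE _] := le_same_core hn NM cE.
by split; [exact: frozen_same|move=> b; exact: Z_same|move=> b; exact: place_same].
Qed.

Lemma zraise_reduces : reduces R (zone i) [set N in zone i | zraise N == N].
Proof.
apply: (raise_reduces hn).
- exact: zone_core.
- exact: zraise_same.
- exact: zone_target.
- move=> N M _ MQ NM fN; apply: (frozen_core hn NM (zone_flat MQ)).
  by rewrite fN.
- move=> N NQ fN b u v uZ ub vb _; have [_ sub] := zoneP _ _ NQ.
  have [vN _] := repP hn (frozen_card fN).
  by have [bC _ _] := pos_sub vN vb; exact: (subsetP (sub fN b bC)).
- exact: zraise_zone.
- exact: zone_stable.
- exact: frozen_act.
- exact: Z_act.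
- exact: zraise_act.
Qed.

Lemma zraise_stable : stable [set N in zone i | zraise N == N].
Proof.
move=> g N; rewrite [LHS]in_set [RHS]in_set (zone_stable i g N).
have H : N \in zone i -> (zraise (realignment_act g N) == realignment_act g N) = (zraise N == N).
  move=> NQ; rewrite (@raise_equivariant _ _ hn (zone i) frozen Z _ zone_core zone_target
    (@frozen_act V G) Z_act zraise_act g N NQ).
  exact: (inj_eq (@realignment_act_inj V G g)).
have [NQ|NQ] := boolP (N \in zone i); first by rewrite (H NQ).
exact: (erefl false).
Qed.

End ZoneRaise.

Section ZoneStep.
Context (R : realType) (i : nat).

Definition fringe N b := prunable (ecore (val N)) (place N b i).

Local Notation zraise := (raise frozen fringe (fun N b => place N b i)).

Lemma fringe_place N b u : frozen N -> u \in fringe N b ->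
  u \in place N b i /\ #|nbw (ecore (val N)) (place N b i) u| = 1.
Proof. by move=> _; rewrite in_set => /and3P[? /eqP]. Qed.

Lemma fringe_same N M b : core (val N) = core (val M) ->
  ecore (val N) = ecore (val M) -> fringe N b = fringe M b.
Proof. by move=> cE eE; rewrite /fringe (place_same _ _ cE eE) eE. Qed.

Lemma fringeE N b : fringe N b = place N b i :\: place N b i.+1.
Proof.
rewrite placeS /prune setDDr setDv set0U; apply/esym/setIidPr.
by apply/subsetP => u; rewrite in_set => /andP[].
Qed.

Lemma fringe_act (g : Aut_graph G) N b u :
  (\val g u \in fringe (realignment_act g N) (\val g b)) = (u \in fringe N b).
Proof. by rewrite !fringeE !place_act -imsetD (mem_gim (\val g)). Qed.

Definition raised : {set realignment G} := [set N in zone i | zraise N == N].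

Lemma in_raised N : (N \in raised) = (N \in zone i) && (zraise N == N).
Proof. by rewrite in_set. Qed.

Lemma raised_zone N : N \in raised -> N \in zone i.
Proof. by rewrite in_raised => /andP[]. Qed.

Lemma raised_fix N : N \in raised -> zraise N = N.
Proof. by rewrite in_raised => /andP[_ /eqP]. Qed.

Local Opaque raised.

Lemma raised_fringe N b u : N \in raised -> frozen N -> b \notin core (val N) ->
  posn (val N) b = [set u] -> u \notin fringe N b.
Proof.
move=> NQ fN bC pu.
exact: (raise_fix hn (@zone_core i) (zone_target fringe_place) (raised_zone NQ) fN
  (raised_fix NQ) bC pu).
Qed.

Lemma raised_intro N : N \in zone i ->
  (frozen N -> forall b u, b \notin core (val N) -> posn (val N) b = [set u] -> u \notin fringe N b) ->
  N \in raised.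
Proof.
move=> NQ h; rewrite in_raised NQ andTb; apply/eqP.
have [fN|fN] := boolP (frozen N); last exact: raise_inactive.
exact: (raise_id hn (@zone_core i) (zone_target fringe_place) NQ fN (h fN)).
Qed.

Definition sinkh N b (X : {set V}) := X :\: fringe N b.
Definition sink N := if frozen N then repos N (sinkh N) else N.

Lemma sink_inactive N : ~~ frozen N -> sink N = N.
Proof. by rewrite /sink => /negbTE ->. Qed.

(** The raising has removed the singletons on the fringe. An edge cannot have both ends there
    either, since the neighbour of a prunable vertex has degree at least two. *)
Lemma sink_sub N : N \in raised -> frozen N -> forall b, b \notin core (val N) ->
  sinkh N b (posn (val N) b) \subset posn (val N) b /\ sinkh N b (posn (val N) b) != set0.
Proof.
move=> NQ fN b bC; split; first exact: subsetDl.
have [vN _] := repP hn (frozen_card fN).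
apply/negP; rewrite setD_eq0 => /subsetP sub.
have [/eqP/cards1P[u pu]|[p2 pE]] := card_pos vN bC.
  by have := raised_fringe NQ fN bC pu; rewrite sub// pu in_set1.
have [u [v [pe uv]]] := edgeE (proj1 (valid_edge vN pE)).
have uF : u \in fringe N b by apply: sub; rewrite pe set21.
have vF : v \in fringe N b by apply: sub; rewrite pe set22.
have [uW _] := fringe_place fN uF.
have uv' : u \in nbw (ecore (val N)) (place N b i) v.
  by rewrite in_setI uW andbT nbP setUC -pe.
move: vF; rewrite in_set => /and3P[_ /cards1P[z vz] /existsP[y]].
rewrite vz in_set1 => /andP[/eqP -> z2]; move: uv'; rewrite vz in_set1 => /eqP uz.
by have [_] := fringe_place fN uF; rewrite uz => z1; rewrite z1 in z2.
Qed.

(** Unlike [low], sinking keeps the core: a frozen cell without removable leaves cannot lose a core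
    vertex. *)
Lemma sinkP N : N \in raised -> frozen N ->
  [/\ realignment_le (sink N) N, core (val (sink N)) = core (val N),
      ecore (val (sink N)) = ecore (val N)
    & posn (val (sink N)) = repos_pos N (sinkh N)].
Proof.
move=> NQ fN; have h2 := frozen_card fN.
have ok : repos_ok N (sinkh N) by exact: (repos_ok_sub hn h2 (sink_sub NQ fN)).
have [vp sE] := reposP hn h2 ok; rewrite /sink fN.
have le : realignment_le (repos N (sinkh N)) N.
  by apply: (repos_lower hn h2 ok) => b bC; exact: subsetDl.
have rN := zone_flat (raised_zone NQ).
have cE := frozen_core hn le rN; rewrite fN orbT in cE; have {}cE := cE isT.
have [eE _] := le_same_core hn le cE.
by split => //; rewrite {1}sE (posn_mk vp)// -sE.
Qed.

Local Opaque sink.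

Lemma sink_raised N : N \in raised -> sink N \in raised.
Proof.
move=> NQ; have [fN|fN] := boolP (frozen N); last by rewrite sink_inactive.
have [le cE eE pE] := sinkP NQ fN; have NZ := raised_zone NQ.
have fs : frozen (sink N) by rewrite (frozen_same cE).
have posE b : b \notin core (val N) -> posn (val (sink N)) b = posn (val N) b :\: fringe N b.
  by move=> bC; rewrite pE [LHS]ffunE (negbTE bC).
apply: raised_intro; last first.
  move=> _ b u; rewrite cE => bC; rewrite posE// (fringe_same _ cE eE) => /setP/(_ u).
  by rewrite in_setD in_set1 eqxx => /andP[].
apply/zoneP; split.
  by apply: (frozen_filled fs); rewrite (removable_same hn le cE) (zone_flat NZ).
move=> _ b; rewrite cE => bC; rewrite posE// (place_same _ _ cE eE).
have [_ sub] := zoneP _ _ NZ; exact: subset_trans (subsetDl _ _) (sub fN b bC).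
Qed.

Lemma sink_reduces : reduces R raised [set N in raised | sink N == N].
Proof.
apply: reduces_kernel.
- exact: sink_raised.
- move=> N NQ; have [fN|fN] := boolP (frozen N); first by have [] := sinkP NQ fN.
  by rewrite sink_inactive// realignment_le_refl.
- move=> N NQ; have [fN|fN] := boolP (frozen N).
    2: by rewrite (sink_inactive fN) (sink_inactive fN).
  have [le cE eE pE] := sinkP NQ fN.
  have fs : frozen (sink N) by rewrite (frozen_same cE).
  have [le' cE' eE' pE'] := sinkP (sink_raised NQ) fs.
  apply: (same_core_eq hn cE' eE' _ (frozen_card fs)).
  rewrite pE' pE; apply/ffunP => b; rewrite [LHS]ffunE [RHS]ffunE cE.
  case: ifPn => [//|bC]; rewrite pE [repos_pos N (sinkh N) b]ffunE (negbTE bC).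
  by rewrite /sinkh (fringe_same _ cE eE) setDDl setUid.
- move=> N M NQ MQ NM; have rM := zone_flat (raised_zone MQ).
  have [fN|fN] := boolP (frozen N); last first.
    have [fM|fM] := boolP (frozen M).
      2: by rewrite (sink_inactive fN) (sink_inactive fM).
    have cE := frozen_core hn NM rM; rewrite fM orbT in cE.
    by rewrite (frozen_same (cE isT)) fM in fN.
  have cE : core (val N) = core (val M) by apply: (frozen_core hn NM rM); rewrite fN.
  have fM : frozen M by rewrite -(frozen_same cE).
  have [eE sub] := le_same_core hn NM cE.
  have [_ cN eN pN] := sinkP NQ fN; have [_ cM eM pM] := sinkP MQ fM.
  have c1 : core (val (sink N)) = core (val (sink M)) by exact: etrans cN (etrans cE (esym cM)).
  have e1 : ecore (val (sink N)) = ecore (val (sink M)) by exact: etrans eN (etrans eE (esym eM)).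
  have c2 : 2 <= #|core (val (sink M))| by rewrite cM; exact: frozen_card.
  apply: (le_of_posn hn c1 e1 c2 pN pM); apply: (repos_pos_homo cE) => b.
  by rewrite /sinkh (fringe_same _ cE eE) setSD.
- exact: (zraise_stable fringe_place fringe_act).
- move=> g N NQ; have [fN|fN] := boolP (frozen N); last first.
    by rewrite (sink_inactive fN) sink_inactive ?frozen_act.
Local Transparent sink.
  rewrite /sink frozen_act fN.
  have ok : repos_ok N (sinkh N) by exact: (repos_ok_sub hn (frozen_card fN) (sink_sub NQ fN)).
  apply: (repos_act hn (frozen_card fN) ok) => b _.
  rewrite /sinkh imsetD; congr (_ :\: _).
  apply/setP => u; rewrite -(permKV (\val g) u) fringe_act.
  by rewrite (mem_gim (\val g)).
Qed.
Local Opaque sink.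

(** If every position avoids the fringe, both the raising and the sinking act trivially; conversely,
    being fixed by the sinking says exactly that positions avoid the fringe. *)
Lemma sink_fix : [set N in raised | sink N == N] = zone i.+1.
Proof.
apply/setP => N; rewrite in_set; apply/andP/zoneP => [[NQ /eqP sN]|[NF h]].
  have [NF sub] := zoneP _ _ (raised_zone NQ); split => // fN b bC.
  have [_ _ _] := sinkP NQ fN; rewrite sN => /ffunP/(_ b).
  rewrite [RHS]ffunE (negbTE bC) /sinkh => pE.
  rewrite placeS; apply/subsetP => u ub; rewrite in_setD (subsetP (sub fN b bC) _ ub) andbT.
  by move: ub; rewrite pE in_setD => /andP[].
have NZ : N \in zone i.
  apply/zoneP; split => // fN b bC.
  exact: subset_trans (h fN b bC) (place_pred N b i).
have nF b u : frozen N -> b \notin core (val N) -> u \in posn (val N) b -> u \notin fringe N b.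
  move=> fN bC ub; have := subsetP (h fN b bC) _ ub.
  by rewrite placeS in_setD => /andP[].
have NQ : N \in raised.
  by apply: raised_intro => // fN b u bC pu; apply: nF => //; rewrite pu in_set1.
split => //; apply/eqP.
have [fN|fN] := boolP (frozen N); last by rewrite sink_inactive.
have [_ cE eE pE] := sinkP NQ fN; apply: (same_core_eq hn cE eE _ (frozen_card fN)).
rewrite pE; apply/ffunP => b; rewrite [LHS]ffunE; case: ifPn => bC; first by rewrite posn_core.
apply/setP => u; rewrite in_setD; case ub : (u \in posn (val N) b); last by rewrite andbF.
by rewrite (nF b u).
Qed.

Lemma zone_step : reduces R (zone i) (zone i.+1).
Proof.
rewrite -sink_fix; apply: retracts_trans sink_reduces.
exact: (zraise_reduces R fringe_place fringe_same fringe_act).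
Qed.

End ZoneStep.

Lemma zone0 : zone 0 = filled.
Proof.
apply/setP => N; apply/zoneP/idP => [[]//|NF]; split => // fN b bC.
have [vN _] := repP hn (frozen_card fN).
by apply/subsetP => u /(pos_sub vN)[_ uC bu]; rewrite in_setI uC in_set.
Qed.

Lemma filled_zone (R : realType) i : reduces R filled (zone i).
Proof.
elim: i => [|i IH]; first by rewrite zone0; exact: retracts_refl.
exact: retracts_trans IH (zone_step R i).
Qed.

End PruningPositions.

(** * The cells that remain: stars, full double stars, isolated frozen cells *)

Section FinalCells.
Import boot.finset boot.fintype.
Local Open Scope nat_scope.
Local Open Scope set_scope.
Context (V : finType) (G : simple_graph V) (hn : 3 <= #|V|).
Local Opaque core raise repos fill flat filled posn ecore zone.
Local Notation removable := (removable G).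
Local Notation special := (special G).
Implicit Types (N K M : realignment G).
Local Notation frozen := (@frozen V G).
Local Notation filled := (@filled V G).
Local Notation S := (universal_vertices G).
Local Notation zone := (@zone V G).

(** After [#|V|] prunings the forest consists of isolated vertices and isolated edges, and these are
    the ends of the edges. *)
Definition leafs N b : {set V} :=
  [set u in place N b #|V| | #|nbw (ecore (val N)) (place N b #|V|) u| == 1].

Lemma leafs_place N b u : frozen N -> u \in leafs N b ->
  u \in place N b #|V| /\ #|nbw (ecore (val N)) (place N b #|V|) u| = 1.
Proof. by move=> _; rewrite in_set => /andP[? /eqP]. Qed.

Lemma leafs_same N M b : core (val N) = core (val M) ->
  ecore (val N) = ecore (val M) -> leafs N b = leafs M b.
Proof. by move=> cE eE; rewrite /leafs (place_same _ _ cE eE) eE. Qed.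

Lemma leafs_act (g : Aut_graph G) N b u :
  (\val g u \in leafs (realignment_act g N) (\val g b)) = (u \in leafs N b).
Proof.
rewrite [LHS]in_set [RHS]in_set place_act (mem_gim (\val g)); congr (_ && _).
rewrite /nbw ecore_permute nb_permute -imsetI; last by move=> ? ? _ _; exact: perm_inj.
by rewrite card_imset//; exact: perm_inj.
Qed.

(* After the pruning each tree is a vertex or an edge, and raising the
   positions to the edges leaves a single, maximal cell on each frozen
   component. The unfrozen cells are the stars and the full double stars. *)
Definition final : {set realignment G} :=
  [set N in zone #|V| | raise frozen leafs (fun N b => place N b #|V|) N == N].
Definition std : {set realignment G} := [set N in final | ~~ frozen N].
Definition islands : {set realignment G} := [set N in final | frozen N].

Lemma final_reduces (R : realType) : reduces R setT final.
Proof.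
apply: (retracts_trans (flat_reduces G hn R)).
apply: (retracts_trans (filled_reduces G hn R)).
apply: (retracts_trans (filled_zone G hn R #|V|)).
exact: (zraise_reduces hn R leafs_place leafs_same leafs_act).
Qed.

Lemma final_stable : stable final.
Proof. exact: (zraise_stable hn leafs_place leafs_act). Qed.

Lemma in_final N : (N \in final) =
  (N \in zone #|V|) && (raise frozen leafs (fun N b => place N b #|V|) N == N).
Proof. by rewrite in_set. Qed.

Local Opaque final.

Lemma in_std N : (N \in std) = (N \in final) && ~~ frozen N.
Proof. by rewrite in_set. Qed.

Lemma in_islands N : (N \in islands) = (N \in final) && frozen N.
Proof. by rewrite in_set. Qed.

Local Opaque std islands.

Lemma finalE N : (N \in final) = (N \in std) || (N \in islands).
Proof. by rewrite in_std in_islands; case: (frozen N); case: (N \in final). Qed.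

Lemma std_stable : stable std.
Proof. by move=> g N; rewrite (in_std N) (in_std (realignment_act g N)) final_stable frozen_act. Qed.

Lemma islands_stable : stable islands.
Proof.
by move=> g N; rewrite (in_islands N) (in_islands (realignment_act g N)) final_stable frozen_act.
Qed.

Lemma final_removable N : N \in final -> removable (val N) = set0.
Proof. by rewrite in_final => /andP[/zone_flat]. Qed.

(** Both cells have the same core, so they could differ only where [N] has a singleton [u] and [M]
    an edge [uw]. Both ends lie in the stable forest of [b], so [u] is a leaf there, and the last
    raising would have enlarged the position of [N]. *)
Lemma final_le_eq N M : N \in final -> M \in final -> realignment_le N M ->
  frozen N || frozen M -> N = M.
Proof.
move=> NF MF NM fr; have cE := frozen_core hn NM (final_removable MF) fr.
have fE := frozen_same cE; have fN : frozen N by rewrite -fE orbb in fr.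
have fM : frozen M by rewrite -fE.
have [eE sub] := le_same_core hn NM cE.
apply: (same_core_eq hn cE eE _ (frozen_card fM)); apply/ffunP => b.
have [bC|bC] := boolP (b \in core (val N)).
  by rewrite !posn_core// -cE.
have bCM : b \notin core (val M) by rewrite -cE.
have [vN _] := repP hn (frozen_card fN); have [vM _] := repP hn (frozen_card fM).
apply/eqP; rewrite eqEcard sub.
have [h1|[h2 hE]] := card_pos vM bCM.
  by rewrite h1 card_gt0 (pos_neq0 vN bC).
have [/eqP/cards1P[u pu]|[-> _]] := card_pos vN bC; last by rewrite h2.
exfalso; move: NF; rewrite in_final => /andP[NZ /eqP fxN].
have := raise_fix hn (@zone_core V G #|V|) (zone_target leafs_place) NZ fN fxN bC pu.
move/negP; apply.
have ub : u \in posn (val M) b by apply: (subsetP (sub b)); rewrite pu in_set1.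
have : 0 < #|posn (val M) b :\ u| by move: h2; rewrite (cardsD1 u) ub add1n => -[->].
case/card_gt0P => w; rewrite in_setD1 => /andP[wu wb].
move: MF; rewrite in_final => /andP[/zoneP[_ zM] _].
have wP : w \in place N b #|V|.
  by rewrite (place_same _ _ cE eE); exact: (subsetP (zM fM b bCM)).
have uP : u \in place N b #|V|.
  by rewrite (place_same _ _ cE eE); exact: (subsetP (zM fM b bCM)).
rewrite in_set uP; apply/eqP; have [EE ac] := ecore_forest hn (frozen_card fN).
apply: (prune_stable EE ac (v := w)) => //; first exact: iter_prune_stable.
rewrite in_setI wP andbT nbP eE (_ : [set u; w] = posn (val M) b)//.
by apply/eqP; rewrite eqEcard subUset !sub1set ub wb h2 cards2 eq_sym wu.
Qed.

Lemma islands_isolated N M : N \in islands -> M \in final ->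
  realignment_le N M || realignment_le M N -> M = N.
Proof.
rewrite in_islands => /andP[NF fN] MF /orP[] le.
  by apply/esym/final_le_eq => //; rewrite fN.
by apply: final_le_eq => //; rewrite fN orbT.
Qed.

Lemma std_cases N : N \in std ->
  (exists2 y, y \in S & core (val N) = [set y] /\ val N = star y) \/
  (special (val N) /\ fill N = N).
Proof.
rewrite in_std in_final => /andP[/andP[/zoneP[NF _] _]].
have [c2|c1] := leqP 2 #|core (val N)|; last first.
  by move=> _; have [y [yS cy sy]] := small_core_star hn (real_is N) c1; left; exists y.
rewrite negb_and c2 /= negbK => sp; right; split => //.
by move: NF; rewrite in_filled => /andP[_ /eqP].
Qed.

Lemma std_core N : N \in std -> core (val N) \in complete_graph S.
Proof.
move=> /std_cases H; rewrite in_set.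
have [[y yS [-> _]]|[/andP[/eqP c2 sS] _]] := H.
  by rewrite sub1set yS cards1.
by rewrite sS c2.
Qed.

Lemma special_ecore N : special (val N) -> ecore (val N) = [set core (val N)].
Proof.
move=> sN; have /andP[/eqP c2 _] := sN; apply/setP => e; rewrite in_set1.
apply/idP/eqP => [eE|->]; last exact: special_core_edge.
move: (eE); rewrite in_ecore => /andP[/(real_edge (real_is N))/card_edge e2 sub].
by apply/eqP; rewrite eqEcard sub c2 e2.
Qed.

Lemma std_core_inj N M : N \in std -> M \in std -> core (val N) = core (val M) -> N = M.
Proof.
move=> /std_cases[[y yS [cy sy]]|[sN fN]] /std_cases[[z zS [cz sz]]|[sM fM]] e.
- by apply: val_inj; rewrite sy sz; move: e; rewrite cy cz => /set1_inj ->.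
- by move: sM; rewrite /special -e cy cards1.
- by move: sN; rewrite /special e cz cards1.
- by rewrite -fN -fM; apply: (fill_same hn) => //; rewrite !special_ecore// e.
Qed.

Lemma std_intro N : ~~ frozen N -> N \in filled -> N \in std.
Proof.
move=> fN NF; rewrite in_std fN andbT in_final.
rewrite (raise_inactive _ _ fN) eqxx andbT.
by apply/zoneP; split => // h; rewrite h in fN.
Qed.

Lemma outside_pair (x y : V) : exists b, b \notin [set x; y].
Proof.
have /card_gt0P[b] : 0 < #|~: [set x; y]|.
  rewrite cardsCs setCK subn_gt0 (leq_ltn_trans _ hn)// cards2.
  by case: (x != y).
by rewrite in_setC; exists b.
Qed.

Lemma std_exists (e : {set V}) : e \in complete_graph S ->
  exists2 N, N \in std & core (val N) = e.
Proof.
rewrite in_set => /andP[eS /andP[e0 e2]].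
have [/cards1P[y ey]|e1] := boolP (#|e| == 1).
  have yS : y \in S by move: eS; rewrite ey sub1set.
  have [rs cs] := star_realignment hn yS.
  have rs' : `[< is_realignment G (star y) >] by apply/asboolP.
  pose N : realignment G := exist (fun D => `[< is_realignment G D >]) _ rs'.
  have cN : core (val N) = [set y] by [].
  exists N; last by rewrite ey.
  apply: std_intro; first by apply/negP => /andP[]; rewrite cN cards1.
  rewrite in_filled fill_inactive ?eqxx ?andbT; last by rewrite /special cN cards1.
  by apply/in_flat/removable_small; rewrite cN cards1.
have {e0 e1 e2} c2 : #|e| = 2.
  by apply/eqP; rewrite eqn_leq e2 ltn_neqAle eq_sym e1.
have [x [y [exy xy]]] : exists x y, e = [set x; y] /\ x != y.
  by move/eqP/cards2P: c2 => [x [y [nxy ->]]]; exists x, y.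
have [xS yS] : x \in S /\ y \in S by move: eS; rewrite exy subUset !sub1set => /andP.
have Gxy : G x y by have /universalP := xS; apply; rewrite eq_sym.
pose pos : {ffun V -> {set V}} := [ffun b => if b \in e then set0 else e].
have posE b : b \notin e -> pos b = e by move=> h; rewrite ffunE (negbTE h).
have vP : valid G e [set e] pos.
  split; first by rewrite c2.
  - by rewrite exy; exact: pair_tree.
  - by move=> b h; rewrite ffunE h.
  - by move=> b h; left; rewrite posE// in_set1.
  - move=> b v; rewrite ffunE; case: ifPn => bE; first by rewrite in_set0.
    move=> vE; have /universalP := subsetP eS _ vE; rewrite adj_sym; apply.
    by apply: contraNneq bE => ->.
have [N NE] := mk_isub vP.
have cN : core (val N) = e.
  rewrite NE (core_mk vP); apply/setP => u; rewrite in_set.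
  case uE : (u \in e) => //=; apply/orP; right.
  have [b bE] := outside_pair x y; apply/existsP; exists b.
  by rewrite posE exy// -exy.
have sN : special (val N) by rewrite /special cN c2 eS.
have [_ cF eF _] := fillP hn sN; have sF := fill_special hn sN.
exists (fill N); last by rewrite cF.
apply: std_intro; first by apply/negP => /andP[_]; rewrite sF.
rewrite in_filled (fill_same hn sF cF eF) eqxx andbT.
by apply/in_flat; exact: special_removable.
Qed.

(** With [std_core], [std_core_inj] and [std_exists] this identifies [std] with the face poset of
    the complete graph, so its order complex is the barycentric subdivision. *)
Lemma std_le N M : N \in std -> M \in std ->
  realignment_le N M = (core (val N) \subset core (val M)).
Proof.
move=> NS MS; apply/idP/idP; first exact: (core_homo hn).
move=> sub; have [e|ne] := eqVneq (core (val N)) (core (val M)).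
  by rewrite (std_core_inj NS MS e) realignment_le_refl.
have cN1 : #|core (val N)| < #|core (val M)| by rewrite proper_card// properEneq ne.
have [[y yS [cy sy]]|[sN _]] := std_cases NS; last first.
  have := std_core MS; rewrite in_set => /and3P[_ _ M2].
  have /andP[/eqP cN _] := sN; move: cN1; rewrite cN => /leq_trans/(_ M2).
  by rewrite ltnn.
have [[z zS [cz sz]]|[sM fM]] := std_cases MS; first by rewrite cz cy !cards1 in cN1.
have yM : y \in core (val M) by move: sub; rewrite cy sub1set.
have M2 := special_card sM; have [vM ME] := repP hn M2.
have ME' : posn (val M) = repos_pos M (fillh M) by have [_ _ _] := fillP hn sM; rewrite fM.
(* All outside vertices of the double star are moved to [y]. The other end of the core edge is then
   not reached any more, the core becomes [[set y]], and the result is the star at [y]. *)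
pose h (b : V) (X : {set V}) := [set y].
have hs b : b \notin core (val M) -> h b (posn (val M) b) \subset posn (val M) b /\
    h b (posn (val M) b) != set0.
  move=> bC; split; last by apply/set0Pn; exists y; rewrite in_set1.
  by rewrite ME' [repos_pos _ _ b]ffunE (negbTE bC) sub1set.
have ok : repos_ok M h := repos_ok_sub hn M2 hs.
have [vp pE] := reposP hn M2 ok.
have le : realignment_le (repos M h) M.
  by apply: (repos_lower hn M2 ok) => b /hs[].
have /andP[/eqP c2 _] := sM; have /eqP/cards2P[u [v [uv cuv]]] := c2.
have cP : core (val (repos M h)) = [set y].
  rewrite pE (core_mk vp) special_ecore//; apply/setP => w; rewrite in_set in_set1 cuv nb_pair//.
  have [->|wy] := eqVneq w y.
    rewrite -cuv yM /=; apply/orP; right.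
    have [b bC] := outside_pair u v; apply/existsP; exists b.
    by rewrite [repos_pos _ _ b]ffunE cuv (negbTE bC) in_set1.
  apply/negbTE; rewrite negb_and negb_or; apply/orP; right; apply/andP; split.
    by case: (w == u); rewrite ?cards1//; case: (w == v); rewrite ?cards1 ?cards0.
  apply/existsPn => b; rewrite [repos_pos _ _ b]ffunE.
  by case: ifP => _; rewrite ?in_set0 ?in_set1.
have [z [_ cz sz]] : exists z, [/\ z \in S, core (val (repos M h)) = [set z] & val (repos M h) = star z].
  by apply: (small_core_star hn (real_is _)); rewrite cP cards1.
have -> : N = repos M h by apply: val_inj; rewrite sy sz; move: cz; rewrite cP => /set1_inj ->.
exact: le.
Qed.

End FinalCells.

(** * The embedded complete graph *)

Section GraphWeights.
Import boot.finset boot.fintype.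
Local Open Scope set_scope.
Local Open Scope ring_scope.
Context (V : finType) (G : simple_graph V) (hn : (3 <= #|V|)%N).
Context (R : realType).
Local Opaque core raise repos std islands final ecore posn.
Local Notation S := (universal_vertices G).
Local Notation K := (complete_graph S).
Implicit Types (N M : realignment G).

Lemma graph_point (x : realisation R K) : exists a b l,
  [/\ a \in S, b \in S, 0 <= l <= 2^-1, a = b -> l = 0
    & forall s, \val x s = (1 - l) * (s == a)%:R + l * (s == b)%:R].
Proof.
have := realisation_supp x; rewrite in_set => /and3P[sS s0 s2].
set s := [set t | _] in sS s0 s2 *.
have x_out t : t \notin s -> \val x t = 0 by rewrite in_set negbK => /eqP.
have [/cards1P[a sa]|s1] := boolP (#|s| == 1)%N.
  have aS : a \in S by move: sS; rewrite sa sub1set.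
  have xa : \val x a = 1.
    rewrite -(realisation_sum x) (bigD1 a)//= big1 ?addr0// => t ta.
    by rewrite x_out// sa in_set1.
  exists a, a, 0; split => //; first by rewrite lexx invr_ge0 ler0n.
  move=> t; rewrite mul0r addr0 subr0 mul1r; have [->|ta] := eqVneq t a; first exact: xa.
  by rewrite x_out// sa in_set1.
have /cards2P[a [b [ab sab]]] : (#|s| == 2)%N by rewrite eqn_leq s2 ltn_neqAle eq_sym s1.
have [aS bS] : a \in S /\ b \in S by move: sS; rewrite sab subUset !sub1set => /andP.
have xab : \val x a + \val x b = 1.
  rewrite -(realisation_sum x) (bigD1 a)//= (bigD1 b) 1?eq_sym//= big1 ?addr0// => t /andP[ta tb].
  by rewrite x_out// sab in_set2 negb_or ta.
have form c d : c \in S -> d \in S -> c != d -> s = [set c; d] -> \val x c + \val x d = 1 ->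
    \val x d <= 2^-1 -> exists a b l,
  [/\ a \in S, b \in S, 0 <= l <= 2^-1, a = b -> l = 0
    & forall s, \val x s = (1 - l) * (s == a)%:R + l * (s == b)%:R].
  move=> cS dS cd scd xcd xd; exists c, d, (\val x d); split => //.
  - by rewrite realisation_ge0.
  - by move=> e; rewrite e eqxx in cd.
  - move=> t; have [->|tc] := eqVneq t c; first by rewrite (negbTE cd) mulr0 addr0 mulr1 -xcd addrK.
    have [->|td] := eqVneq t d; first by rewrite mulr0 add0r mulr1.
    by rewrite !mulr0 addr0 x_out// scd in_set2 negb_or tc.
have [h|h] := leP (\val x b) 2^-1; first exact: (form a b).
apply: (form b a); rewrite // 1?eq_sym 1?addrC 1?setUC//.
have -> : \val x a = 1 - \val x b by rewrite -xab addrK.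
by move: h; set u := \val x b; lra.
Qed.

(* The barycentric subdivision: the point [(1 - l) a + l b] with [l <= 1/2] is
   sent to [1 - 2 l] times the star at [a] plus [2 l] times the double star on
   [a, b]; [weight] writes these coordinates symmetrically in [a] and [b]. *)
Definition weight (z : V -> R) (e : {set V}) : R :=
  if (#|e| == 1)%N then \sum_(s in e) Num.max 0 (2 * z s - 1)
  else \sum_(s in e) z s - 2^-1 * \sum_(s in e) \sum_(t in e) `|z s - z t|.

Lemma weight1 z a : weight z [set a] = Num.max 0 (2 * z a - 1).
Proof. by rewrite /weight cards1 big_set1. Qed.

(** This is twice the smaller of the two coordinates, so for a point of the graph it vanishes unless
    the point is inside the edge [ab]. *)
Lemma weight2 z a b : a != b -> weight z [set a; b] = z a + z b - `|z a - z b|.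
Proof.
move=> ab; have sum2 (F : V -> R) : \sum_(s in [set a; b]) F s = F a + F b.
  by rewrite big_setU1 ?in_set1//= big_set1.
rewrite /weight cards2 ab !sum2 !subrr !normr0 addr0 add0r (distrC (z b)).
by rewrite /=; set u := `|_ - _|; lra.
Qed.

Definition incl_coord (z : V -> R) : {ptws realignment G -> R} :=
  fun N => if N \in std G then weight z (core (val N)) else 0.

Lemma incl_coordE (z : V -> R) a b l Na Nab N : Na \in std G -> Nab \in std G ->
  core (val Na) = [set a] -> core (val Nab) = [set a; b] ->
  0 <= l <= 2^-1 -> (a = b -> l = 0) ->
  (forall s, z s = (1 - l) * (s == a)%:R + l * (s == b)%:R) ->
  incl_coord z N = (1 - 2 * l) * (N == Na)%:R + 2 * l * (N == Nab)%:R.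
Proof.
move=> NaS NabS ca cab /andP[l0 l1] abl zE; rewrite /incl_coord.
have Neq M M' : M \in std G -> M' \in std G -> (M == M') = (core (val M) == core (val M')).
  by move=> MS MS'; apply/eqP/eqP => [->//|]; exact: (std_core_inj hn).
case: ifPn => [NS|NS]; last first.
  have [e|_] := eqVneq N Na; first by rewrite e NaS in NS.
  have [e|_] := eqVneq N Nab; first by rewrite e NabS in NS.
  by rewrite !mulr0 addr0.
rewrite !Neq// ca cab; have := std_core hn NS; rewrite in_set => /and3P[_ e0 e2].
have [/cards1P[s es]|e1] := boolP (#|core (val N)| == 1)%N.
  rewrite es weight1 zE (inj_eq set1_inj).
  have -> : ([set s] == [set a; b]) = (s == a) && (a == b).
    apply/eqP/andP => [/setP e|[/eqP -> /eqP ->]]; last by rewrite setUid.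
    have := e a; have := e b; rewrite !in_set2 !in_set1 !eqxx orbT => /eqP -> /eqP ->.
    by rewrite eqxx.
  have [sa|sa] := eqVneq s a; last first.
    rewrite !mulr0 addr0 add0r; case: (s == b); rewrite ?mulr1 ?mulr0 max_l; lra.
  have [ab|ab] := eqVneq a b.
    rewrite sa -ab eqxx abl// !mulr1 !mulr0 addr0 !subr0 mulr1 max_r; lra.
  by rewrite sa (negbTE ab) !mulr0 !mulr1 !addr0 max_r; lra.
have /cards2P[s [t [st est]]] : (#|core (val N)| == 2)%N by rewrite eqn_leq e2 ltn_neqAle eq_sym e1.
rewrite est weight2// !zE.
have -> : ([set s; t] == [set a]) = false.
  by apply/negbTE/eqP => /(congr1 (fun A : {set V} => #|A|)); rewrite cards2 st cards1.
have [ab|ab] := eqVneq a b.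
  rewrite -ab abl//.
  have [sa|sa] := eqVneq s a; have [ta|ta] := eqVneq t a;
    rewrite !(mul0r, mulr0, mulr1, mul1r, addr0, add0r, subr0, sub0r, normrN, normr1, normr0, subrr)//.
    by move: st; rewrite sa ta eqxx.
  by rewrite oppr0.
have pairE : ([set s; t] == [set a; b]) = (s == a) && (t == b) || (s == b) && (t == a).
  apply/eqP/orP => [/setP e|[/andP[/eqP-> /eqP->]//|/andP[/eqP-> /eqP->]]]; last by rewrite setUC.
  have := e a; have := e b; have := e s; have := e t; rewrite !in_set2 !eqxx !orbT.
  have [sa|sa] := eqVneq s a; have [ta|ta] := eqVneq t a.
  - by move: st; rewrite sa ta eqxx.
  - by rewrite orFb => /esym tb _ _ _; left; rewrite tb.
  - by rewrite !orFb ?orbF => _ /esym sb _ _; right; rewrite sb.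
  - by rewrite !orFb => /esym/eqP tb /esym/eqP sb; move: st; rewrite sb tb eqxx.
rewrite pairE mulr0 add0r.
have [sa|sa] := eqVneq s a; have [ta|ta] := eqVneq t a.
- by move: st; rewrite sa ta eqxx.
- rewrite sa (negbTE ab) mulr1 mulr0 addr0 andTb andFb orbF mulr0 add0r.
  case: (t == b); rewrite ?mulr1 ?mulr0; last by rewrite addr0 subr0 ger0_norm ?subrr//; lra.
  rewrite ger0_norm; lra.
- rewrite ta (negbTE ab) !mulr1 !mulr0 addr0 andFb andbT orFb add0r.
  case: (s == b); rewrite ?mulr1 ?mulr0; last by rewrite add0r sub0r normrN ger0_norm ?subrr//; lra.
  by rewrite distrC ger0_norm; lra.
- rewrite !andFb andbF orFb !mulr0 !add0r.
  case: eqP => [sb|_]; case: eqP => [tb|_].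
  + by move: st; rewrite sb tb eqxx.
  + by rewrite mulr1 mulr0 addr0 subr0 ger0_norm ?subrr.
  + by rewrite mulr1 mulr0 add0r sub0r normrN ger0_norm ?subrr.
  + by rewrite mulr0 addr0 subr0 normr0 subrr.
Qed.

End GraphWeights.

(** * The subdivision map onto the stars and double stars, with its inverse *)

Section GraphInclusion.
Import boot.finset boot.fintype.
Local Open Scope set_scope.
Local Open Scope ring_scope.
Context (V : finType) (G : simple_graph V) (hn : (3 <= #|V|)%N).
Context (R : realType).
Local Opaque core raise repos std islands final ecore posn.
Local Notation S := (universal_vertices G).
Local Notation K := (complete_graph S).
Implicit Types (N M : realignment G).

Lemma sum_delta (I : finType) (P : pred I) (F : I -> R) (i : I) :
  \sum_(j | P j) F j * (j == i)%:R = if P i then F i else 0.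
Proof.
rewrite big_mkcond (bigD1 i)//= big1 ?addr0 => [|j /negbTE ->].
  by rewrite eqxx mulr1.
by rewrite mulr0; case: ifP.
Qed.

Lemma two_point_in (d : Order.disp_t) (T : finPOrderType d) (A B : T) (m : R)
    (f : {ptws T -> R}) : (A <= B)%O -> 0 <= m <= 1 ->
  (forall t, f t = (1 - m) * (t == A)%:R + m * (t == B)%:R) ->
  f \in @realisation_set R T (order_complex T).
Proof.
move=> AB /andP[m0 m1] fE.
have f1 : \sum_t f t = 1.
  under eq_bigr do rewrite fE; rewrite big_split/=.
  by rewrite (sum_delta predT (fun=> 1 - m)) (sum_delta predT (fun=> m)) /= subrK.
apply: mem_set; split => //.
  by move=> t; rewrite fE addr_ge0// mulr_ge0// subr_ge0.
have sub t : f t != 0 -> t = A \/ t = B.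
  rewrite fE; have [->|tA] := eqVneq t A; first by left.
  have [->|tB] := eqVneq t B; first by right.
  by rewrite !mulr0 addr0 eqxx.
rewrite in_set; apply/andP; split.
  apply/negP => /eqP/setP s0; move/eqP: f1; rewrite big1 1?eq_sym ?oner_eq0// => t _.
  by apply/eqP/negPn; have := s0 t; rewrite in_set in_set0 => ->.
apply/forall_inP => t; rewrite in_set => /sub ht; apply/forall_inP => u.
rewrite in_set => /sub hu; rewrite /Order.comparable.
by case: ht => ->; case: hu => ->; rewrite ?lexx ?AB ?orbT.
Qed.

Lemma pair_in_graph a b : a \in S -> b \in S -> [set a; b] \in K.
Proof.
by move=> aS bS; rewrite in_set subUset !sub1set aS bS cards2; case: (a != b).
Qed.

Lemma single_in_graph a : a \in S -> [set a] \in K.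
Proof. by move=> aS; rewrite in_set sub1set aS cards1. Qed.

Lemma graph_point_exists a b (l : R) : a \in S -> b \in S -> 0 <= l <= 1 ->
  exists z : realisation R K, forall s, \val z s = (1 - l) * (s == a)%:R + l * (s == b)%:R.
Proof.
move=> aS bS /andP[l0 l1].
pose f : {ptws V -> R} := fun s => (1 - l) * (s == a)%:R + l * (s == b)%:R.
have f1 : \sum_s f s = 1.
  rewrite big_split/= (sum_delta predT (fun=> 1 - l)) (sum_delta predT (fun=> l)) /=.
  by rewrite subrK.
have fK : f \in @realisation_set R V K.
  apply: mem_set; split => //.
    by move=> s; rewrite /f addr_ge0// mulr_ge0// subr_ge0.
  have sub : [set t | f t != 0] \subset [set a; b].
    apply/subsetP => t; rewrite in_set in_set2 /f; case: (t == a) => //.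
    by case: (t == b) => //; rewrite !mulr0 addr0 eqxx.
  rewrite in_set; apply/and3P; split.
  - by apply: subset_trans sub _; rewrite subUset !sub1set aS bS.
  - rewrite card_gt0; apply/negP => /eqP/setP s0; move/eqP: f1.
    rewrite big1 1?eq_sym ?oner_eq0// => t _.
    by apply/eqP/negPn; have := s0 t; rewrite in_set in_set0 => ->.
  - by apply: leq_trans (subset_leq_card sub) _; rewrite cards2; case: (a != b).
by exists (exist (fun y => y \in @realisation_set R V K) f fK).
Qed.

Lemma graph_incl_in (z : realisation R K) :
  (incl_coord (\val z) : {ptws realignment G -> R}) \in @realisation_set R _ (order_complex (realignment G)).
Proof.
have [a [b [l [aS bS l01 abl zE]]]] := graph_point z.
have [Na NaS ca] := std_exists hn (single_in_graph aS).
have [Nab NabS cab] := std_exists hn (pair_in_graph aS bS).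
apply: (@two_point_in _ _ Na Nab (2 * l)).
- rewrite [(_ <= _)%O](std_le hn NaS NabS) ca cab; exact: subsetUl.
- by move/andP: l01 => [? ?]; apply/andP; split; lra.
- by move=> N; exact: (incl_coordE hn N NaS NabS ca cab).
Qed.

Definition graph_incl (z : realisation R K) : realignment_complex G R :=
  exist (fun y => y \in @realisation_set R _ (order_complex (realignment G))) _ (graph_incl_in z).

(** The affine extension of the map sending a cell of [std] to the barycentre of its core. It is a
    left inverse of [graph_incl] given by linear formulas on the whole complex, which is how
    openness in the image is checked. *)
Definition back (x : realignment_complex G R) (s : V) : R :=
  \sum_(N in std G | s \in core (val N)) (#|core (val N)|%:R)^-1 * \val x N.

Lemma back_two (x : realignment_complex G R) a b l Na Nab s :
  Na \in std G -> Nab \in std G ->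
  core (val Na) = [set a] -> core (val Nab) = [set a; b] -> (a = b -> l = 0) ->
  (forall N, \val x N = (1 - 2 * l) * (N == Na)%:R + 2 * l * (N == Nab)%:R) ->
  back x s = (1 - l) * (s == a)%:R + l * (s == b)%:R.
Proof.
move=> NaS NabS ca cab abl xE; rewrite /back.
have split_sum (I : finType) (P : pred I) (F y : I -> R) i j m n :
    (forall k, y k = m * (k == i)%:R + n * (k == j)%:R) ->
    \sum_(k | P k) F k * y k = m * (if P i then F i else 0) + n * (if P j then F j else 0).
  move=> yE; rewrite -[in RHS](sum_delta P F i) -[in RHS](sum_delta P F j).
  rewrite !mulr_sumr -big_split; apply: eq_bigr => k _.
  by rewrite yE/=; ring.
rewrite (split_sum _ _ _ _ _ _ _ _ xE) NaS NabS ca cab cards1 cards2 in_set1 in_set2 /=.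
have [ab|ab] := eqVneq a b.
  rewrite -ab abl// orbb; case: (s == a); rewrite !(mulr0, mul0r, subr0, addr0) ?invr1 ?mulr1//.
rewrite /=; have [->|sa] := eqVneq s a.
  by rewrite (negbTE ab) /= invr1; lra.
by case: (s == b) => /=; lra.
Qed.

Lemma graph_inclK (z : realisation R K) s : back (graph_incl z) s = \val z s.
Proof.
have [a [b [l [aS bS l01 abl zE]]]] := graph_point z.
have [Na NaS ca] := std_exists hn (single_in_graph aS).
have [Nab NabS cab] := std_exists hn (pair_in_graph aS bS).
rewrite zE; apply: (back_two _ NaS NabS ca cab abl) => N.
exact: (incl_coordE hn N NaS NabS ca cab).
Qed.

Lemma graph_incl_inj : injective graph_incl.
Proof. by move=> z z' e; apply: realisationP => s; rewrite -!graph_inclK e. Qed.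

(** A chain in [std] contains at most one star and at most one double star. The cases are a star
    alone, with [l = 0]; both; and a double star alone, with [l] one half. *)
Lemma std_point (x : realignment_complex G R) : supported (std G) x ->
  exists a b l Na Nab, [/\ [/\ a \in S, b \in S & 0 <= l <= 2^-1],
    [/\ Na \in std G, Nab \in std G, core (val Na) = [set a] & core (val Nab) = [set a; b]],
    a = b -> l = 0
    & forall N, \val x N = (1 - 2 * l) * (N == Na)%:R + 2 * l * (N == Nab)%:R].
Proof.
move=> xS; have /order_complexP[s0 sC] := realisation_supp x.
have chain N M : \val x N != 0 -> \val x M != 0 ->
    (core (val N) \subset core (val M)) || (core (val M) \subset core (val N)).
  move=> xN xM; rewrite -(std_le hn (xS _ xN) (xS _ xM)) -(std_le hn (xS _ xM) (xS _ xN)).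
  by apply: sC; rewrite in_set.
have stdS N u : N \in std G -> u \in core (val N) -> u \in S.
  by move=> /(std_core hn); rewrite in_set => /andP[/subsetP + _]; exact.
have [[Nab xab c2]|no2] := pselect (exists2 N, \val x N != 0 & #|core (val N)| = 2); last first.
  have c1 N : \val x N != 0 -> exists u, core (val N) = [set u].
    move=> xN; apply/cards1P; have := std_core hn (xS _ xN); rewrite in_set => /and3P[_ e0 e2].
    rewrite eqn_leq e0 andbT leqNgt; apply/negP => e2'; apply: no2; exists N => //.
    by apply/eqP; rewrite eqn_leq e2.
  move/set0Pn: s0 => [Na]; rewrite in_set => xa; have [a ca] := c1 _ xa.
  have NaS := xS _ xa; have aS : a \in S by apply: (stdS Na); rewrite // ca in_set1.
  have other N : N != Na -> \val x N = 0.
    move=> ne; apply/eqP/negPn/negP => xN; case/negP: ne; apply/eqP/(std_core_inj hn) => //.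
      exact: xS.
    have [u cu] := c1 _ xN; have := chain _ _ xN xa; rewrite cu ca !sub1set !in_set1.
    by case/orP => /eqP ->.
  have xa1 : \val x Na = 1.
    by rewrite -(realisation_sum x) (bigD1 Na)//= big1 ?addr0.
  exists a, a, 0, Na, Na; split => //.
  - by split => //; rewrite lexx invr_ge0 ler0n.
  - by split => //; rewrite setUid.
  - move=> N; rewrite mulr0 mul0r addr0 subr0 mul1r.
    by have [->|/other] := eqVneq N Na.
have NabS := xS _ xab.
have single N : \val x N != 0 -> N != Nab ->
    exists2 u, core (val N) = [set u] & u \in core (val Nab).
  move=> xN ne; have sub : core (val N) \proper core (val Nab).
    have cne : core (val N) != core (val Nab).
      by apply: contraNneq ne => /(std_core_inj hn (xS _ xN) NabS) ->.
    rewrite properEneq cne; case/orP: (chain _ _ xN xab) => // sub.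
    have := proper_card (_ : core (val Nab) \proper core (val N)).
    rewrite properEneq eq_sym cne sub c2 => /(_ isT) e3.
    have := std_core hn (xS _ xN); rewrite in_set => /and3P[_ _ e2].
    by have := leq_ltn_trans e2 e3; rewrite ltnn.
  have := proper_card sub; rewrite c2 ltnS => e1.
  have e0 : (0 < #|core (val N)|)%N by rewrite card_gt0 (core_neq0 hn).
  have /cards1P[u cu] : #|core (val N)| == 1%N by rewrite eqn_leq e1.
  by exists u => //; move/proper_sub: sub; rewrite cu sub1set.
have [[Na xa ne]|only] := pselect (exists2 N, \val x N != 0 & N != Nab).
  have [a ca aN] := single _ xa ne; have NaS := xS _ xa.
  have [b bN ba] : exists2 b, b \in core (val Nab) & b != a.
    have : (0 < #|core (val Nab) :\ a|)%N by move: c2; rewrite (cardsD1 a) aN add1n => -[->].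
    by case/card_gt0P => b; rewrite in_setD1 => /andP[? ?]; exists b.
  have cab : core (val Nab) = [set a; b].
    by apply/eqP; rewrite eq_sym eqEcard subUset !sub1set aN bN c2 cards2 eq_sym ba.
  have other N : N != Na -> N != Nab -> \val x N = 0.
    move=> nea neab; apply/eqP/negPn/negP => xN; case/negP: nea; apply/eqP.
    have [u cu _] := single _ xN neab; apply: (std_core_inj hn) => //; first exact: xS.
    have := chain _ _ xN xa; rewrite cu ca !sub1set !in_set1.
    by case/orP => /eqP ->.
  have x1 : \val x Na + \val x Nab = 1.
    rewrite -(realisation_sum x) (bigD1 Na)//= (bigD1 Nab) 1?eq_sym//= big1 ?addr0//.
    by move=> N /andP[]; exact: other.
  have x0a := realisation_ge0 x Na; have x0b := realisation_ge0 x Nab.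
  exists a, b, (2^-1 * \val x Nab), Na, Nab; split.
  - split; [by apply: (stdS Na) => //; rewrite ca in_set1|exact: (stdS Nab)|].
    by move: x1 x0a x0b; set u := \val x Na; set v := \val x Nab => *; apply/andP; split; lra.
  - by split.
  - by move=> e; rewrite e eqxx in ba.
  - move=> N; have [->|na] := eqVneq N Na.
      rewrite (negbTE ne) mulr0 addr0 mulr1.
      by move: x1; set u := \val x Na; set v := \val x Nab => *; lra.
    have [->|nab] := eqVneq N Nab; last by rewrite other// !mulr0 addr0.
    by rewrite mulr0 add0r mulr1; set v := \val x Nab; lra.
have /cards2P[a [b [ab cab]]] : #|core (val Nab)| == 2%N by rewrite c2.
have aS : a \in S by apply: (stdS Nab); rewrite // cab set21.
have bS : b \in S by apply: (stdS Nab); rewrite // cab set22.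
have [Na NaS ca] := std_exists hn (single_in_graph aS).
have other N : N != Nab -> \val x N = 0.
  by move=> ne; apply/eqP/negPn/negP => xN; apply: only; exists N.
have x1 : \val x Nab = 1 by rewrite -(realisation_sum x) (bigD1 Nab)//= big1 ?addr0.
(* At the midpoint the coefficient [1 - 2 * l] of the star vanishes, so either end of the edge can
   be taken as [a]. *)
exists a, b, 2^-1, Na, Nab; split.
- by split => //; rewrite invr_ge0 ler0n lexx.
- by split.
- by move=> e; rewrite e eqxx in ab.
- move=> N; rewrite mulfV// subrr mul0r add0r mul1r.
  by have [->|/other] := eqVneq N Nab.
Qed.

Lemma graph_incl_supported z : supported (std G) (graph_incl z).
Proof. by move=> N /=; rewrite /incl_coord; case: ifP => //; rewrite eqxx. Qed.

Lemma std_graph_incl x : supported (std G) x -> exists z, graph_incl z = x.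
Proof.
move=> /std_point[a [b [l [Na [Nab [[aS bS l01] [NaS NabS ca cab] abl xE]]]]]].
have [z zE] : exists z : realisation R K, forall s, \val z s = (1 - l) * (s == a)%:R + l * (s == b)%:R.
  by apply: graph_point_exists => //; move/andP: l01 => [? ?]; apply/andP; split; lra.
exists z; apply: realisationP => N; rewrite xE.
exact: (incl_coordE hn N NaS NabS ca cab).
Qed.

Lemma weight_act (g : {perm V}) (z w : V -> R) (e : {set V}) :
  (forall s, w (g s) = z s) -> weight w (g @: e) = weight z e.
Proof.
move=> wz; rewrite /weight card_imset; last exact: perm_inj.
have im (F : V -> R) : \sum_(s in g @: e) F s = \sum_(s in e) F (g s).
  by rewrite big_imset//= => x y _ _; exact: perm_inj.
case: ifP => _; rewrite !im; first by apply: eq_bigr => s _; rewrite wz.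
congr (_ - _ * _); apply: eq_bigr => s _; rewrite ?im ?wz//.
by apply: eq_bigr => t _; rewrite !wz.
Qed.

Lemma graph_actE (g : Aut_graph G) (z : realisation R K) s :
  \val (complete_graph_act g z) (\val g s) = \val z s.
Proof.
rewrite /= (bigD1 s)//= big1 ?addr0// => t /andP[/eqP/perm_inj ->].
by rewrite eqxx.
Qed.

Lemma graph_incl_equivariant (g : Aut_graph G) z :
  graph_incl (complete_graph_act g z) = realignment_complex_act g (graph_incl z).
Proof.
apply: realisationP => N; have [h _ hK] := injF_bij (@realignment_act_inj V G g).
rewrite -(hK N) realignment_complex_actE /= /incl_coord (std_stable hn); case: ifP => // _.
rewrite core_permute; apply: weight_act => s; exact: graph_actE.
Qed.

End GraphInclusion.

Section GraphInclusionContinuity.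
Import boot.finset boot.fintype.
Local Open Scope set_scope.
Local Open Scope ring_scope.
Context (V : finType) (G : simple_graph V) (hn : (3 <= #|V|)%N).
Context (R : realType).
Local Opaque core raise repos std islands final ecore posn.
Local Notation S := (universal_vertices G).
Local Notation K := (complete_graph S).
Implicit Types (N M : realignment G).

Lemma graph_incl_continuous : continuous (@graph_incl V G hn R).
Proof.
apply: continuous_set_type; apply: continuous_ptws => N.
suff cN : continuous (fun z : realisation R K => incl_coord (\val z) (N : realignment G) : R) by exact: cN.
rewrite /incl_coord; case: (N \in std G); last exact: rcont_cst.
have cz s : continuous (fun z : realisation R K => \val z s) by exact: realisation_coord_continuous.
rewrite /weight; case: (_ == _)%N.
  apply: rcont_sum => s _; apply: rcont_max; first exact: rcont_cst.
  by apply: rcontB; [apply: rcontM => //; exact: rcont_cst|exact: rcont_cst].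
apply: rcontB; first exact: rcont_sum.
apply: rcontM; first exact: rcont_cst.
apply: rcont_sum => s _; apply: rcont_sum => t _.
by apply: rcont_norm; exact: rcontB.
Qed.

Lemma back_continuous s : continuous (fun x : realignment_complex G R => back x s).
Proof.
apply: rcont_sum => N _; apply: rcontM; first exact: rcont_cst.
exact: realisation_coord_continuous.
Qed.

End GraphInclusionContinuity.

(** * Components *)

Section Components.
Context (R : realType) (X : topologicalType) (H : X * R -> X).
Context (cH : homotopy_continuous H).
Context (H0 : forall x, H (x, 0) = x).

Lemma homotopy_end_continuous : continuous (fun x => H (x, 1)).
Proof.
apply/continuous_subspace_setT.
have one01 : 0 <= (1 : R) <= 1 by rewrite ler01 lexx.
have : {within [set: X], continuous (H \o (fun x => (x, 1)))}.
  apply: within_comp cH.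
    apply: continuous_subspaceT; apply: pair_continuous; first by move=> ?.
    by move=> z; exact: cvg_cst.
  by move=> x _; split => //=; rewrite in_itv/= one01.
exact.
Qed.

(** The trajectory of [x] is connected and starts at [x], so a component is never left. *)
Lemma homotopy_component x0 x t : 0 <= t <= 1 ->
  connected_component [set: X] x0 x -> connected_component [set: X] x0 (H (x, t)).
Proof.
move=> t01 Cx; apply: connected_component_trans Cx _.
have path : connected ((fun s => H (x, s)) @` `[0, 1]).
  apply: connected_continuous_connected; first exact: segment_connected.
  apply: (within_comp (f := fun s : R => (x, s)) _ _ cH).
    apply: continuous_subspaceT; apply: pair_continuous; last by move=> ?.
    by move=> z; exact: cvg_cst.
  by move=> s s01; split.
apply: (connected_component_max _ _ path) => //.
  by exists 0; rewrite ?H0// /= in_itv/= lexx ler01.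
by exists t; rewrite //= in_itv.
Qed.

Lemma homotopy_restrict x0 :
  let C := set_type (connected_component [set: X] x0) in
  exists Hc : C * R -> C, homotopy_continuous Hc /\
    forall c t, 0 <= t <= 1 -> \val (Hc (c, t)) = H (\val c, t).
Proof.
move=> C; pose Hc (z : C * R) : C := insubd z.1 (H (\val z.1, z.2)).
have HcE c t : 0 <= t <= 1 -> \val (Hc (c, t)) = H (\val c, t).
  move=> t01; rewrite insubdK// mem_set//; apply: homotopy_component => //.
  exact: set_valP.
exists Hc; split => //; apply: (@continuous_set_type (subspace _)).
apply: (@within_eq _ _ _ (H \o (fun z : C * R => (\val z.1, z.2)))).
  by move=> [c t] [_ /=]; rewrite in_itv/= => t01; rewrite HcE.
apply: within_comp cH.
  apply: continuous_subspaceT; apply: pair_continuous; last exact: snd_continuous.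
  move=> z; apply: continuous_comp; first exact: fst_continuous.
  exact: continuous_val.
by move=> [c t] [_ /= t01].
Qed.

Lemma connected_component_image x0 :
  connected ((fun x => H (x, 1)) @` connected_component [set: X] x0).
Proof.
apply: connected_continuous_connected; first exact: component_connected.
by apply: continuous_subspaceT; exact: homotopy_end_continuous.
Qed.

Lemma discrete_connected (D A : set X) a : discrete_subset D -> A `<=` D ->
  connected A -> A a -> forall b, A b -> b = a.
Proof.
move=> Dd AD cA Aa b Ab; suff : [set x | A x /\ x = a] b by case.
have open_trace (P : set X) : exists2 B : set X, open B & forall x, D x -> B x <-> P x.
  have [B oB BP] := Dd [set c | P (\val c)]; exists B => // x Dx.
  have dD : x \in D by exact: mem_set.
  move/seteqP: BP => [BP PB]; split; first exact: (BP (exist _ x dD)).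
  exact: (PB (exist _ x dD)).
rewrite (cA [set x | A x /\ x = a])//; first by exists a.
  have [B oB BP] := open_trace [set a]; exists B => //.
  apply/seteqP; split => x /= [Ax h]; split => //; first by apply/BP => //; exact: AD.
  by apply/BP => //; exact: AD.
have [B oB BP] := open_trace (~` [set a]); exists (~` B); first exact: open_closedC.
apply/seteqP; split => x /= [Ax h]; split => //.
  by move/BP; apply => //; exact: AD.
by apply: contrapT => xa; apply: h; apply/BP => //; exact: AD.
Qed.

Context (K : topologicalType) (i : K -> X) (D : set X).
Context (i_emb : topological_embedding i).
Context (Dd : discrete_subset D).
Context (sep : separated (range i) D).
Context (H1 : forall x, (range i `|` D) (H (x, 1))).
Context (Hfix : forall t x, 0 <= t <= 1 -> (range i `|` D) x -> H (x, t) = x).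

Let one01 : 0 <= (1 : R) <= 1. Proof. by rewrite ler01 lexx. Qed.

(** The end of the deformation maps the component to a connected subset of the discrete set [D],
    hence to a single point. *)
Lemma contractible_component x : connected_component [set: X] x `&` range i = set0 ->
  contractible R (set_type (connected_component [set: X] x)).
Proof.
move=> miss; have [Hc [cHc HcE]] := homotopy_restrict x.
have xx : connected_component [set: X] x x by exact: connected_component_refl.
have Cx1 := homotopy_component one01 xx.
exists (exist (fun y => y \in _) _ (mem_set Cx1)), Hc; split => // c.
  by apply: val_inj; rewrite HcE ?H0// lexx ler01.
apply: val_inj; rewrite HcE//=; have := @connected_component_image x => cI.
have sub : (fun x => H (x, 1)) @` connected_component [set: X] x `<=` D.
  move=> _ [y Cy <-]; have [h|//] := H1 y.
  suff : set0 (H (y, 1)) by [].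
  by rewrite -miss; split => //; exact: homotopy_component.
apply: (discrete_connected Dd sub cI); first by exists x.
by exists (\val c) => //; exact: set_valP.
Qed.

(** The end of the deformation maps the component to a connected subset of [range i] and [D]
    together. As these are separated and [i k0] stays fixed, the image lies in [range i]; composing
    with the inverse of the embedding gives the map to [K]. *)
Lemma main_component k0 : connected [set: K] ->
  range i `<=` connected_component [set: X] (i k0) /\
  homotopy_equivalent R (set_type (connected_component [set: X] (i k0))) K.
Proof.
move=> cK; have [i_inj i_open] := i_emb.
have ci : continuous i.
  by apply/continuousP => A oA; apply/i_open; exists A.
have sub : range i `<=` connected_component [set: X] (i k0).
  apply: connected_component_max => //.
  by apply: connected_continuous_connected => //; exact: continuous_subspaceT.
split => //; have [Hc [cHc HcE]] := homotopy_restrict (i k0).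
have cI := @connected_component_image (i k0).
have endP y : connected_component [set: X] (i k0) y -> range i (H (y, 1)).
  have Hk : H (i k0, 1) = i k0 by apply: Hfix => //; left; exists k0.
  have : (fun x => H (x, 1)) @` connected_component [set: X] (i k0) `<=` range i `|` D.
    by move=> _ [z _ <-].
  have inI z : connected_component [set: X] (i k0) z ->
      ((fun x => H (x, 1)) @` connected_component [set: X] (i k0)) (H (z, 1)).
    by exists z.
  move=> /(connected_subset sep) /(_ cI)[h /inI /h //|h _].
  have : D (i k0) by rewrite -{1}Hk; apply/h/inI; exact: connected_component_refl.
  move=> Dk; suff : set0 (i k0) by [].
  by rewrite -(separated_disjoint sep); split => //; exists k0.
have fP (c : set_type (connected_component [set: X] (i k0))) :
    exists k, i k = H (\val c, 1).
  by have [k _ <-] := endP _ (set_valP c); exists k.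
pose f c := projT1 (cid (fP c)).
have fE c : i (f c) = H (\val c, 1) by rewrite /f; case: cid.
pose g k : set_type (connected_component [set: X] (i k0)) :=
  exist (fun y => y \in _) (i k) (mem_set (sub _ (imageT i k))).
exists f, g; split.
- apply/continuousP => A /i_open[B oB ->].
  have -> : f @^-1` (i @^-1` B) = (fun c => H (\val c, 1)) @^-1` B.
    by apply/seteqP; split => c /=; rewrite fE.
  suff cHv : continuous (fun c : set_type (connected_component [set: X] (i k0)) => H (\val c, 1)).
    by move/continuousP: cHv; exact.
  move=> c; apply: (@continuous_comp _ _ _ (fun c : set_type _ => \val c) (fun y => H (y, 1))).
    exact: continuous_val.
  exact: homotopy_end_continuous.
- exact: continuous_set_type.
(* The homotopy has to start at [g \o f] and end at the identity, so the deformation runs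
   backwards. *)
- exists (fun z => Hc (z.1, 1 - z.2)); split.
  + pose C := set_type (connected_component [set: X] (i k0)).
    have rev : {within [set: C] `*` `[0, 1], continuous (Hc \o (fun z : C * R => (z.1, 1 - z.2)))}.
      apply: within_comp cHc; last first.
        by move=> [c t] [_ /=]; rewrite !in_itv/= => /andP[? ?]; split => //; apply/andP; split; lra.
      apply: continuous_subspaceT; apply: pair_continuous; first exact: fst_continuous.
      by apply: rcontB; [exact: rcont_cst|exact: snd_continuous].
    exact: rev.
  + by move=> c; apply: val_inj; rewrite subr0 HcE//= fE.
  + by move=> c; apply: val_inj; rewrite subrr HcE ?H0// lexx ler01.
- exists fst; split => //; first by apply: continuous_subspaceT; exact: fst_continuous.
  move=> k; apply: i_inj; rewrite fE /= Hfix//.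
  by left; exists k.
Qed.

End Components.

(** * Assembling the deformation, the embedding and the discrete part *)

Section Assembly.
Import boot.finset boot.fintype.
Local Open Scope set_scope.
Local Open Scope ring_scope.
Context (V : finType) (G : simple_graph V) (hn : (3 <= #|V|)%N).
Context (R : realType).
Local Opaque core raise repos std islands final ecore posn.
Local Notation S := (universal_vertices G).
Local Notation K := (complete_graph S).
Implicit Types (N M : realignment G).
Lemma range_graph_incl : range (@graph_incl V G hn R) = supported (std G).
Proof.
apply/seteqP; split => [_ [z _ <-]|x /(std_graph_incl hn)[z <-]]; last by exists z.
exact: graph_incl_supported.
Qed.

(** The support is a chain, and an island is comparable to no other final cell; so the support is
    one island or consists of cells of [std]. *)
Lemma supported_final (x : realignment_complex G R) : supported (final G) x ->
  (supported (std G) `|` supported (islands G)) x.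
Proof.
move=> xF; have /order_complexP[_ xC] := realisation_supp x.
have [[N xN NI]|noI] := pselect (exists2 N, \val x N != 0 & N \in islands G).
  right => M xM; have [->//|] := eqVneq M N; case/negP; apply/eqP.
  apply: (islands_isolated hn NI (xF _ xM)).
  by have := xC N M; rewrite !in_set xN xM => /(_ isT isT).
left => N xN; have := xF _ xN; rewrite finalE => /orP[//|NI].
by exfalso; apply: noI; exists N.
Qed.

Lemma island_point (x : realignment_complex G R) N :
  supported (islands G) x -> \val x N != 0 -> forall M, \val x M = (M == N)%:R.
Proof.
move=> xI xN; have /order_complexP[_ xC] := realisation_supp x.
have NF : N \in final G by rewrite finalE (xI _ xN) orbT.
have other M : M != N -> \val x M = 0.
  move=> MN; apply/eqP/negPn/negP => xM; case/negP: MN; apply/eqP/esym.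
  apply: (islands_isolated hn (xI _ xM) NF).
  by have := xC M N; rewrite !in_set xM xN => /(_ isT isT).
move=> M; have [->|/other//] := eqVneq M N.
by rewrite -(realisation_sum x) (bigD1 N)//= big1 ?addr0.
Qed.

Lemma graph_incl_embedding : topological_embedding (@graph_incl V G hn R).
Proof.
split; first exact: graph_incl_inj.
move=> A; split; last first.
  by move=> [B oB ->]; apply: open_comp => // z _; exact: graph_incl_continuous.
move=> [B oB <-]; exists ((fun x => back x : {ptws V -> R}) @^-1` B).
  apply: open_comp => // x _; apply: continuous_ptws => s; exact: back_continuous.
apply/seteqP; split => z /=.
  by rewrite (_ : back _ = \val z)//; apply/funext => s; exact: graph_inclK.
by rewrite (_ : back _ = \val z)//; apply/funext => s; exact: graph_inclK.
Qed.

(** Each point of this subspace is a single vertex [N], and positivity of the coordinate [N] cuts it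
    out by an open condition. *)
Lemma islands_discrete : discrete_subset (@supported R _ (order_complex (realignment G)) (islands G)).
Proof.
move=> A; rewrite openE => c Ac; set x := \val c.
have xI : supported (islands G) x by exact: set_valP.
have /order_complexP[/set0Pn[N]] := realisation_supp x; rewrite in_set => xN _.
pose coord (y : realignment_complex G R) : R := \val y N.
have oB : open (coord @^-1` [set u | 0 < u]).
  by apply: open_comp; [move=> y _; exact: realisation_coord_continuous|exact: open_gt].
have : nbhs c (fun d : classical_sets.set_type (@supported R _ (order_complex (realignment G)) (islands G)) =>
    0 < coord (\val d)).
  apply: (@continuous_val _ _ c (coord @^-1` [set u | 0 < u])).
  apply: open_nbhs_nbhs; split => //.
  by rewrite /= lt_neqAle eq_sym xN realisation_ge0.
apply: filterS => d /= dN; rewrite (_ : d = c)//.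
have dI : supported (islands G) (\val d) by exact: set_valP.
apply: val_inj; apply: realisationP => M.
by rewrite (island_point dI (lt0r_neq0 dN)) (island_point xI xN).
Qed.

Lemma islands_invariant :
  invariant_set (@realignment_complex_act V G R) (supported (islands G)).
Proof.
move=> g x xI N; have [h _ hK] := injF_bij (@realignment_act_inj V G g).
by rewrite -(hK N) realignment_complex_actE (islands_stable hn); exact: xI.
Qed.

Lemma std_islands_separated :
  separated (@supported R _ (order_complex (realignment G)) (std G)) (supported (islands G)).
Proof.
have disj : supported (std G) `&` supported (islands G) =
    classical_sets.set0 :> set (realignment_complex G R).
  apply/seteqP; split => // x [xS xI].
  have /order_complexP[/set0Pn[N]] := realisation_supp x; rewrite in_set => xN _.
  have := xS _ xN; have := xI _ xN; rewrite (in_std N) (in_islands N).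
  by move=> /andP[_ fN] /andP[_]; rewrite fN.
by split; rewrite -(closure_id _).1//; exact: closed_supported.
Qed.

Lemma graph_connected : S != set0 -> connected [set: realisation R K].
Proof.
move/set0Pn=> [s sS].
have segment a b l (z : realisation R K) : a \in S -> b \in S -> 0 <= l <= 1 ->
    (forall t, \val z t = (1 - l) * (t == a)%:R + l * (t == b)%:R) ->
    exists2 w : realisation R K, connected_component [set: realisation R K] w z
      & forall t, \val w t = (t == a)%:R.
  move=> aS bS l01 zE.
  (* Clamping the parameter makes the segment from [a] to [b] a continuous map on all of [R]. *)
  pose cl (u : R) := Num.min 1 (Num.max 0 u).
  have clP u : 0 <= cl u <= 1.
    by rewrite /cl le_min ler01 le_max lexx ge_min lexx.
  have clE u : 0 <= u <= 1 -> cl u = u.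
    by move=> /andP[u0 u1]; rewrite /cl max_r// min_r.
  pose P u := projT1 (cid (graph_point_exists aS bS (clP u))).
  have PE u : forall t, \val (P u) t = (1 - cl u) * (t == a)%:R + cl u * (t == b)%:R.
    by rewrite /P; case: cid.
  have cP : continuous P.
    apply: continuous_set_type; apply: continuous_ptws => t.
    have ccl : continuous cl.
      by apply: rcont_min; [exact: rcont_cst|apply: rcont_max; [exact: rcont_cst|by move=> u; exact: cvg_id]].
    have -> : (fun u => \val (P u) t) = fun u => (1 - cl u) * (t == a)%:R + cl u * (t == b)%:R.
      by apply/funext => u; exact: PE.
    by apply: rcontD; apply: rcontM; [apply: rcontB| | |] => //; exact: rcont_cst.
  exists (P 0); last first.
    by move=> t; rewrite PE clE ?lexx ?ler01// subr0 mul1r mul0r addr0.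
  have -> : z = P l by apply: realisationP => t; rewrite PE clE.
  have cI : connected (P @` `[0, 1]).
    by apply: connected_continuous_connected; [exact: segment_connected|exact: continuous_subspaceT].
  apply: (connected_component_max _ _ cI) => //.
    by exists 0; rewrite //= in_itv/= lexx ler01.
have [ws wsE] : exists w : realisation R K, forall t, \val w t = (t == s)%:R.
  have l01 : 0 <= (0 : R) <= 1 by rewrite lexx ler01.
  have [w wE] := graph_point_exists sS sS l01.
  by exists w => t; rewrite wE subr0 mul1r mul0r addr0.
have all z : connected_component [set: realisation R K] ws z.
  have [a [b [l [aS bS l01 _ zE]]]] := graph_point z.
  have l1 : 0 <= l <= 1 by move/andP: l01 => [? ?]; apply/andP; split; lra.
  have [w wz wE] := segment _ _ _ _ aS bS l1 zE.
  apply: connected_component_trans wz.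
  have wE' t : \val w t = (1 - 1) * (t == s)%:R + 1 * (t == a)%:R.
    by rewrite wE subrr mul0r add0r mul1r.
  have one01 : 0 <= (1 : R) <= 1 by rewrite ler01 lexx.
  have [w' w'w w'E] := segment _ _ _ _ sS aS one01 wE'.
  by rewrite (_ : ws = w')//; apply: realisationP => t; rewrite wsE w'E.
suff <- : connected_component [set: realisation R K] ws = [set: realisation R K]%classic.
  exact: component_connected.
by apply/seteqP; split.
Qed.

Lemma final_deformation :
  equivariant_strong_deformation_retract R (@realignment_complex_act V G R)
    (range (@graph_incl V G hn R) `|` supported (islands G)).
Proof.
have [_ [H [cH H0 _ H1 Hfix Heq]]] := final_reduces G hn R.
have all x : @supported R _ (order_complex (realignment G)) setT x by move=> t; rewrite in_setT.
have sub x : (range (@graph_incl V G hn R) `|` supported (islands G)) x -> supported (final G) x.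
  rewrite range_graph_incl => -[] h N /h; rewrite finalE => ->; rewrite ?orbT //.
exists H; split => //.
- rewrite /homotopy_continuous; suff <- : @supported R _ (order_complex (realignment G)) setT = [set: realignment_complex G R]%classic.
    exact: cH.
  by apply/seteqP; split.
- by move=> x; rewrite range_graph_incl; apply: supported_final; exact: H1.
- by move=> t x t01 /sub; exact: Hfix.
- by move=> g t x t01; exact: Heq.
Qed.

End Assembly.

(** * The complete graph as a wedge of circles *)

Section Triangle.
Context (R : realType).
Implicit Types (c : set_type (@circle R)).

Definition unit_vec (v : R * R) : set_type (@circle R) :=
  insubd (@circle_base R) (v.1 / Num.sqrt (v.1 ^+ 2 + v.2 ^+ 2), v.2 / Num.sqrt (v.1 ^+ 2 + v.2 ^+ 2)).

Lemma unit_vecE v : v.1 ^+ 2 + v.2 ^+ 2 != 0 -> \val (unit_vec v) =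
  (v.1 / Num.sqrt (v.1 ^+ 2 + v.2 ^+ 2), v.2 / Num.sqrt (v.1 ^+ 2 + v.2 ^+ 2)).
Proof.
move=> v0; rewrite insubdK// mem_set// /circle/=.
by rewrite !expr_div_n sqr_sqrtr ?addr_ge0 ?sqr_ge0// -mulrDl divff.
Qed.

Lemma unit_vec_continuous (X : topologicalType) (v w : X -> R) :
  (forall x, v x ^+ 2 + w x ^+ 2 != 0) -> continuous v -> continuous w ->
  continuous (fun x => unit_vec (v x, w x)).
Proof.
move=> vw0 cv cw; apply: continuous_set_type.
pose n x := Num.sqrt (v x ^+ 2 + w x ^+ 2).
have -> : (fun x => \val (unit_vec (v x, w x))) = (fun x => (v x / n x, w x / n x)).
  by apply/funext => x; rewrite unit_vecE //=; exact: vw0.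
have cn : continuous n.
  move=> x; apply: (@continuous_comp _ _ _ (fun x => v x ^+ 2 + w x ^+ 2) Num.sqrt).
    have : continuous (fun x => v x * v x + w x * w x) by apply: rcontD; exact: rcontM.
    exact.
  exact: sqrt_continuous.
have n0 x : n x != 0.
  by rewrite /n sqrtr_eq0 -ltNge lt_neqAle eq_sym vw0 addr_ge0 ?sqr_ge0.
by apply: pair_continuous; apply: rcontM => //; exact: rcontV.
Qed.

Lemma unit_vec_scale c (r : R) : 0 < r -> unit_vec (r * (\val c).1, r * (\val c).2) = c.
Proof.
move=> r0; have c1 : (\val c).1 ^+ 2 + (\val c).2 ^+ 2 = 1 by have := set_valP c.
have e : (r * (\val c).1) ^+ 2 + (r * (\val c).2) ^+ 2 = r ^+ 2.
  by rewrite !exprMn -mulrDr c1 mulr1.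
apply: val_inj; rewrite unit_vecE /= e ?expf_neq0 ?gt_eqF// sqrtr_sqr gtr0_norm//.
by rewrite !(mulrC r) !mulfK ?gt_eqF//; case: (\val c).
Qed.

(* The boundary of the triangle with vertices [(0, 0)], [(1, 0)], [(0, 1)];
   [(a, b)] has barycentric coordinates [(1 - a - b, a, b)]. *)
Definition on_triangle (a b : R) :=
  [/\ 0 <= a, 0 <= b, a + b <= 1 & [|| a == 0, b == 0 | a + b == 1]].

(* The radial projection from the barycentre of the triangle. *)
Definition tri_circle (a b : R) := unit_vec (2 - 3 * (a + b), 3 * (a - b)).

Lemma on_triangle_neq0 a b : on_triangle a b ->
  (2 - 3 * (a + b)) ^+ 2 + (3 * (a - b)) ^+ 2 != 0.
Proof.
move=> [a0 b0 ab1 h]; rewrite paddr_eq0 ?sqr_ge0// !sqrf_eq0; apply/negP => /andP[/eqP e1 /eqP e2].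
by case/or3P: h => /eqP e; lra.
Qed.

(** Twice the gauge of the triangle with vertices (2, 0), (-1, 3), (-1, -3), which is the image of
    the original triangle under the affine map inside [tri_circle]. Hence [c] scaled by
    [2 / circle_size c] lies on its boundary. *)
Definition circle_size c : R :=
  Num.max (- 2 * (\val c).1) ((\val c).1 + `|(\val c).2|).

(** First coordinate of the inverse affine map at the scaled point: solving [x = 2 - 3 * (a + b)],
    [y = 3 * (a - b)] gives [a = (2 - x + y) / 6], and likewise [b = (2 - x - y) / 6] below. *)
Definition circle_tri1 c : R := (1 + ((\val c).2 - (\val c).1) / circle_size c) / 3.

Definition circle_tri2 c : R := (1 - ((\val c).1 + (\val c).2) / circle_size c) / 3.

Lemma circle_size_gt0 c : 0 < circle_size c.
Proof.
have c1 : (\val c).1 ^+ 2 + (\val c).2 ^+ 2 = 1 by have := set_valP c.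
rewrite /circle_size lt_max; have [h|h] := ltP (\val c).1 0; first by apply/orP; left; lra.
apply/orP; right; rewrite lt_neqAle addr_ge0// andbT eq_sym paddr_eq0// normr_eq0.
by apply/negP => /andP[/eqP e1 /eqP e2]; move: c1; rewrite e1 e2 expr0n addr0 => /eqP; rewrite eq_sym oner_eq0.
Qed.

(** The maximum in [circle_size] is over three linear forms, one for each side of the triangle. That
    each is at most the maximum gives the three inequalities, and a form that attains it gives the
    side containing the point. *)
Lemma circle_on_triangle c : on_triangle (circle_tri1 c) (circle_tri2 c).
Proof.
have s0 := circle_size_gt0 c; rewrite /circle_tri1 /circle_tri2.
have le1 : - 2 * (\val c).1 <= circle_size c by rewrite le_max lexx.
have le2 : (\val c).1 + `|(\val c).2| <= circle_size c by rewrite le_max lexx orbT.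
have eqs : (circle_size c == - 2 * (\val c).1) || (circle_size c == (\val c).1 + `|(\val c).2|).
  by rewrite /circle_size /Num.max; case: ifP; rewrite eqxx ?orbT.
move: le1 le2 eqs s0; set s := circle_size c; set x := (\val c).1; set y := (\val c).2.
move=> le1 le2 eqs s0; have si : 0 < s^-1 by rewrite invr_gt0.
have nn := ler_norm y; have nn' := ler_norm (- y); rewrite normrN in nn'.
have B1 : (x - y) / s <= 1 by rewrite ler_pdivrMr// mul1r; lra.
have B2 : (x + y) / s <= 1 by rewrite ler_pdivrMr// mul1r; lra.
have B3 : - 2 * x / s <= 1 by rewrite ler_pdivrMr// mul1r; lra.
have E1 : (y - x) / s = - ((x - y) / s) by rewrite -mulNr opprB.
have E3 : (x + y) / s = - (- 2 * x / s) - (x - y) / s by lra.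
split.
- by rewrite E1; lra.
- by lra.
- by rewrite E1; lra.
- case/orP: eqs => /eqP e.
    apply/or3P/Or33/eqP; have : - 2 * x / s = 1 by rewrite -e divff ?gt_eqF.
    by move=> e3; rewrite E1; lra.
  have [y0|y0] := leP 0 y.
    rewrite ger0_norm// in e; apply/or3P/Or32/eqP.
    have : (x + y) / s = 1 by rewrite -e divff ?gt_eqF.
    by move=> ->; rewrite subrr mul0r.
  rewrite ltr0_norm// in e; apply/or3P/Or31/eqP.
  have : (x - y) / s = 1 by rewrite -e divff ?gt_eqF.
  by move=> e3; rewrite E1 e3 subrr mul0r.
Qed.

Lemma circle_triK c : tri_circle (circle_tri1 c) (circle_tri2 c) = c.
Proof.
have s0 := circle_size_gt0 c; rewrite -[RHS](@unit_vec_scale c (2 / circle_size c)) ?divr_gt0//.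
by rewrite /tri_circle /circle_tri1 /circle_tri2; congr (unit_vec (_, _)); field; rewrite gt_eqF.
Qed.

(** The gauge is homogeneous, and the maximum of the three forms is 2 on the boundary; only the
    normalising factor of [unit_vec] remains. *)
Lemma tri_circle_size a b : on_triangle a b ->
  circle_size (tri_circle a b) =
    2 / Num.sqrt ((2 - 3 * (a + b)) ^+ 2 + (3 * (a - b)) ^+ 2).
Proof.
move=> tab; rewrite /circle_size unit_vecE /=; last exact: on_triangle_neq0.
set n := Num.sqrt _.
have n0 : 0 < n by rewrite sqrtr_gt0 lt_neqAle eq_sym on_triangle_neq0// addr_ge0 ?sqr_ge0.
rewrite normrM (gtr0_norm (x := n^-1)) ?invr_gt0// mulrA -mulrDl -maxr_pMl ?invr_ge0 ?ltW//.
congr (_ / _); case: tab => a0 b0 ab1.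
have nn := ler_norm (3 * (a - b)); have nn' := ler_norm (- (3 * (a - b))); rewrite normrN in nn'.
have nm : `|3 * (a - b)| = 3 * (a - b) \/ `|3 * (a - b)| = - (3 * (a - b)).
  by have [h|h] := leP 0 (3 * (a - b)); [left; rewrite ger0_norm|right; rewrite ltr0_norm].
by case/or3P => /eqP e; case: (leP (- 2 * (2 - 3 * (a + b))) (2 - 3 * (a + b) + `|3 * (a - b)|)) => h; case: nm => nm; lra.
Qed.

Lemma tri_circle1K a b : on_triangle a b -> circle_tri1 (tri_circle a b) = a.
Proof.
move=> tab; rewrite /circle_tri1 tri_circle_size// unit_vecE /=; last exact: on_triangle_neq0.
set n := Num.sqrt _.
have n0 : n != 0 by rewrite gt_eqF// sqrtr_gt0 lt_neqAle eq_sym on_triangle_neq0// addr_ge0 ?sqr_ge0.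
by field.
Qed.

Lemma tri_circle2K a b : on_triangle a b -> circle_tri2 (tri_circle a b) = b.
Proof.
move=> tab; rewrite /circle_tri2 tri_circle_size// unit_vecE /=; last exact: on_triangle_neq0.
set n := Num.sqrt _.
have n0 : n != 0 by rewrite gt_eqF// sqrtr_gt0 lt_neqAle eq_sym on_triangle_neq0// addr_ge0 ?sqr_ge0.
by field.
Qed.

Lemma circle_base_tri : tri_circle 0 0 = circle_base R.
Proof.
rewrite -[RHS](@unit_vec_scale (circle_base R) 2)// /tri_circle /=.
by congr (unit_vec (_, _)); ring.
Qed.

Lemma circle_tri_base1 : circle_tri1 (circle_base R) = 0.
Proof. by rewrite -circle_base_tri tri_circle1K//; split; rewrite ?lexx ?addr0 ?ler01 ?eqxx. Qed.

Lemma circle_tri_base2 : circle_tri2 (circle_base R) = 0.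
Proof. by rewrite -circle_base_tri tri_circle2K//; split; rewrite ?lexx ?addr0 ?ler01 ?eqxx. Qed.

Lemma circle_coord_continuous :
  continuous (fun c => (\val c).1) /\ continuous (fun c => (\val c).2).
Proof.
have cv : continuous (fun c => \val c : R * R) by exact: continuous_val.
split=> c.
  by apply: (@continuous_comp _ _ _ (fun c => \val c : R * R) fst); [exact: cv|exact: cvg_fst].
by apply: (@continuous_comp _ _ _ (fun c => \val c : R * R) snd); [exact: cv|exact: cvg_snd].
Qed.

Lemma circle_size_continuous : continuous circle_size.
Proof.
have [c1 c2] := circle_coord_continuous.
apply: rcont_max; first by apply: rcontM => //; exact: rcont_cst.
by apply: rcontD => //; exact: rcont_norm.
Qed.

Lemma circle_tri1_continuous : continuous circle_tri1.
Proof.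
have [c1 c2] := circle_coord_continuous.
apply: rcontM; last exact: rcont_cst.
apply: rcontD; first exact: rcont_cst.
apply: rcontM; first exact: rcontB.
by apply: rcontV circle_size_continuous => c; rewrite gt_eqF ?circle_size_gt0.
Qed.

Lemma circle_tri2_continuous : continuous circle_tri2.
Proof.
have [c1 c2] := circle_coord_continuous.
apply: rcontM; last exact: rcont_cst.
apply: rcontB; first exact: rcont_cst.
apply: rcontM; first exact: rcontD.
by apply: rcontV circle_size_continuous => c; rewrite gt_eqF ?circle_size_gt0.
Qed.

Lemma tri_circle_continuous (X : topologicalType) (a b : X -> R) :
  (forall x, on_triangle (a x) (b x)) -> continuous a -> continuous b ->
  continuous (fun x => tri_circle (a x) (b x)).
Proof.
move=> tab ca cb; apply: unit_vec_continuous.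
- by move=> x; exact: on_triangle_neq0.
- by apply: rcontB; [|apply: rcontM; [|exact: rcontD]]; exact: rcont_cst.
- by apply: rcontM; [exact: rcont_cst|exact: rcontB].
Qed.

End Triangle.

(** * Stretching the edges of the complete graph over triangles at the root *)

Section Stretching.
Import boot.finset boot.fintype.
Local Open Scope set_scope.
Local Open Scope ring_scope.
Context (V : finType) (G : simple_graph V).
Context (R : realType).
Local Notation S := (universal_vertices G).
Local Notation K := (complete_graph S).
Context (s0 : V).
Context (s0S : s0 \in S).

(* On an edge [ab] of the triangle [s0ab] the barycentric coordinates of the
   point are stretched along the path [s0, a, b, s0]; on an edge [s0a] the
   point moves towards [s0]. *)
Definition stretch (u v t : R) : R :=
  Num.max 0 (Num.min (u + v - t + (1 + 2 * t) * v) ((1 + 2 * t) * u - t * (u + v))).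

Lemma stretch0l v t : 0 <= v -> 0 <= t -> stretch 0 v t = 0.
Proof.
move=> v0 t0; apply/max_idPl; rewrite ge_min; apply/orP; right.
by rewrite mulr0 sub0r add0r oppr_le0 mulr_ge0.
Qed.

Lemma stretch0r u : 0 <= u <= 1 -> stretch u 0 1 = 0.
Proof.
move=> /andP[u0 u1]; apply/max_idPl; rewrite ge_min; apply/orP; left; lra.
Qed.

Lemma stretch0 u v : 0 <= u -> 0 <= v -> stretch u v 0 = u.
Proof. by move=> u0 v0; rewrite /stretch min_r ?max_r; lra. Qed.

Lemma stretch_continuous (Y : topologicalType) (u v t : Y -> R) :
  continuous u -> continuous v -> continuous t ->
  continuous (fun y => stretch (u y) (v y) (t y)).
Proof.
move=> cu cv ct.
have cuv : continuous (fun y => u y + v y) by exact: rcontD.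
have c2t : continuous (fun y => 1 + 2 * t y).
  by apply: rcontD; [|apply: rcontM => //]; exact: rcont_cst.
apply: rcont_max; first exact: rcont_cst.
apply: rcont_min; first by apply: rcontD; [exact: rcontB|exact: rcontM].
by apply: rcontB; exact: rcontM.
Qed.

Lemma stretch_triangle u v t : on_triangle u v -> 0 <= t <= 1 ->
  on_triangle (stretch u v t) (stretch v u t).
Proof.
move=> [u0 v0 uv1 h] /andP[t0 t1].
have side w : 0 <= w <= 1 -> stretch w 0 t = Num.max 0 (w - t).
  move=> /andP[w0 w1]; rewrite /stretch addr0 mulr0 addr0 min_l//.
  have := mulr_ge0 t0 w0; lra.
have side01 w : 0 <= w <= 1 -> 0 <= Num.max 0 (w - t) <= 1.
  by move=> /andP[w0 w1]; rewrite le_max lexx ge_max ler01/=; lra.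
case/or3P: h => /eqP e.
- have v1 : 0 <= v <= 1 by apply/andP; split; lra.
  rewrite e stretch0l// side//; have /andP[? ?] := side01 _ v1.
  by split; rewrite ?lexx ?add0r ?eqxx.
- have u1 : 0 <= u <= 1 by apply/andP; split; lra.
  rewrite e stretch0l// side//; have /andP[? ?] := side01 _ u1.
  by split; rewrite ?lexx ?addr0 ?eqxx ?orbT.
have ve : v = 1 - u by lra.
rewrite /stretch (addrC v u) e ve mulr1.
have tu : 0 <= t * u by exact: mulr_ge0.
have tu1 : t * u <= t by rewrite -[leRHS]mulr1 ler_wpM2l//; lra.
(* The edge is dilated about its midpoint by the factor [1 + 2 * t]. For [p] between 0 and 1 the
   point stays on [ab]; for negative [p] it has passed [b], and for [p] above 1 it has passed [a],
   by the excess along the side to [s0]. At [t = 1] the range of [p] has length 3, the whole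
   triangle. *)
set p := (1 + 2 * t) * u - t.
have -> : (1 + 2 * t) * (1 - u) - t = 1 - p by rewrite /p; lra.
have -> : 1 - t + (1 + 2 * t) * (1 - u) = 1 + (1 - p) by rewrite /p; lra.
have -> : 1 - t + (1 + 2 * t) * u = 1 + p by rewrite /p; lra.
have p1 : - 1 <= p by rewrite /p; lra.
have p2 : p <= 2 by rewrite /p; lra.
have [pn|pp] := leP p 0.
  have -> : Num.min (1 + (1 - p)) p = p by rewrite min_r; lra.
  have -> : Num.min (1 + p) (1 - p) = 1 + p by rewrite min_l; lra.
  rewrite max_l// max_r; last by lra.
  by split; rewrite ?lexx ?add0r ?eqxx//; lra.
have [qn|qp] := leP (1 - p) 0.
  have -> : Num.min (1 + (1 - p)) p = 1 + (1 - p) by rewrite min_l; lra.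
  have -> : Num.min (1 + p) (1 - p) = 1 - p by rewrite min_r; lra.
  rewrite (max_l qn) max_r; last by lra.
  by split; rewrite ?lexx ?addr0 ?eqxx ?orbT//; lra.
have -> : Num.min (1 + (1 - p)) p = p by rewrite min_r; lra.
have -> : Num.min (1 + p) (1 - p) = 1 - p by rewrite min_r; lra.
rewrite !max_r; try lra.
by split; try lra; apply/or3P/Or33/eqP; lra.
Qed.

Definition tri_point (a b : V) (u v : R) : {ptws V -> R} :=
  fun s => u * (s == a)%:R + v * (s == b)%:R + (1 - u - v) * (s == s0)%:R.

Lemma edge_point_in a b l (w : {ptws V -> R}) : a \in S -> b \in S -> 0 <= l <= 1 ->
  (forall s, w s = (1 - l) * (s == a)%:R + l * (s == b)%:R) ->
  w \in @realisation_set R V K.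
Proof.
move=> aS bS l01 wE; have [z zE] := graph_point_exists aS bS l01.
by rewrite (_ : w = \val z); [exact: valP|apply/funext => s; rewrite wE zE].
Qed.

Lemma tri_point_in a b u v : a \in S -> b \in S -> on_triangle u v ->
  tri_point a b u v \in @realisation_set R V K.
Proof.
move=> aS bS [u0 v0 uv1 /or3P[] /eqP e].
- apply: (@edge_point_in s0 b v) => //; first by apply/andP; split; lra.
  by move=> s; rewrite /tri_point e subr0 mul0r add0r addrC.
- apply: (@edge_point_in s0 a u) => //; first by apply/andP; split; lra.
  by move=> s; rewrite /tri_point e subr0 mul0r addr0 addrC.
- apply: (@edge_point_in a b v) => //; first by apply/andP; split; lra.
  move=> s; rewrite /tri_point (_ : 1 - u - v = 0); last by lra.
  by rewrite mul0r addr0 (_ : 1 - v = u)//; lra.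
Qed.

(** On an edge, [1 - z s0 - z s] is the coordinate of the end that is neither [s] nor the root.
    Writing it this way avoids naming the edge, so one formula is continuous on the whole graph. *)
Definition push_coord (z : V -> R) (t : R) : {ptws V -> R} := fun s =>
  if s == s0 then 1 - \sum_(c | c != s0) stretch (z c) (1 - z s0 - z c) t
  else stretch (z s) (1 - z s0 - z s) t.

(** The condition on [b] admits edges at the root, which are written with [b = s0] and [v = 0]. *)
Lemma push_coordE a b u v t : a != s0 -> a != b -> (b = s0 -> v = 0) ->
  0 <= u -> 0 <= v -> 0 <= t ->
  push_coord (tri_point a b u v) t = tri_point a b (stretch u v t) (stretch v u t).
Proof.
move=> as0 ab bs0 u0 v0 t0; set z := tri_point a b u v.
have z0 : z s0 = 1 - u - v.
  rewrite /z /tri_point eq_sym (negbTE as0) mulr0 add0r eqxx mulr1.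
  by case: (s0 =P b) => [/esym/bs0 ->|_]; rewrite ?mul0r ?mulr0 add0r.
have zs s : s != s0 -> stretch (z s) (1 - z s0 - z s) t =
    stretch u v t * (s == a)%:R + stretch v u t * (s == b)%:R.
  move=> ss0; rewrite z0 /z /tri_point (negbTE ss0) mulr0 addr0.
  have [->|sa] := eqVneq s a.
    rewrite (negbTE ab) !mulr0 !addr0 !mulr1; congr stretch; lra.
  have [_|sb] := eqVneq s b.
    rewrite !mulr0 !add0r !mulr1; congr stretch; lra.
  by rewrite !mulr0 addr0 stretch0l//; lra.
apply/funext => s; rewrite /push_coord; have [->|ss0] := eqVneq s s0; last first.
  by rewrite zs// /tri_point (negbTE ss0) mulr0 addr0.
under eq_bigr => c cs0 do rewrite zs//.
rewrite big_split/= (sum_delta (fun c => c != s0) (fun=> stretch u v t)).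
rewrite (sum_delta (fun c => c != s0) (fun=> stretch v u t)) as0.
rewrite /tri_point eqxx (eq_sym s0 a) (negbTE as0) mulr0 add0r mulr1 (eq_sym s0 b).
have [bE|_] := eqVneq b s0; last by rewrite /= mulr0 add0r opprD addrA.
by rewrite /= bs0// stretch0l// mul0r add0r subr0 addr0.
Qed.

Lemma graph_edge (x : realisation R K) a b : a != b -> \val x a != 0 -> \val x b != 0 ->
  [/\ a \in S, b \in S, \val x a + \val x b = 1
    & forall c, c != a -> c != b -> \val x c = 0].
Proof.
move=> ab xa xb; have := realisation_supp x; rewrite in_set => /and3P[sS _ s2].
set s := [set t | _] in sS s2.
have sab : s = [set a; b].
  apply/eqP; rewrite eq_sym eqEcard cards2 ab s2 andbT.
  by rewrite subUset !sub1set !in_set xa xb.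
have out c : c != a -> c != b -> \val x c = 0.
  move=> ca cb; have : c \notin s by rewrite sab in_set2 negb_or ca.
  by rewrite in_set negbK => /eqP.
move: sS; rewrite sab subUset !sub1set => /andP[aS bS]; split => //.
rewrite -(realisation_sum x) (bigD1 a)//= (bigD1 b) 1?eq_sym//= big1 ?addr0// => t /andP[].
exact: out.
Qed.

Lemma graph_on_triangle (x : realisation R K) a b : a != b -> on_triangle (\val x a) (\val x b).
Proof.
move=> ab; split; try exact: realisation_ge0.
  rewrite -(realisation_sum x) (bigD1 a)//= (bigD1 b) 1?eq_sym//= addrA lerDl.
  by apply: sumr_ge0 => c _; exact: realisation_ge0.
have [//|xa] := eqVneq (\val x a) 0; have [//|xb] := eqVneq (\val x b) 0.
by have [_ _ -> _] := graph_edge ab xa xb; rewrite eqxx.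
Qed.

Lemma graph_edge_point (x : realisation R K) a b : a != b -> a != s0 -> b != s0 ->
  \val x a != 0 -> \val x b != 0 -> \val x = tri_point a b (\val x a) (\val x b).
Proof.
move=> ab as0 bs0 xa xb; have [_ _ x1 out] := graph_edge ab xa xb.
have x2 : 1 - \val x a - \val x b = 0 by lra.
apply/funext => s; rewrite /tri_point x2 mul0r addr0.
have [->|sa] := eqVneq s a; first by rewrite (negbTE ab) mulr1 mulr0 addr0.
have [->|sb] := eqVneq s b; first by rewrite mulr1 mulr0 add0r.
by rewrite out// !mulr0 addr0.
Qed.

(** If no other vertex carries weight, the point is the root itself and any second universal vertex
    serves as [a]; this is where [S] must have two elements. *)
Lemma graph_star_point (x : realisation R K) : (1 < #|S|)%N ->
  (forall a b, a != b -> a != s0 -> b != s0 -> \val x a = 0 \/ \val x b = 0) ->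
  exists a, [/\ a \in S, a != s0 & \val x = tri_point a s0 (\val x a) 0].
Proof.
move=> S2 star.
have form a : a != s0 -> (forall c, c != a -> c != s0 -> \val x c = 0) ->
    \val x = tri_point a s0 (\val x a) 0.
  move=> as0 out; apply/funext => s; rewrite /tri_point mul0r addr0 subr0.
  have [->|sa] := eqVneq s a; first by rewrite (negbTE as0) mulr1 mulr0 addr0.
  have [->|ss0] := eqVneq s s0; last by rewrite out// !mulr0 addr0.
  rewrite mulr0 add0r mulr1 -(realisation_sum x) (bigD1 a)//= (bigD1 s0) 1?eq_sym//=.
  rewrite big1 ?addr0 => [|t /andP[]]; last exact: out.
  by rewrite addrAC subrr add0r.
have [[a as0 xa]|no] := pselect (exists2 a, a != s0 & \val x a != 0).
  exists a; split => //.
    have := realisation_supp x; rewrite in_set => /and3P[/subsetP sS _ _].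
    by apply: sS; rewrite in_set.
  apply: form => // c ca cs0; have [//|e] := star c a ca cs0 as0.
  by rewrite e eqxx in xa.
have [a] : exists a, a \in S :\ s0.
  by apply/card_gt0P; move: S2; rewrite (cardsD1 s0) s0S.
rewrite in_setD1 => /andP[as0 aS]; exists a; split => //.
by apply: form => // c _ cs0; apply/eqP/negPn/negP => xc; apply: no; exists c.
Qed.

Lemma push_coord_in (x : realisation R K) t : (1 < #|S|)%N -> 0 <= t <= 1 ->
  push_coord (\val x) t \in @realisation_set R V K.
Proof.
move=> S2 /andP[t0 t1]; have t01 : 0 <= t <= 1 by rewrite t0.
have [[a [b [ab as0 bs0 xa xb]]]|no] := pselect (exists a b,
    [/\ a != b, a != s0, b != s0, \val x a != 0 & \val x b != 0]).
  have [aS bS _ _] := graph_edge ab xa xb.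
  rewrite (graph_edge_point ab as0 bs0 xa xb) push_coordE ?realisation_ge0//; last first.
    by move=> e; rewrite e eqxx in bs0.
  by apply: tri_point_in => //; apply: stretch_triangle => //; exact: graph_on_triangle.
have [a [aS as0 ->]] : exists a, [/\ a \in S, a != s0 & \val x = tri_point a s0 (\val x a) 0].
  apply: graph_star_point => // a b ab as0 bs0; have [?|xa] := eqVneq (\val x a) 0; first by left.
  by have [?|xb] := eqVneq (\val x b) 0; [right|case: no; exists a, b].
have xa1 : on_triangle (\val x a) 0.
  have [u0 _ uv _] := graph_on_triangle x as0; have v0 := realisation_ge0 x s0.
  by split; rewrite ?lexx ?addr0 ?eqxx ?orbT//; lra.
rewrite push_coordE ?realisation_ge0//.
by apply: tri_point_in => //; exact: stretch_triangle.
Qed.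

Lemma push_coord0 (x : realisation R K) : push_coord (\val x) 0 = \val x.
Proof.
have str c : c != s0 -> stretch (\val x c) (1 - \val x s0 - \val x c) 0 = \val x c.
  move=> cs0; rewrite stretch0 ?realisation_ge0//.
  by have [_ _ uv _] := graph_on_triangle x cs0; lra.
apply/funext => s; rewrite /push_coord; have [->|/str//] := eqVneq s s0.
rewrite (eq_bigr (\val x) str) -(realisation_sum x) (bigD1 s0)//=.
by rewrite addrK.
Qed.

Lemma push_coord_continuous (Y : topologicalType) (z : Y -> {ptws V -> R}) (t : Y -> R) s :
  (forall c, continuous (fun y => z y c)) -> continuous t ->
  continuous (fun y => push_coord (z y) (t y) s).
Proof.
move=> cz ct.
have cst c : continuous (fun y => stretch (z y c) (1 - z y s0 - z y c) (t y)).
  apply: stretch_continuous => //.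
  by apply: rcontB => //; apply: rcontB => //; exact: rcont_cst.
rewrite /push_coord; case: (s == s0) => //.
by apply: rcontB; [exact: rcont_cst|exact: rcont_sum].
Qed.

Lemma tri_point_continuous (Y : topologicalType) (u v : Y -> R) a b s :
  continuous u -> continuous v -> continuous (fun y => tri_point a b (u y) (v y) s).
Proof.
move=> cu cv; apply: rcontD; first by apply: rcontD; apply: rcontM => //; exact: rcont_cst.
by apply: rcontM; [apply: rcontB => //; apply: rcontB => //|]; exact: rcont_cst.
Qed.

End Stretching.

Section PairIndex.
Import boot.finset boot.fintype.
Local Open Scope set_scope.
Local Open Scope ring_scope.
Context (V : finType) (G : simple_graph V).
Local Notation S := (universal_vertices G).
Context (s0 : V).
Context (s0S : s0 \in S).
(** There is one circle for each pair of universal vertices different from the root, and the number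
    of such pairs is the binomial coefficient of [#|S| - 1] over 2. *)
Lemma pair_index : exists a b : 'I_(((#|S| - 1) * (#|S| - 2)) %/ 2) -> V,
  [/\ forall i, [/\ a i \in S, b i \in S, a i != s0, b i != s0 & a i != b i],
      forall c d, c \in S -> d \in S -> c != s0 -> d != s0 -> c != d ->
        exists i, [set a i; b i] = [set c; d]
    & forall i j, [set a i; b i] = [set a j; b j] -> i = j].
Proof.
pose J : {set {set V}} := [set e : {set V} | (e \subset S :\ s0) && (#|e| == 2)%N].
have Jm : (((#|S| - 1) * (#|S| - 2)) %/ 2 = #|J|)%N.
  rewrite /J cards_draws bin2 divn2 (cardsD1 s0) s0S.
  by rewrite add1n subn1 subn2.
pose e i := enum_val (cast_ord Jm i).
have eJ i : e i \in J by exact: enum_valP.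
have eP i : exists ab : V * V, ab.1 != ab.2 /\ e i = [set ab.1; ab.2].
  have := eJ i; rewrite in_set => /andP[_ /cards2P[c [d [cd ->]]]].
  by exists (c, d).
pose ab i := projT1 (cid (eP i)).
have abP i : (ab i).1 != (ab i).2 /\ e i = [set (ab i).1; (ab i).2].
  by rewrite /ab; case: cid.
exists (fun i => (ab i).1), (fun i => (ab i).2); split => [i|c d cS dS cs ds cd|i j].
- have [ne ee] := abP i; have := eJ i.
  by rewrite in_set ee subUset !sub1set !in_setD1 => /andP[/andP[/andP[? ?] /andP[? ?]] _].
- have cdJ : [set c; d] \in J.
    by rewrite in_set cards2 cd subUset !sub1set !in_setD1 cs cS ds dS.
  exists (cast_ord (esym Jm) (enum_rank_in cdJ [set c; d])).
  by rewrite -(abP _).2 /e cast_ordKV enum_rankK_in.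
- by rewrite -(abP i).2 -(abP j).2 => /enum_val_inj/cast_ord_inj.
Qed.
End PairIndex.

(** * The homotopy equivalence between the complete graph and the bouquet *)

Section GraphBouquet.
Import boot.finset boot.fintype.
Local Open Scope set_scope.
Local Open Scope ring_scope.
Context (V : finType) (G : simple_graph V).
Context (R : realType).
Local Notation S := (universal_vertices G).
Local Notation K := (complete_graph S).
Context (s0 : V).
Context (s0S : s0 \in S).
Context (S2 : (1 < #|S|)%N).
Context (m : nat) (a b : 'I_m -> V).
Context (abS : forall i, [/\ a i \in S, b i \in S, a i != s0, b i != s0 & a i != b i]).
Context (ab_onto : forall c d, c \in S -> d \in S -> c != s0 -> d != s0 -> c != d ->
  exists i, [set a i; b i] = [set c; d]).
Context (ab_inj : forall i j, [set a i; b i] = [set a j; b j] -> i = j).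

Local Notation B := (bouquet R m).
Local Notation KR := (realisation R K).

Let lift (i : option 'I_m) (c : bouquet_summand R i) : B :=
  @wedge_lift _ (@bouquet_summand R m) (@bouquet_base R m) i c.
Let base : B := lift (i := None) tt.

Lemma lift_base i : lift (bouquet_base R i) = base.
Proof. exact: (@wedge_liftE _ (@bouquet_summand R m) (@bouquet_base R m) None tt i (bouquet_base R i)). Qed.

Lemma lift_continuous i : continuous (lift (i := i)).
Proof. exact: wedge_lift_continuous. Qed.

Lemma bouquet_case (z : B) : z = base \/ exists (i : 'I_m) c, z = lift (i := Some i) c.
Proof.
have : [set: B]%classic z by [].
rewrite -wedgeTE => -[[i|] _ [c _ <-]]; first by right; exists i, c.
by left; case: c.
Qed.

Definition edge_circle (i : 'I_m) (x : KR) : classical_sets.set_type (@circle R) :=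
  tri_circle (stretch (\val x (a i)) (\val x (b i)) 1) (stretch (\val x (b i)) (\val x (a i)) 1).

(** An interior point of an edge determines that edge, so at most one index qualifies; points on
    edges at the root go to the base point. *)
Definition to_bouquet (x : KR) : B :=
  if [pick i | (\val x (a i) != 0) && (\val x (b i) != 0)] is Some i
  then lift (i := Some i) (edge_circle i x) else base.


Lemma to_bouquet_edge i x : \val x (a i) != 0 -> \val x (b i) != 0 ->
  to_bouquet x = lift (i := Some i) (edge_circle i x).
Proof.
move=> xa xb; rewrite /to_bouquet; case: pickP => [j /andP[xaj xbj]|/(_ i)]; last by rewrite xa xb.
suff -> : j = i by [].
have [_ _ as0 bs0 ab] := abS i; have [_ _ _ out] := graph_edge ab xa xb.
have [_ _ _ _ abj] := abS j.
have mem c : \val x c != 0 -> c \in [set a i; b i].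
  move=> xc; rewrite in_set2; apply/negPn/negP; rewrite negb_or => /andP[ca cb].
  by rewrite out ?eqxx in xc.
apply: ab_inj; apply/eqP; rewrite eqEcard !cards2 ab abj leqnn andbT.
by rewrite subUset !sub1set !mem.
Qed.

Lemma to_bouquet_star x : (forall i, \val x (a i) = 0 \/ \val x (b i) = 0) -> to_bouquet x = base.
Proof.
move=> x0; rewrite /to_bouquet; case: pickP => // i /andP[].
by have [->|->] := x0 i; rewrite eqxx.
Qed.

Lemma edge_circle_star i x : \val x (a i) = 0 \/ \val x (b i) = 0 -> edge_circle i x = circle_base R.
Proof.
have [_ _ _ _ ab] := abS i; have [u0 v0 uv _] := graph_on_triangle x ab.
move=> h; rewrite /edge_circle; have zero : (0 <= (1 : R)) by exact: ler01.
by rewrite -circle_base_tri; case: h => e; rewrite !e; congr tri_circle;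
  rewrite ?stretch0l// stretch0r//; apply/andP; split; lra.
Qed.

Lemma edge_circle_continuous i : continuous (edge_circle i).
Proof.
have cx s : continuous (fun x : KR => \val x s) by exact: realisation_coord_continuous.
apply: tri_circle_continuous.
- move=> x; have [_ _ _ _ ab] := abS i.
  by apply: stretch_triangle; [exact: graph_on_triangle|rewrite ler01 lexx].
- by apply: stretch_continuous => //; exact: rcont_cst.
- by apply: stretch_continuous => //; exact: rcont_cst.
Qed.

Lemma closed_cover_continuous (X Y : topologicalType) (I : finType) (C : I -> set X)
    (F : I -> X -> Y) (f : X -> Y) : (forall i, closed (C i)) ->
  (forall x, exists i, C i x) -> (forall i, continuous (F i)) ->
  (forall i x, C i x -> f x = F i x) -> continuous f.
Proof.
move=> cC cov cF fE; apply/continuous_closedP => A cA.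
rewrite (_ : f @^-1` A = \bigcup_(i in [set: I]%classic) (C i `&` F i @^-1` A))%classic; last first.
  apply/seteqP; split => [x /= Ax|x [i _ [Cx]]] /=; last by rewrite (fE i).
  by have [i Cx] := cov x; exists i => //; split => //=; rewrite -(fE i).
apply: closed_bigcup; first exact: finite_finset.
by move=> i _; apply: closedI => //; move/continuous_closedP: (cF i); exact.
Qed.

(** The graph is covered by finitely many closed pieces: the closed edge for each index, and the
    star of the root where all products of end coordinates vanish. The formulas agree where pieces
    meet, since the ends of a fully stretched edge lie at the root. *)
Lemma to_bouquet_continuous : continuous to_bouquet.
Proof.
have cx s : continuous (fun x : KR => \val x s) by exact: realisation_coord_continuous.
pose C (i : option 'I_m) : classical_sets.set KR :=
  if i is Some i then (fun x => \val x (a i) + \val x (b i) = 1)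
  else (fun x => \sum_i \val x (a i) * \val x (b i) = 0).
pose F (i : option 'I_m) (x : KR) : B :=
  if i is Some i then lift (i := Some i) (edge_circle i x) else base.
have prod0 (x : KR) : \sum_i \val x (a i) * \val x (b i) = 0 ->
    forall i, \val x (a i) = 0 \/ \val x (b i) = 0.
  move=> /eqP; rewrite psumr_eq0 => [/allP h i|i _]; last by rewrite mulr_ge0 ?realisation_ge0.
  have := h i; rewrite mem_index_enum => /(_ isT) /=; rewrite mulf_eq0.
  by case/orP => /eqP; [left|right].
apply: (closed_cover_continuous (C := C) (F := F)).
- have ceq (h : KR -> R) (c : R) : continuous h -> closed (fun x => h x = c).
    by move=> ch; apply: (@closed_comp _ _ h [set y | y = c]%classic); [move=> x _; exact: ch|exact: closed_eq].
  case=> [i|]; apply: ceq; first exact: rcontD.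
  by apply: rcont_sum => i _; exact: rcontM.
- move=> x; have [x0|x0] := eqVneq (\sum_i \val x (a i) * \val x (b i)) 0; first by exists None.
  have [i] : exists i, \val x (a i) * \val x (b i) != 0.
    apply: contrapT => no; case/negP: x0; rewrite big1// => i _.
    by apply/eqP/negPn/negP => xi; apply: no; exists i.
  rewrite mulf_eq0 negb_or => /andP[xa xb]; exists (Some i).
  by have [_ _ _ _ ab] := abS i; have [_ _ ? _] := graph_edge ab xa xb.
- case=> [i|]; last exact: (@cst_continuous KR B base).
  move=> x; apply: (@continuous_comp _ _ _ (edge_circle i) (lift (i := Some i))).
    exact: edge_circle_continuous.
  exact: lift_continuous.
- case=> [i|] x /= Cx; last by apply: to_bouquet_star; exact: prod0.
  have vertex c : \val x c = 1 -> forall j, \val x (a j) = 0 \/ \val x (b j) = 0.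
    move=> xc j; have out s : s != c -> \val x s = 0.
      move=> sc; have := realisation_sum x; rewrite (bigD1 c)//= xc -{2}[1]addr0.
      move=> /addrI/eqP; rewrite psumr_eq0 => [/allP h|t _]; last exact: realisation_ge0.
      by have := h s; rewrite mem_index_enum sc => /(_ isT)/eqP.
    have [_ _ _ _ ab] := abS j; have [ac|/out] := eqVneq (a j) c; last by left.
    by right; apply: out; rewrite -ac eq_sym.
  have corner c : \val x c = 1 -> to_bouquet x = lift (i := Some i) (edge_circle i x).
    by move=> /vertex x0; rewrite to_bouquet_star// edge_circle_star// (lift_base (Some i)).
  have [xa|xa] := eqVneq (\val x (a i)) 0; first by apply: (corner (b i)); rewrite -Cx xa add0r.
  have [xb|xb] := eqVneq (\val x (b i)) 0; first by apply: (corner (a i)); rewrite -Cx xb addr0.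
  exact: to_bouquet_edge.
Qed.


Definition tri_graph (i : 'I_m) (c : classical_sets.set_type (@circle R)) : KR :=
  exist (fun x => x \in @realisation_set R V K) (tri_point s0 (a i) (b i) (circle_tri1 c) (circle_tri2 c))
    (let: And5 aS bS _ _ _ := abS i in
     tri_point_in s0S aS bS (circle_on_triangle c)).

Lemma root_in : (fun s => (s == s0)%:R : R) \in @realisation_set R V K.
Proof.
apply: (@edge_point_in _ _ _ s0 s0 0) => //; first by rewrite lexx ler01.
by move=> s; rewrite mul0r addr0 subr0 mul1r.
Qed.

Definition root_point : KR := exist (fun x => x \in @realisation_set R V K) _ root_in.

Definition of_bouquet_summand (i : option 'I_m) : bouquet_summand R i -> KR :=
  if i is Some i then tri_graph i else fun=> root_point.

Lemma of_bouquet_base i : of_bouquet_summand (bouquet_base R i) = root_point.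
Proof.
case: i => [i|//]; apply: val_inj; apply/funext => s /=.
by rewrite circle_tri_base1 circle_tri_base2 /tri_point !mul0r !add0r !subr0 mul1r.
Qed.

Definition of_bouquet : B -> KR := wedge_fun (fun i => @of_bouquet_summand i).

Lemma of_bouquetE i c : of_bouquet (lift (i := i) c) = of_bouquet_summand c.
Proof. by apply: wedge_lift_funE => j k; rewrite !of_bouquet_base. Qed.

Lemma of_bouquet_continuous : continuous of_bouquet.
Proof.
apply: wedge_fun_continuous => [i|i j]; last by rewrite !of_bouquet_base.
case: i => [i|]; last exact: cst_continuous.
apply: continuous_set_type; apply: continuous_ptws => s.
by apply: tri_point_continuous; [exact: circle_tri1_continuous|exact: circle_tri2_continuous].
Qed.

(** Going to the bouquet and back is the stretching at time 1, so the stretching itself is the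
    required homotopy. *)
Lemma of_to_bouquet x : \val (of_bouquet (to_bouquet x)) = push_coord s0 (\val x) 1.
Proof.
have [[i [xa xb]]|no] := pselect (exists i, \val x (a i) != 0 /\ \val x (b i) != 0).
  have [aS bS as0 bs0 ab] := abS i; have tab := graph_on_triangle x ab.
  have t01 : 0 <= (1 : R) <= 1 by rewrite ler01 lexx.
  rewrite (to_bouquet_edge xa xb) of_bouquetE /= /edge_circle.
  rewrite tri_circle1K ?tri_circle2K; try exact: stretch_triangle.
  rewrite [in RHS](graph_edge_point ab as0 bs0 xa xb) push_coordE ?realisation_ge0//.
  by move=> e; rewrite e eqxx in bs0.
have x0 i : \val x (a i) = 0 \/ \val x (b i) = 0.
  have [?|xa] := eqVneq (\val x (a i)) 0; first by left.
  by right; apply/eqP/negPn/negP => xb; apply: no; exists i.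
rewrite (to_bouquet_star x0) of_bouquetE /=.
have [c [cS cs0 xE]] : exists c, [/\ c \in S, c != s0 & \val x = tri_point s0 c s0 (\val x c) 0].
  apply: (graph_star_point s0S) => // c d cd cs0 ds0.
  have [?|xc] := eqVneq (\val x c) 0; first by left.
  right; apply/eqP/negPn/negP => xd; have [cS dS _ _] := graph_edge cd xc xd.
  have [i /setP iE] := ab_onto cS dS cs0 ds0 cd.
  have nz s : s \in [set a i; b i] -> \val x s != 0.
    by rewrite iE in_set2 => /orP[] /eqP ->.
  by have [e|e] := x0 i; [have := nz (a i)|have := nz (b i)];
    rewrite e eqxx ?set21 ?set22 => /(_ isT).
have [u0 _ u1 _] := graph_on_triangle x cs0; have v0 := realisation_ge0 x s0.
rewrite xE push_coordE ?ler01// stretch0r ?stretch0l ?ler01//; last by apply/andP; split; lra.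
by apply/funext => s; rewrite /tri_point !mul0r !add0r !subr0 mul1r.
Qed.

(** The other composite is the stretching at time 1 on each circle, viewed as the boundary of a
    triangle, where the two sides at the root are collapsed. *)
Lemma to_bouquet_tri i c : to_bouquet (tri_graph i c) =
  lift (i := Some i) (tri_circle (stretch (circle_tri1 c) (circle_tri2 c) 1)
                                 (stretch (circle_tri2 c) (circle_tri1 c) 1)).
Proof.
have [aS bS as0 bs0 ab] := abS i; set x := tri_graph i c.
have xs s : s != s0 -> \val x s = circle_tri1 c * (s == a i)%:R + circle_tri2 c * (s == b i)%:R.
  by move=> ss0; rewrite /= /tri_point (negbTE ss0) mulr0 addr0.
have xa : \val x (a i) = circle_tri1 c by rewrite xs// eqxx (negbTE ab) mulr1 mulr0 addr0.
have xb : \val x (b i) = circle_tri2 c by rewrite xs// eqxx eq_sym (negbTE ab) mulr1 mulr0 add0r.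
rewrite -[in RHS]xa -[in RHS]xb -/(edge_circle i x).
have star : \val x (a i) = 0 \/ \val x (b i) = 0 -> to_bouquet x = lift (i := Some i) (edge_circle i x).
  move=> x0; rewrite edge_circle_star// (lift_base (Some i)); apply: to_bouquet_star => j.
  have [_ _ asj bsj abj] := abS j; rewrite !xs//.
  case: x0; rewrite ?xa ?xb => ->; rewrite !mul0r ?add0r ?addr0.
    have [e|_] := eqVneq (a j) (b i); last by left; rewrite mulr0.
    by right; rewrite -e eq_sym (negbTE abj) mulr0.
  have [e|_] := eqVneq (a j) (a i); last by left; rewrite mulr0.
  by right; rewrite -e eq_sym (negbTE abj) mulr0.
have [xa0|xa0] := eqVneq (\val x (a i)) 0; first by apply: star; left.
have [xb0|xb0] := eqVneq (\val x (b i)) 0; first by apply: star; right.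
exact: to_bouquet_edge.
Qed.

Lemma to_bouquet_root : to_bouquet root_point = base.
Proof.
by apply: to_bouquet_star => i; have [_ _ as0 _ _] := abS i; left; rewrite /= (negbTE as0).
Qed.

(** Joint continuity of a family of maps out of the wedge asks for closed base points. On the circle
    the base point is cut out by first coordinate 1. *)
Lemma closed_bouquet_base (i : option (ordinal m)) : closed [set bouquet_base R i]%classic.
Proof.
case: i => [i|]; last first.
  suff -> : [set bouquet_base R None]%classic = [set: bouquet_summand R (None : option 'I_m)]%classic by exact: closedT.
  by apply/seteqP; split => -[].
have [c1 _] := circle_coord_continuous R.
suff -> : [set bouquet_base R (Some i)]%classic =
    (fun c : classical_sets.set_type (@circle R) => (\val c).1) @^-1` [set y | y = 1]%classic.
  by apply: closed_comp; [move=> c _; exact: c1|exact: closed_eq].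
apply/seteqP; split => [c -> //|c /= e]; apply: val_inj.
have : (\val c).1 ^+ 2 + (\val c).2 ^+ 2 = 1 by have := set_valP c.
rewrite e expr1n -{2}[1]addr0 => /addrI/eqP; rewrite sqrf_eq0 => /eqP e2.
by rewrite [LHS]surjective_pairing e e2.
Qed.

Lemma graph_bouquet : homotopy_equivalent R KR B.
Proof.
exists to_bouquet, of_bouquet; split.
- exact: to_bouquet_continuous.
- exact: of_bouquet_continuous.
(* The stretching is run backwards, from the composite at time 0 to the identity at time 1. *)
- pose H (z : KR * R) : KR := insubd z.1 (push_coord s0 (\val z.1) (1 - z.2)).
  have HE x t : 0 <= t <= 1 -> \val (H (x, t)) = push_coord s0 (\val x) (1 - t).
    move=> /andP[t0 t1]; rewrite insubdK//; apply: push_coord_in => //.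
    by rewrite /=; apply/andP; split; lra.
  exists H; split.
  + apply: (within_realisation (f := fun z : KR * R => push_coord s0 (\val z.1) (1 - z.2))).
      move=> s; apply: push_coord_continuous.
        move=> c y; apply: (@continuous_comp _ _ _ (@fst KR R) (fun x : KR => \val x c)).
          exact: fst_continuous.
        exact: realisation_coord_continuous.
      by apply: rcontB; [exact: rcont_cst|exact: snd_continuous].
    by move=> [x t] [_ /=]; rewrite in_itv/=; exact: HE.
  + by move=> x; apply: val_inj; rewrite HE ?lexx ?ler01// subr0 -of_to_bouquet.
  + by move=> x; apply: val_inj; rewrite HE ?lexx ?ler01// subrr push_coord0.
(* Again reversed time, now clamped to the unit interval: the family of maps on the wedge is to be
   continuous for all real times, and the stretching stays on the triangle only for times between 0
   and 1. *)
- pose cl (t : R) := Num.min 1 (Num.max 0 (1 - t)).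
  have cl01 t : 0 <= cl t <= 1 by rewrite /cl le_min ler01 le_max lexx ge_min lexx.
  have ccl : continuous cl.
    apply: rcont_min; first exact: rcont_cst.
    apply: rcont_max; first exact: rcont_cst.
    by apply: rcontB; [exact: rcont_cst|move=> t; exact: cvg_id].
  pose F (t : R) (i : 'I_m) (c : classical_sets.set_type (@circle R)) :=
    tri_circle (stretch (circle_tri1 c) (circle_tri2 c) (cl t))
               (stretch (circle_tri2 c) (circle_tri1 c) (cl t)).
  pose k (i : option 'I_m) (t : R) : bouquet_summand R i -> B :=
    if i is Some i then fun c => lift (i := Some i) (F t i c) else fun=> base.
  have kb i t : k i t (bouquet_base R i) = base.
    case: i => [i|//]; rewrite /k /F /= circle_tri_base1 circle_tri_base2.
    have /andP[c0 _] := cl01 t.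
    by rewrite stretch0l// circle_base_tri (lift_base (Some i)).
  pose H (z : B * R) : B := wedge_fun (fun i => k i z.2) z.1.
  have HE i c t : H (lift (i := i) c, t) = k i t c.
    by apply: (wedge_lift_funE (f := fun i => k i t)) => ? ?; rewrite !kb.
  exists H; split.
  + apply: continuous_subspaceT.
    pose W t := @wedge_fun _ (@bouquet_summand R m) (@bouquet_base R m) B (fun i => k i t).
    have cu : continuous (uncurry W).
      apply: (@wedge_fun_joint_continuous _ (@bouquet_summand R m) (@bouquet_base R m) R B k) => [|i|t i j|i].
      * exact: finite_finset.
      * exact: closed_bouquet_base.
      * by rewrite !kb.
      * case: i => [i|]; last first.
          have -> : uncurry (k None) = fun=> base by apply/funext => -[].
          by move=> z; exact: cvg_cst.
        have c1 : continuous (fun z : R * classical_sets.set_type (@circle R) => circle_tri1 z.2).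
          move=> z; apply: (@continuous_comp _ _ _ snd (@circle_tri1 R)); first exact: snd_continuous.
          exact: circle_tri1_continuous.
        have c2 : continuous (fun z : R * classical_sets.set_type (@circle R) => circle_tri2 z.2).
          move=> z; apply: (@continuous_comp _ _ _ snd (@circle_tri2 R)); first exact: snd_continuous.
          exact: circle_tri2_continuous.
        have c3 : continuous (fun z : R * classical_sets.set_type (@circle R) => cl z.1).
          by move=> z; apply: (@continuous_comp _ _ _ fst cl); [exact: fst_continuous|exact: ccl].
        have cF : continuous (fun z : R * classical_sets.set_type (@circle R) => F z.1 i z.2).
          apply: tri_circle_continuous; try exact: stretch_continuous.
          by move=> z; apply: stretch_triangle => //; exact: circle_on_triangle.
        have -> : uncurry (k (Some i)) = lift (i := Some i) \o
            (fun z : R * classical_sets.set_type (@circle R) => F z.1 i z.2).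
          by apply/funext => -[].
        by move=> z; apply: continuous_comp; [exact: cF|exact: lift_continuous].
    have -> : H = uncurry W \o (fun z : B * R => (z.2, z.1)).
      by apply/funext => -[].
    move=> z; apply: (@continuous_comp _ _ _ (fun z : B * R => (z.2, z.1))); last exact: cu.
    by apply: pair_continuous; [exact: snd_continuous|exact: fst_continuous].
  + move=> z; have [->|[i [c ->]]] := bouquet_case z; rewrite HE /= of_bouquetE /=.
      by rewrite to_bouquet_root.
    by rewrite to_bouquet_tri /F (_ : cl 0 = 1)// /cl subr0 max_r ?ler01// minxx.
  + move=> z; have [->|[i [c ->]]] := bouquet_case z; rewrite HE //=.
    have [u0 v0 _ _] := circle_on_triangle c.
    rewrite /F (_ : cl 1 = 0); last by rewrite /cl subrr maxxx min_r ?ler01.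
    by rewrite !stretch0// circle_triK.
Qed.

End GraphBouquet.

Theorem theorem2p1 (R : realType) (V : finType) (G : simple_graph V)
    (hn : (3 <= #|V|)%N) (hG : connected_graph G) :
  let S := universal_vertices G in
  let k := #|S| in
  let K := realisation R (complete_graph S) in
  let X := realignment_complex G R in
  let actK := @complete_graph_act V G R in
  let actX := @realignment_complex_act V G R in
  (forall g : Aut_graph G, (\val g @: S)%SET = S) /\
  exists (iota : K -> X) (D : set X),
    [/\ [/\ topological_embedding iota,
            equivariant actK actX iota,
            invariant_set actX D,
            discrete_subset D
          & separated (range iota) D],
        equivariant_strong_deformation_retract R actX (range iota `|` D),
        forall x : X,
          connected_component [set: X] x `&` range iota = set0 ->
          contractible R (set_type (connected_component [set: X] x)),
        S != finset.set0 ->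
          exists x : X,
            range iota `<=` connected_component [set: X] x /\
            homotopy_equivalent R
              (set_type (connected_component [set: X] x)) K
      & (2 <= k)%N ->
          homotopy_equivalent R K (bouquet R (((k - 1) * (k - 2)) %/ 2))].
Proof.
move=> S k K X actK actX; split; first exact: universal_vertices_imset.
pose iota := @graph_incl V G hn R; pose D : set X := supported (islands G).
have emb : topological_embedding iota by exact: graph_incl_embedding.
have disc : discrete_subset D by exact: islands_discrete.
have sep : separated (range iota) D.
  by rewrite /iota range_graph_incl; exact: std_islands_separated.
have esdr := final_deformation G hn R.
exists iota, D; split => //.
- split => //; last exact: islands_invariant.
  by move=> g z; exact: graph_incl_equivariant.
- have [H [cH H0 H1 Hfix _]] := esdr.
  move=> x; exact: (contractible_component cH H0 disc H1).
- have [H [cH H0 H1 Hfix _]] := esdr.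
  move=> S0; have /finset.set0Pn[s sS] := S0.
  have l01 : 0 <= (0 : R) <= 1 by rewrite lexx ler01.
  have [z _] := graph_point_exists sS sS l01.
  exists (iota z); apply: (main_component cH H0 emb sep H1 Hfix).
  exact: graph_connected.
- rewrite /k => k2; have /card_gt0P[s0 s0S] : (0 < #|S|)%N by apply: leq_trans k2.
  have [a [b [abS ab_onto ab_inj]]] := pair_index s0S.
  exact: (graph_bouquet R s0S k2 abS ab_onto ab_inj).
Qed.
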